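(* Let $p\in(0,1)$ be fixed. For each $n$ let $\alpha=\alpha^{(n)}\in\mathbb{R}^{d}$, $d=d_n$, be a nonzero vector with non-negative entries. If $\left(\frac{\|\alpha\|_2}{\|\alpha\|_4}\right)^4/n^3\to\infty$ as $n\to\infty$, then $$\mathrm{Ent}\left[W(n,\alpha)\,\|\,M(n)\right]\to 0\quad\text{as } n\to\infty.$$
   Context: For $v\in\mathbb{R}^d$ and $q\ge 1$, $\|v\|_q=(\sum_i|v_i|^q)^{1/q}$. Let $\mathbb{Y}$ be a random $n\times d$ matrix whose rows are i.i.d. with law $\mathcal{N}(0,D_\alpha)$, $D_\alpha=\mathrm{diag}(\alpha)$ (centered Gaussian with covariance $D_\alpha$). Define $W(n,\alpha)=\mathbb{Y}\mathbb{Y}^T/\|\alpha\|_2-\mathrm{diag}\left(\mathbb{Y}\mathbb{Y}^T/\|\alpha\|_2\right)$, i.e. the symmetric $n\times n$ matrix with zero diagonal whose $(i,j)$ entry for $i\ne j$ is $\langle\gamma_i,\gamma_j\rangle/\|\alpha\|_2$, where $\gamma_1,\dots,\gamma_n$ are the rows of $\mathbb{Y}$. $M(n)$ is the symmetric $n\times n$ random matrix with zero diagonal whose entries above the diagonal are i.i.d. standard normal random variables. Both matrices are identified with the random vectors of their entries above the diagonal, in $\mathbb{R}^{\binom n2}$. For random vectors $X,Y$ with densities $f,g$, the relative entropy is $\mathrm{Ent}[X\|Y]=\int f(x)\ln\left(\frac{f(x)}{g(x)}\right)dx$ (with value $+\infty$ if the law of $X$ is not absolutely continuous with respect to the law of $Y$).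 The dimension $d$ and the vector $\alpha$ are allowed to depend on $n$. *)

(* Defs.v *)
From HB Require Import structures.
From mathcomp Require Import all_boot all_order all_algebra.
From mathcomp Require Import all_classical all_reals all_analysis.
From mathcomp Require Import measurable_realfun.

Set Implicit Arguments.
Unset Strict Implicit.
Unset Printing Implicit Defensive.

Import Order.TTheory GRing.Theory Num.Theory.
Import numFieldNormedType.Exports.

Local Open Scope classical_set_scope.
Local Open Scope ring_scope.

Section product_of_measures.
Context {d : measure_display} {T : measurableType d} {R : realType}.

Definition cons_pair (n : nat) (x : T * n.-tuple T) : n.+1.-tuple T :=
  [tuple of x.1 :: x.2].

Lemma measurable_cons_pair (n : nat) :
  measurable_fun [set: T * n.-tuple T] (@cons_pair n).
Proof. by apply: measurable_cons => //=. Qed.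

HB.instance Definition _ (n : nat) :=
  isMeasurableFun.Build _ _ _ _ (@cons_pair n) (@measurable_cons_pair n).

Definition cons_measure (n : nat) (m1 : {sigma_finite_measure set T -> \bar R})
    (m2 : {sigma_finite_measure set (n.-tuple T) -> \bar R})
    : set (n.+1.-tuple T) -> \bar R :=
  pushforward (m1 \x m2)%E (@cons_pair n).

Section cons_measure_measure.
Variables (n : nat) (m1 : {sigma_finite_measure set T -> \bar R})
  (m2 : {sigma_finite_measure set (n.-tuple T) -> \bar R}).

Let cons_measure0 : cons_measure m1 m2 set0 = 0%E.
Proof. exact: measure0. Qed.

Let cons_measure_ge0 A : (0 <= cons_measure m1 m2 A)%E.
Proof. exact: measure_ge0. Qed.

Let cons_measure_sigma_additive : semi_sigma_additive (cons_measure m1 m2).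
Proof. exact: measure_semi_sigma_additive. Qed.

HB.instance Definition _ := isMeasure.Build _ _ _ (cons_measure m1 m2)
  cons_measure0 cons_measure_ge0 cons_measure_sigma_additive.

Let split_tuple (t : n.+1.-tuple T) : T * n.-tuple T :=
  (thead t, [tuple of behead t]).

Let cons_pairK : cancel (@cons_pair n) split_tuple.
Proof.
by case=> a t; congr pair; apply/val_inj.
Qed.

Let measurable_split_tuple : measurable_fun setT split_tuple.
Proof.
apply: measurable_fun_pair; last exact: measurable_behead.
exact: measurable_tnth.
Qed.

Let cons_measure_sigma_finite : sigma_finite setT (cons_measure m1 m2).
Proof.
have /sigma_finiteP[F [TF ndF Foo]] := sigma_finiteT m1.
have /sigma_finiteP[G [TG ndG Goo]] := sigma_finiteT m2.
exists (fun k => split_tuple @^-1` (F k `*` G k)).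
  rewrite -preimage_bigcup -[LHS](preimage_setT split_tuple); congr (_ @^-1` _).
  rewrite -setXTT TF TG predeqE => -[x y]; split.
    move=> [/= [i _ Fix] [k _ Gky]]; exists (maxn i k) => //; split.
    - by move: x Fix; exact/subsetPset/ndF/leq_maxl.
    - by move: y Gky; exact/subsetPset/ndG/leq_maxr.
  by move=> [i _ []/= ? ?]; split; exists i.
move=> k; have [? ?] := Foo k; have [? ?] := Goo k; split.
  rewrite -[X in measurable X]setTI; apply: measurable_split_tuple => //.
  exact: measurableX.
rewrite /cons_measure /pushforward -comp_preimage.
rewrite (_ : split_tuple \o _ = id); last by apply/funext => x /=; exact: cons_pairK.
by rewrite preimage_id product_measure1E// lte_mul_pinfty// ge0_fin_numE.
Qed.

HB.instance Definition _ := Measure_isSigmaFinite.Build _ _ _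
  (cons_measure m1 m2) cons_measure_sigma_finite.

End cons_measure_measure.

(* mu_0 x ... x mu_(n-1) on T^n *)
Fixpoint prod_measure (n : nat) :
    ('I_n -> {sigma_finite_measure set T -> \bar R}) ->
    {sigma_finite_measure set (n.-tuple T) -> \bar R} :=
  match n with
  | 0 => fun=> \d_([tuple] : 0.-tuple T)
  | m.+1 => fun mu =>
      cons_measure (mu ord0) (prod_measure (fun i => mu (lift ord0 i)))
  end.

(* On boxes the product measure is the product of the measures of the sides,
   which characterizes it. *)
Lemma prod_measure_box (n : nat)
    (mu : 'I_n -> {sigma_finite_measure set T -> \bar R}) (A : 'I_n -> set T) :
  (forall i, measurable (A i)) ->
  prod_measure mu [set t | forall i, A i (tnth t i)] =
    (\prod_(i < n) mu i (A i))%E.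
Proof.
elim: n mu A => [|n IH] mu A mA.
  rewrite big_ord0 /= diracE mem_set//.
  by case.
rewrite big_ord_recl /= /cons_measure /pushforward.
rewrite (_ : _ @^-1` _ =
    A ord0 `*` [set t | forall i, A (lift ord0 i) (tnth t i)]); last first.
  apply/seteqP; split => [[a t] /= H|[a t] /= [Aa At] i].
    split; first exact: (H ord0).
    by move=> i; have := H (lift ord0 i); rewrite tnthS.
  case: (unliftP ord0 i) => [j ->|->]; last exact: Aa.
  by rewrite tnthS; exact: At.
rewrite product_measure1E//; first by rewrite -IH.
rewrite (_ : [set t | _] = \bigcap_(i in [set: 'I_n])
    ((fun t : n.-tuple T => tnth t i) @^-1` A (lift ord0 i))); last first.
  by apply/seteqP; split => [t H i _|t H i]; [exact: H|exact: (H i)].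
apply: fin_bigcap_measurable => // i _.
by rewrite -[X in measurable X]setTI; exact: measurable_tnth.
Qed.

End product_of_measures.

Section random_variables.
Context {R : realType} {d d' : measure_display}.
Context {T : measurableType d} {T' : measurableType d'} (P : probability T R).

Definition has_law (X : {RV P >-> T'}) (mu : set T' -> \bar R) :=
  forall A : set T', measurable A -> distribution P X A = mu A.

Definition mutually_independent (I : finType) (X : I -> {RV P >-> T'}) :=
  forall (J : {set I}) (A : I -> set T'), (forall i, measurable (A i)) ->
    P (\bigcap_(i in [set` J]) (X i @^-1` A i)) =
    (\prod_(i in J) P (X i @^-1` A i))%E.

End random_variables.

Section random_vectors.
Context {R : realType} {d : measure_display} {T : measurableType d}.
Context (P : probability T R).

(* [measurableTypeR R] has the same measurable sets as [R], but another
   display; it is the one carrying [lebesgue_measure] and [normal_prob]. *)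
Definition tuple_of_rvs (n : nat) (X : 'I_n -> {RV P >-> R}) (w : T) :
  n.-tuple (measurableTypeR R) := [tuple X i w | i < n].

Lemma measurable_tuple_of_rvs (n : nat) (X : 'I_n -> {RV P >-> R}) :
  measurable_fun setT (tuple_of_rvs X).
Proof.
apply/measurable_fun_tnthP => i.
rewrite (_ : _ \o _ = X i); first exact: (measurable_funPT (X i)).
by apply/funext => w /=; rewrite tnth_mktuple.
Qed.

HB.instance Definition _ (n : nat) (X : 'I_n -> {RV P >-> R}) :=
  isMeasurableFun.Build _ _ _ _ (tuple_of_rvs X) (measurable_tuple_of_rvs X).

Definition random_tuple (n : nat) (X : 'I_n -> {RV P >-> R}) :
  {RV P >-> n.-tuple (measurableTypeR R)} := tuple_of_rvs X.

End random_vectors.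

Section gaussian_and_entropy.
Context {R : realType}.

(* N(0, v); the library's [normal_prob 0 0] is not the Dirac mass at 0. *)
Definition gaussian1 (v : R) :
    {sigma_finite_measure set (measurableTypeR R) -> \bar R} :=
  if v == 0 then
    [the {sigma_finite_measure set _ -> \bar _} of \d_(0 : measurableTypeR R)]
  else
    [the {sigma_finite_measure set _ -> \bar _} of normal_prob 0 (Num.sqrt v)].

(* N(0, diag(a)): the coordinates are independent, the j-th one with variance
   a_j (possibly 0). *)
Definition gaussian_diag (k : nat) (a : 'rV[R]_k) :
    {sigma_finite_measure set (k.-tuple (measurableTypeR R)) -> \bar R} :=
  prod_measure (fun j => gaussian1 (a 0 j)).

Definition lebesgue (m : nat) :
    {sigma_finite_measure set (m.-tuple (measurableTypeR R)) -> \bar R} :=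
  prod_measure (fun=> lebesgue_measure).

Definition density (m : nat) (mu : probability (m.-tuple (measurableTypeR R)) R)
    (x : m.-tuple (measurableTypeR R)) : R :=
  fine (Radon_Nikodym (charge_of_finite_measure mu) (lebesgue m) x).

(* Meaningful when [nu] has a density; then so does [mu] in the first branch. *)
Definition relative_entropy (m : nat)
    (mu nu : probability (m.-tuple (measurableTypeR R)) R) : \bar R :=
  if pselect (mu `<< nu) then
    (\int[lebesgue m]_x
       (density mu x * ln (density mu x / density nu x))%:E)%E
  else +oo%E.

Definition Ent {d d' : measure_display} {T : measurableType d}
    {T' : measurableType d'} (P : probability T R) (Q : probability T' R)
    (m : nat) (X : {RV P >-> m.-tuple (measurableTypeR R)})
    (Y : {RV Q >-> m.-tuple (measurableTypeR R)}) : \bar R :=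
  relative_entropy (distribution P X) (distribution Q Y).

Definition lnorm (q : R) (k : nat) (v : 'rV[R]_k) : R :=
  (\sum_(i < k) `|v 0 i| `^ q) `^ q^-1.

End gaussian_and_entropy.

(* Index set of the entries above the diagonal; R^('C(n, 2)) is rendered as
   [#|above n|.-tuple (measurableTypeR R)]. *)
Definition above (n : nat) : {set 'I_n * 'I_n} :=
  [set ij : 'I_n * 'I_n | (ij.1 < ij.2)%N]%SET.

Lemma card_above (n : nat) : #|above n| = 'C(n, 2).
Proof.
rewrite -bin2_sum -sum1_card.
under eq_bigl do rewrite inE.
rewrite -(pair_big_dep xpredT (fun i j : 'I_n => (i < j)%N) (fun _ _ => 1%N))/=.
rewrite (exchange_big_dep xpredT)//= big_mkord.
apply: eq_bigr => j _.
by rewrite (big_ord_narrow (ltnW (ltn_ord j))) sum1_card card_ord.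
Qed.

Section random_matrices.
Context {R : realType} {d : measure_display} {T : measurableType d}.
Context (P : probability T R).

Definition random_matrix (m n : nat) := 'I_m -> 'I_n -> {RV P >-> R}.

Definition mx_value (m n : nat) (X : random_matrix m n) (w : T) : 'M[R]_(m, n) :=
  \matrix_(i, j) X i j w.

Definition iid_gaussian_rows (n k : nat) (a : 'rV[R]_k) (Y : random_matrix n k) :=
  mutually_independent (fun i => random_tuple (Y i)) /\
  forall i, has_law (random_tuple (Y i)) (gaussian_diag a).

Definition gaussian_symmetric_zero_diag (n : nat) (M : random_matrix n n) :=
  [/\ forall i j w, M i j w = M j i w,
      forall i w, M i i w = 0,
      mutually_independent
        (fun k : 'I_#|above n| => M (enum_val k).1 (enum_val k).2)
    & forall i j : 'I_n, (i < j)%N -> has_law (M i j) (normal_prob 0 1)].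

Definition upper (n : nat) (M : random_matrix n n) :
    {RV P >-> #|above n|.-tuple (measurableTypeR R)} :=
  random_tuple (fun k => M (enum_val k).1 (enum_val k).2).

Definition Wmx (n k : nat) (a : 'rV[R]_k) (Y : 'M[R]_(n, k)) : 'M[R]_n :=
  let G := (lnorm 2 a)^-1 *: (Y *m Y^T) in G - diag_mx (\row_i G i i).

Definition Wentry (n k : nat) (a : 'rV[R]_k) (Y : random_matrix n k)
    (i j : 'I_n) (w : T) : R := Wmx a (mx_value Y w) i j.

Lemma measurable_Wentry (n k : nat) (a : 'rV[R]_k) (Y : random_matrix n k) i j :
  measurable_fun setT (Wentry a Y i j).
Proof.
have mG (i' j' : 'I_n) : measurable_fun setT
    (fun w => ((lnorm 2 a)^-1 *: (mx_value Y w *m (mx_value Y w)^T)) i' j').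
  rewrite (_ : (fun w => _) = fun w =>
      (lnorm 2 a)^-1 * \sum_(l < k) (Y i' l w * Y j' l w)); last first.
    by apply/funext => w; rewrite !mxE; under eq_bigr do rewrite !mxE.
  apply: measurable_funM => //; apply: measurable_sum => l.
  by apply: measurable_funM; exact: measurable_funPT.
rewrite (_ : Wentry a Y i j = fun w =>
    ((lnorm 2 a)^-1 *: (mx_value Y w *m (mx_value Y w)^T)) i j -
    ((lnorm 2 a)^-1 *: (mx_value Y w *m (mx_value Y w)^T)) i i *+ (i == j));
    last first.
  by apply/funext => w; rewrite /Wentry /Wmx [LHS]mxE; congr (_ + _);
    rewrite mxE [in LHS]mxE [in LHS]mxE.
apply: measurable_funB; first exact: mG.
case: (i == j); first exact: mG.
exact: measurable_cst.
Qed.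

HB.instance Definition _ (n k : nat) (a : 'rV[R]_k) (Y : random_matrix n k) i j :=
  isMeasurableFun.Build _ _ _ _ (Wentry a Y i j) (measurable_Wentry a Y i j).

Definition W (n k : nat) (a : 'rV[R]_k) (Y : random_matrix n k) :
  random_matrix n n := fun i j => Wentry a Y i j.

End random_matrices.

(* Main.v *)
(* Put a = alpha / |alpha|_2. The entropy is bounded through the
   Donsker-Varadhan inequality: it is at most B as soon as
   E G(W) <= ln E exp G(M) + B for every bounded measurable G >= 0.

   The entries of W are replaced one column at a time. Column t of W is
   (<row i, row t>_a)_(i < t); conditionally on the other rows it is Gaussian,
   with covariance a submatrix of the Gram matrix Sigma = U U^T of the rows
   scaled by a. Jensen's inequality against the density of U z (z standard
   Gaussian) compares this column with a standard Gaussian vector, at the cost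
   (tr Sigma - n - ln det Sigma) / 2. The trace has expectation n, and
   - ln det Sigma / 2 <= det(Sigma)^(-1/2) - 1, where det(Sigma)^(-1/2) is
   J(Sigma) = \int exp (- y^T Sigma y / 2) dy divided by (2 pi)^(n/2). Hence
   Ent <= n (E J(Sigma) / (2 pi)^(n/2) - 1).

   By Tonelli the expectation is explicit:
   E J(Sigma) = \int \prod_k (1 + a_k^2 |y|^2)^(-1/2) dy. Since
   \sum_k a_k^2 = 1 the integrand is exp (- |y|^2 / 2) up to a factor
   1 + O(eps |y|^4) with eps = \sum_k a_k^4 = (|alpha|_4 / |alpha|_2)^4. This
   gives Ent = O(n^3 eps + 1 / n). *)

From HB Require Import structures.
Require Import Defs.
From mathcomp Require Import all_boot all_order all_algebra.
From mathcomp Require Import all_classical all_reals all_analysis.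
From mathcomp Require Import measurable_realfun ring lra.

Set Implicit Arguments.
Unset Strict Implicit.
Unset Printing Implicit Defensive.

Import Order.TTheory GRing.Theory Num.Theory.
Import numFieldNormedType.Exports.

Local Open Scope classical_set_scope.
Local Open Scope ring_scope.

(** * Product measures and independent families *)

(** No chain rule for relative entropy and no conditional law is needed: the functional [hybrid]
    averages the Gaussian columns inside ln E exp and the Gram columns outside, so that the
    replacement of one column is a single use of [gauss_variational]. The obstacle is that the Gram
    matrix may be singular and that the expectation of its log-determinant is hard to control.
    [Jint] settles both: it is [+oo] in the singular case, where the inequality is trivial, and as
    an integral of a positive function it needs only Tonelli. The identity
    [Jint S * Jint (invmx S) = gnorm n ^+ 2] stands in for det (S^-1) = 1 / det S. Working with all
    n rows at every column, not only with those before t, makes the cost the same each time: delta =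
    2 e^3 eps n^2 + n^-2, and n steps give n delta. The two terms of delta come from |y|^2 <= n^2,
    where the Gaussian factor dominates, and from |y|^2 > n^2, where n^3 eps <= 1 and n >= 400
    secure a polynomial decay strong enough to be integrated. *)

Lemma tonelli {d1 d2 : measure_display} {T1 : measurableType d1}
    {T2 : measurableType d2} {R : realType}
    (m1 : {sigma_finite_measure set T1 -> \bar R})
    (m2 : {sigma_finite_measure set T2 -> \bar R}) (f : T1 -> T2 -> \bar R) :
  measurable_fun setT (fun z => f z.1 z.2) -> (forall x y, 0 <= f x y)%E ->
  (\int[m1]_x \int[m2]_y f x y = \int[m2]_y \int[m1]_x f x y)%E.
Proof.
move=> mf f0.
exact: (@fubini_tonelli _ _ _ _ _ m1 m2 (fun z => f z.1 z.2) mf (fun z => f0 _ _)).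
Qed.

Lemma measurable_integral_snd {d1 d2 : measure_display} {T1 : measurableType d1}
    {T2 : measurableType d2} {R : realType}
    (m : {sigma_finite_measure set T2 -> \bar R}) (f : T1 -> T2 -> \bar R) :
  measurable_fun setT (fun z => f z.1 z.2) -> (forall x y, 0 <= f x y)%E ->
  measurable_fun setT (fun x => \int[m]_y f x y)%E.
Proof.
move=> mf f0; exact: (@measurable_fun_fubini_tonelli_F _ _ _ _ _ m
  (fun z => f z.1 z.2) mf (fun z => f0 _ _)).
Qed.

Section product_measure_theory.
Context {d : measure_display} {T : measurableType d} {R : realType}.

Definition box (n : nat) (A : 'I_n -> set T) : set (n.-tuple T) :=
  [set t | forall i, A i (tnth t i)].

Lemma measurable_box (n : nat) (A : 'I_n -> set T) :
  (forall i, measurable (A i)) -> measurable (box A).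
Proof.
move=> mA; rewrite (_ : box A = \bigcap_(i in [set: 'I_n])
    ((fun t : n.-tuple T => tnth t i) @^-1` A i)); last first.
  by apply/seteqP; split => [t H i _|t H i]; [exact: H|exact: (H i)].
apply: fin_bigcap_measurable => // i _.
by rewrite -[X in measurable X]setTI; exact: measurable_tnth.
Qed.

(** Boxes, unlike preimages under a single coordinate, are stable under intersection, as uniqueness
    of measures requires of a generating family. *)
Lemma measurable_boxE (n : nat) :
  measurable = <<s [set B : set (n.-tuple T) |
    exists2 A : 'I_n -> set T, forall i, measurable (A i) & B = box A] >>.
Proof.
apply/seteqP; split; last first.
  apply: smallest_sub; first exact: sigma_algebra_measurable.
  by move=> _ [A mA ->]; exact: measurable_box.
apply: smallest_sub; first exact: smallest_sigma_algebra.
move=> B; rewrite -bigcup_seq /= => -[i _ [C mC <-]].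
apply: sub_sigma_algebra.
exists (fun j => if j == i then C else setT); first by move=> j; case: ifP.
rewrite setTI; apply/seteqP; split => [t Ct j|t /(_ i)]; last by rewrite eqxx.
by case: eqP => // ->.
Qed.

Lemma prod_measure_unique (n : nat)
    (mu : 'I_n -> {sigma_finite_measure set T -> \bar R})
    (m : {measure set (n.-tuple T) -> \bar R}) :
  (forall i, mu i setT = 1%E) ->
  (forall A : 'I_n -> set T, (forall i, measurable (A i)) ->
    m (box A) = (\prod_(i < n) mu i (A i))%E) ->
  forall A, measurable A -> m A = prod_measure mu A.
Proof.
move=> mu1 mE; apply: (measure_unique _ (fun=> setT) (@measurable_boxE n)).
- move=> _ _ [A mA ->] [B mB ->]; exists (fun i => A i `&` B i).
    by move=> i; exact: measurableI.
  apply/seteqP; split => [t [At Bt] i|t H]; first by split; [exact: At|exact: Bt].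
  by split => i; have [] := H i.
- move=> _; exists (fun=> setT) => //.
  by apply/seteqP; split.
- by rewrite bigcup_const//; exists 0%N.
- by move=> _ [A mA ->]; rewrite mE// [RHS]prod_measure_box.
- move=> _; rewrite (_ : setT = box (fun=> setT)); last first.
    by apply/seteqP; split.
  rewrite mE//; under eq_bigr do rewrite mu1.
  by rewrite big1 ?ltry.
Qed.

Lemma prod_measure_setT (n : nat)
    (mu : 'I_n -> {sigma_finite_measure set T -> \bar R}) :
  (forall i, mu i setT = 1%E) -> prod_measure mu setT = 1%E.
Proof.
move=> mu1; rewrite (_ : setT = box (fun=> setT)); last first.
  by apply/seteqP; split.
rewrite [LHS]prod_measure_box//; under eq_bigr do rewrite mu1.
by rewrite big1.
Qed.

Lemma ge0_integral_prod_measureS (n : nat)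
    (mu : 'I_n.+1 -> {sigma_finite_measure set T -> \bar R})
    (f : n.+1.-tuple T -> \bar R) :
  measurable_fun setT f -> (forall t, 0 <= f t)%E ->
  (\int[prod_measure mu]_t f t =
   \int[mu ord0]_x \int[prod_measure (fun i => mu (lift ord0 i))]_t
     f (cons_pair (x, t)))%E.
Proof.
move=> mf f0; rewrite /= /cons_measure ge0_integral_pushforward//.
rewrite fubini_tonelli1// => [|x]; last exact: f0.
by apply: measurableT_comp => //; exact: measurable_cons_pair.
Qed.

(** The order used in [Jint_schur], where the first coordinate is integrated out while the others
    stay fixed. *)
Lemma ge0_integral_prod_measureSr (n : nat)
    (mu : 'I_n.+1 -> {sigma_finite_measure set T -> \bar R})
    (f : n.+1.-tuple T -> \bar R) :
  measurable_fun setT f -> (forall t, 0 <= f t)%E ->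
  (\int[prod_measure mu]_t f t =
   \int[prod_measure (fun i => mu (lift ord0 i))]_t \int[mu ord0]_x
     f (cons_pair (x, t)))%E.
Proof.
move=> mf f0; rewrite ge0_integral_prod_measureS//.
have mfc : measurable_fun setT (f \o @cons_pair _ T n).
  by apply: measurableT_comp => //; exact: measurable_cons_pair.
exact: (tonelli _ _ (f := fun x t => f (cons_pair (x, t))) mfc (fun x t => f0 _)).
Qed.

Lemma integral_prod_measure0 (mu : 'I_0 -> {sigma_finite_measure set T -> \bar R})
    (f : 0.-tuple T -> \bar R) :
  measurable_fun setT f -> (forall t, 0 <= f t)%E ->
  (\int[prod_measure mu]_t f t = f [tuple])%E.
Proof. by move=> mf f0; rewrite /= integral_dirac// diracE mem_set// mul1e. Qed.

Lemma ge0_integral_prod_tnth (n : nat)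
    (mu : 'I_n -> {sigma_finite_measure set T -> \bar R}) (g : 'I_n -> T -> R) :
  (forall i, measurable_fun setT (g i)) -> (forall i x, 0 <= g i x) ->
  (\int[prod_measure mu]_t (\prod_(i < n) g i (tnth t i))%:E =
   \prod_(i < n) \int[mu i]_x (g i x)%:E)%E.
Proof.
elim: n mu g => [|n IH] mu g mg g0.
  rewrite integral_prod_measure0 ?big_ord0//.
    by apply/measurable_EFinP; apply: measurable_prod => -[].
  by move=> t; rewrite big_ord0 lee_fin.
have mgt m (h : 'I_m -> T -> R) : (forall i, measurable_fun setT (h i)) ->
    measurable_fun setT (fun t : m.-tuple T => (\prod_(i < m) h i (tnth t i))%:E).
  move=> mh; apply/measurable_EFinP; apply: measurable_prod => i _.
  by apply: measurableT_comp => //; exact: measurable_tnth.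
rewrite ge0_integral_prod_measureS//; last 2 first.
- by apply: (mgt n.+1 g).
- by move=> t; rewrite lee_fin prodr_ge0.
rewrite big_ord_recl -IH//.
transitivity (\int[mu ord0]_x ((g ord0 x)%:E *
   (\int[prod_measure (fun i => mu (lift ord0 i))]_t
     (\prod_(i < n) g (lift ord0 i) (tnth t i))%:E)))%E.
  apply: eq_integral => x _; rewrite -ge0_integralZl//.
  - apply: eq_integral => t _; rewrite big_ord_recl EFinM; congr (_ * _%:E)%E.
    by apply: eq_bigr => i _; rewrite tnthS.
  - by apply: (mgt n (fun i => g (lift ord0 i))).
  - by move=> t _; rewrite lee_fin prodr_ge0.
  - by rewrite lee_fin.
rewrite ge0_integralZr//; first exact/measurable_EFinP.
- by move=> x _; rewrite lee_fin.
- by apply: integral_ge0 => t _; rewrite lee_fin prodr_ge0.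
Qed.

End product_measure_theory.

Section independent_families.
Context {d d' : measure_display} {S : measurableType d} {T : measurableType d'}
  {R : realType} (m : {measure set S -> \bar R}).

(** Boxes over the whole index type suffice: a side equal to the full space has mass 1, which yields
    every subfamily. The index type is arbitrary so that rows, matrix entries and disjoint unions of
    families are all covered. *)
Definition indep_family (I : finType) (X : I -> S -> T)
    (mu : I -> {sigma_finite_measure set T -> \bar R}) :=
  [/\ forall i, measurable_fun setT (X i),
      forall i, mu i setT = 1%E &
      forall A : I -> set T, (forall i, measurable (A i)) ->
        m [set w | forall i, A i (X i w)] = (\prod_i mu i (A i))%E].

Definition select (I : Type) (X : I -> S -> T) (k : nat) (s : 'I_k -> I) (w : S) :
  k.-tuple T := [tuple X (s i) w | i < k].

Lemma measurable_select (I : Type) (X : I -> S -> T) (k : nat) (s : 'I_k -> I) :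
  (forall i, measurable_fun setT (X i)) -> measurable_fun setT (select X s).
Proof.
move=> mX; apply/measurable_fun_tnthP => i.
rewrite (_ : _ \o _ = X (s i)); first exact: mX.
by apply/funext => w /=; rewrite tnth_mktuple.
Qed.

(** Indices outside the image of [s] are marginalized: there [B i] is the whole space, of mass 1.
    Injectivity of [s] makes [A j] the only constraint at the index [s j]. *)
Lemma indep_family_prod_measure (I : finType) (X : I -> S -> T)
    (mu : I -> {sigma_finite_measure set T -> \bar R}) (k : nat) (s : 'I_k -> I) :
  indep_family X mu -> injective s ->
  forall A, measurable A ->
    m (select X s @^-1` A) = prod_measure (mu \o s) A.
Proof.
move=> [mX mu1 mE] injs A mA.
pose h := select X s.
have mh : measurable_fun setT h by exact: measurable_select.
pose hM := isMeasurableFun.Build _ _ _ _ h mh.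
pose H : {mfun S >-> k.-tuple T} := HB.pack h hM.
have -> : m (h @^-1` A) = pushforward m H A by [].
apply: prod_measure_unique mA => [i|{}A mA]; first exact: mu1.
rewrite /= /pushforward /=.
pose B (i : I) : set T := [set x | forall j, s j = i -> A j x].
have Bs j : B (s j) = A j.
  by apply/seteqP; split => [x|x Ax j' /injs -> //]; apply.
have BnT i : (forall j, s j != i) -> B i = setT.
  by move=> ns; apply/seteqP; split => // x _ j sj; have := ns j; rewrite sj eqxx.
have mB i : measurable (B i).
  have [[j <-]|ns] := pselect (exists j, s j = i); first by rewrite Bs.
  by rewrite BnT// => j; apply/eqP => sj; apply: ns; exists j.
rewrite (_ : _ @^-1` _ = [set w | forall i, B i (X i w)]); last first.
  apply/seteqP; split => [w /= H1 i j si|w /= H1 j].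
    by have := H1 j; rewrite tnth_mktuple si.
  by rewrite tnth_mktuple; exact: H1.
rewrite mE// [RHS](partition_big s xpredT)//=; apply: eq_bigr => i _.
have [[j <-]|ns] := pselect (exists j, s j = i).
  by rewrite Bs (big_pred1 j)// => j' /=; rewrite (inj_eq injs).
have nsi j : s j != i by apply/eqP => sj; apply: ns; exists j.
by rewrite BnT// mu1 big1// => j; rewrite (negbTE (nsi j)).
Qed.

Lemma ge0_integral_indep_family (I : finType) (X : I -> S -> T)
    (mu : I -> {sigma_finite_measure set T -> \bar R}) (k : nat) (s : 'I_k -> I)
    (f : k.-tuple T -> \bar R) :
  indep_family X mu -> injective s ->
  measurable_fun setT f -> (forall t, 0 <= f t)%E ->
  (\int[m]_w f (select X s w) = \int[prod_measure (mu \o s)]_t f t)%E.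
Proof.
move=> iX injs mf f0.
pose h := select X s.
have mh : measurable_fun setT h by apply: measurable_select; case: iX.
pose hM := isMeasurableFun.Build _ _ _ _ h mh.
pose H : {mfun S >-> k.-tuple T} := HB.pack h hM.
transitivity (\int[pushforward m H]_t f t)%E.
  by rewrite (ge0_integral_pushforward mh)// => t _; exact: f0.
by apply: eq_measure_integral => A mA _; exact: indep_family_prod_measure.
Qed.

End independent_families.

(** * One-dimensional Gaussian integrals *)

Import HBNNSimple.

(** By monotone convergence both sides are limits along the same increasing simple functions; for a
    simple function the identity is the hypothesis on [nu], summed over the level sets. *)
Lemma ge0_integral_density {d : measure_display} {S : measurableType d}
    {R : realType} (m nu : {measure set S -> \bar R}) (phi : S -> R)
    (f : S -> \bar R) :
  measurable_fun setT phi -> (forall x, 0 <= phi x) ->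
  (forall A, measurable A -> nu A = \int[m]_(x in A) (phi x)%:E)%E ->
  measurable_fun setT f -> (forall x, 0 <= f x)%E ->
  (\int[nu]_x f x = \int[m]_x (f x * (phi x)%:E))%E.
Proof.
move=> mphi phi0 nuE mf f0.
pose h := nnsfun_approx measurableT mf.
have hf x : (h n x)%:E @[n --> \oo] --> f x by exact: cvg_nnsfun_approx.
have mphiE : measurable_fun setT (EFin \o phi) by exact/measurable_EFinP.
have -> : (\int[nu]_x f x = lim (\int[nu]_x (h n x)%:E @[n --> \oo]))%E.
  rewrite -monotone_convergence//=.
  - by apply: eq_integral => x _; apply/esym/cvg_lim.
  - by move=> n; exact/measurable_EFinP.
  - by move=> n x _; rewrite lee_fin.
  - by move=> x _ a b ab; rewrite lee_fin; exact/lefP/nd_nnsfun_approx.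
have -> : (\int[m]_x (f x * (phi x)%:E) =
    lim (\int[m]_x ((h n x)%:E * (phi x)%:E) @[n --> \oo]))%E.
  rewrite -monotone_convergence//=.
  - by apply: eq_integral => x _; apply/esym/cvg_lim => //; exact: cvgeZr.
  - by move=> n; apply: emeasurable_funM => //; exact/measurable_EFinP.
  - by move=> n x _; rewrite mule_ge0 ?lee_fin.
  - move=> x _ a b ab; rewrite lee_wpmul2r ?lee_fin//.
    exact/lefP/nd_nnsfun_approx.
apply: congr_lim; apply/funext => n.
rewrite integralT_nnsfun sintegralE.
under [RHS]eq_integral => x _.
  rewrite fimfunE -fsumEFin// ge0_mule_fsuml; last first.
    by move=> y; rewrite EFinM nnfun_muleindic_ge0.
  over.
rewrite ge0_integral_fsum//; last 2 first.
- move=> y; apply: emeasurable_funM => //.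
  by apply/measurable_EFinP; apply: measurable_funM => //; exact: measurable_indic.
- by move=> y x _; rewrite mule_ge0//; [rewrite EFinM nnfun_muleindic_ge0|rewrite lee_fin].
apply: eq_fsbigr => r /[!inE] -[x _ hx].
have r0 : 0 <= r by rewrite -hx.
have mhr : measurable (h n @^-1` [set r]) by [].
under eq_integral => y _ do rewrite EFinM -muleA.
rewrite ge0_integralZl ?lee_fin//; last 2 first.
- by apply: emeasurable_funM => //; apply/measurable_EFinP; exact: measurable_indic.
- by move=> y _; rewrite mule_ge0 ?lee_fin.
congr (_ * _)%E; rewrite nuE// integral_mkcond; apply: eq_integral => y _.
by rewrite patchE indicE; case: ifP => _; rewrite ?mul1e ?mul0e.
Qed.

Section lebesgue_affine.
Context {R : realType}.
Notation mR := (measurableTypeR R).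
Notation leb := (@lebesgue_measure R).

Lemma measurable_addr (c : R) : measurable_fun setT (fun x : mR => (x + c : mR)).
Proof. exact: (@measurable_funD _ mR R setT (fun x => x) (fun=> c)). Qed.

Lemma measurable_mulr (c : R) : measurable_fun setT (fun x : mR => (c * x : mR)).
Proof. exact: (@measurable_funM _ mR R setT (fun=> c) (fun x => x)). Qed.

Lemma lebesgue_measure_addr (c : R) (A : set mR) : measurable A ->
  leb ((fun x => x + c) @^-1` A) = leb A.
Proof.
move=> mA; apply/esym.
pose hM := isMeasurableFun.Build _ _ _ _ (fun x : mR => (x + c : mR)) (measurable_addr c).
pose H : {mfun mR >-> mR} := HB.pack (fun x : mR => (x + c : mR)) hM.
have := @lebesgue_measure_unique R (pushforward leb H); apply => //.
move=> _ [[a b]/= _ <-]; rewrite /pushforward.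
rewrite (_ : _ @^-1` _ = `]a - c, b - c]%classic); last first.
  by apply/seteqP; split => x /=; rewrite !in_itv/=; lra.
rewrite !lebesgue_measure_itv /= !lte_fin ltrD2r.
by case: ifP => // _; rewrite -!EFinD; congr EFin; lra.
Qed.

Lemma ge0_integral_addr (c : R) (f : mR -> \bar R) :
  measurable_fun setT f -> (forall x, 0 <= f x)%E ->
  (\int[leb]_x f (x + c)%R = \int[leb]_x f x)%E.
Proof.
move=> mf f0.
pose hM := isMeasurableFun.Build _ _ _ _ (fun x : mR => (x + c : mR)) (measurable_addr c).
pose H : {mfun mR >-> mR} := HB.pack (fun x : mR => (x + c : mR)) hM.
transitivity (\int[pushforward leb H]_x f x)%E.
  by rewrite (ge0_integral_pushforward (measurable_addr c))// => t _; exact: f0.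
by apply: eq_measure_integral => A mA _; exact: lebesgue_measure_addr.
Qed.

Lemma lebesgue_measure_scale (c : R) (A : set mR) : 0 < c -> measurable A ->
  (c%:E * leb ((fun x => c * x)%R @^-1` A) = leb A)%E.
Proof.
move=> c0 mA; apply/esym.
pose hM := isMeasurableFun.Build _ _ _ _ (fun x : mR => (c * x : mR)) (measurable_mulr c).
pose H : {mfun mR >-> mR} := HB.pack (fun x : mR => (c * x : mR)) hM.
apply: (lebesgue_measure_unique (mu := mscale (NngNum (ltW c0)) (pushforward leb H))) mA.
move=> _ [[a b]/= _ <-]; rewrite /mscale /pushforward.
transitivity (c%:E * leb [set` `](a / c)%R, (b / c)%R]])%E; last first.
  congr (_ * leb _)%E; apply/seteqP; split => x /=; rewrite !in_itv/=;
    by rewrite ltr_pdivrMr// ler_pdivlMr// ![x * c]mulrC.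
rewrite !lebesgue_measure_itv /= !lte_fin ltr_pM2r ?invr_gt0//.
case: ifP => // _; last by rewrite mule0.
by rewrite -!EFinD -EFinM; congr EFin; field; rewrite gt_eqF.
Qed.

Lemma ge0_integral_scale (c : R) (f : mR -> \bar R) : 0 < c ->
  measurable_fun setT f -> (forall x, 0 <= f x)%E ->
  (c%:E * \int[leb]_x f (c * x)%R = \int[leb]_x f x)%E.
Proof.
move=> c0 mf f0.
pose hM := isMeasurableFun.Build _ _ _ _ (fun x : mR => (c * x : mR)) (measurable_mulr c).
pose H : {mfun mR >-> mR} := HB.pack (fun x : mR => (c * x : mR)) hM.
pose P0 : {measure set mR -> \bar R} := pushforward leb H.
pose P := P0 (measurable_mulr c).
transitivity (\int[mscale (NngNum (ltW c0)) P]_x f x)%E.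
  rewrite ge0_integral_mscale//=.
  by rewrite (ge0_integral_pushforward (measurable_funPT H))// => t _; exact: f0.
by apply: eq_measure_integral => A mA _; exact: lebesgue_measure_scale.
Qed.

End lebesgue_affine.

Section gaussian_integrals.
Context {R : realType}.
Notation mR := (measurableTypeR R).
Notation leb := (@lebesgue_measure R).

Lemma measurable_gauss_quad (a b c : R) :
  measurable_fun setT (fun x : mR => (expR (- (a * x ^+ 2 + 2 * b * x + c) / 2))%:E).
Proof.
apply/measurable_EFinP; apply: measurableT_comp => //.
apply: measurable_funM => //; apply: measurableT_comp => //.
by apply: measurable_funD => //; apply: measurable_funD => //; apply: measurable_funM.
Qed.

(** Completing the square: the integrand is a constant multiple of the normal density with mean
    [- b / a] and variance [a^-1]. *)
Lemma integral_gauss_quad (a b c : R) : 0 < a ->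
  (\int[leb]_x (expR (- (a * x ^+ 2 + 2 * b * x + c) / 2))%:E =
   (Num.sqrt (2 * pi / a) * expR ((b ^+ 2 / a - c) / 2))%:E)%E.
Proof.
move=> a0.
pose s := (Num.sqrt a)^-1.
have sa : Num.sqrt a ^+ 2 = a by rewrite sqr_sqrtr// ltW.
have sa0 : 0 < Num.sqrt a by rewrite sqrtr_gt0.
have s0 : s != 0 by rewrite invr_eq0 gt_eqF.
have := @integral_normal_pdf R (- b / a) s.
rewrite normal_pdfE//.
have -> : (fun x => ((normal_peak s * normal_fun (- b / a) s x)%:E)) =
   (fun x : mR => ((Num.sqrt (2 * pi / a) * expR ((b ^+ 2 / a - c) / 2))^-1%:E *
     (expR (- (a * x ^+ 2 + 2 * b * x + c) / 2))%:E)%E).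
  apply/funext => x; rewrite -EFinM; congr EFin.
  rewrite invfM -[RHS]mulrA; congr (_ * _).
    rewrite /normal_peak /s exprVn sa; congr (Num.sqrt _)^-1.
    by rewrite -mulr_natr; field; rewrite gt_eqF.
  rewrite -expRN -expRD /normal_fun /s exprVn sa -mulr_natr; congr expR.
  by field; rewrite gt_eqF.
rewrite ge0_integralZl; [|by []|exact: measurable_gauss_quad
  |by move=> x _; rewrite lee_fin expR_ge0
  |by rewrite lee_fin invr_ge0 mulr_ge0 ?expR_ge0].
set K := (X in X^-1).
have K0 : 0 < K.
  by rewrite mulr_gt0 ?expR_gt0// sqrtr_gt0 divr_gt0// mulr_gt0// pi_gt0.
move=> /(congr1 (fun z => K%:E * z)%E).
by rewrite mule1 muleA -EFinM divff ?gt_eqF// mul1e.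
Qed.

(** On the half-line where b x <= 0 the exponent is at least - c / 2, and that half-line has
    infinite length. *)
Lemma integral_gauss_quad_le0 (a b c : R) : a <= 0 ->
  (\int[leb]_x (expR (- (a * x ^+ 2 + 2 * b * x + c) / 2))%:E = +oo)%E.
Proof.
move=> a0; apply/eqP; rewrite eq_le leey/=.
pose D : set mR := if b <= 0 then `[0, +oo[%classic else `]-oo, 0]%classic.
have mD : measurable D by rewrite /D; case: ifP.
apply: (@le_trans _ _ (\int[leb]_(x in D) (expR (- c / 2))%:E)%E).
  have -> : (\int[leb]_(x in D) (expR (- c / 2))%:E = (expR (- c / 2))%:E * leb D)%E.
    by rewrite integral_cst.
  have -> : leb D = +oo%E.
    rewrite /D; case: ifP => _.
      by apply: etrans (lebesgue_measure_itv `[(0 : R), +oo[) _; rewrite /= ltry.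
    by apply: etrans (lebesgue_measure_itv `]-oo, (0 : R)]) _; rewrite /= ltNyr.
  by rewrite gt0_muley// lte_fin expR_gt0.
apply: (@le_trans _ _ (\int[leb]_(x in D) (expR (- (a * x ^+ 2 + 2 * b * x + c) / 2))%:E)%E); last first.
  by apply: ge0_subset_integral => //; [exact: measurable_gauss_quad].
apply: ge0_le_integral => //.
  by apply: measurable_funTS; exact: measurable_gauss_quad.
move=> x Dx; rewrite lee_fin ler_expR.
have h1 : a * x ^+ 2 <= 0 by rewrite mulr_le0_ge0// sqr_ge0.
have h2 : b * x <= 0.
  move: Dx; rewrite /D; case: ifPn => [b0|]; rewrite ?ltNge /= in_itv/= ?andbT.
    by move=> x0; rewrite mulr_le0_ge0.
  by rewrite -ltNge => b0 x0; rewrite mulr_ge0_le0// ltW.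
lra.
Qed.

Lemma ge0_integral_normal_prob (m s : R) (f : mR -> \bar R) :
  measurable_fun setT f -> (forall x, 0 <= f x)%E ->
  (\int[normal_prob m s]_x f x = \int[leb]_x (f x * (normal_pdf m s x)%:E))%E.
Proof.
move=> mf f0; rewrite (ge0_integral_density (m := leb) (phi := normal_pdf m s))//.
- exact: measurable_normal_pdf.
- exact: normal_pdf_ge0.
Qed.
End gaussian_integrals.

(** * Gaussian vectors *)

Section tuple_vectors.
Context {R : realType}.
Notation mR := (measurableTypeR R).

Definition vec {n : nat} (t : n.-tuple mR) : 'cV[R]_n := \col_i tnth t i.

Definition tup {n : nat} (v : 'cV[R]_n) : n.-tuple mR := [tuple v i 0 | i < n].

Lemma vecK n : cancel (@vec n) tup.
Proof.
by move=> t; apply: eq_from_tnth => i; rewrite tnth_mktuple mxE.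
Qed.

Lemma tupK n : cancel (@tup n) vec.
Proof. by move=> v; apply/colP => i; rewrite mxE tnth_mktuple. Qed.

Definition qf {n : nat} (S : 'M[R]_n) (v : 'cV[R]_n) : R := (v^T *m S *m v) 0 0.

Lemma qf1 n (v : 'cV[R]_n) : qf 1%:M v = \sum_i v i 0 ^+ 2.
Proof. by rewrite /qf mulmx1 mxE; apply: eq_bigr => i _; rewrite mxE expr2. Qed.

Lemma qfN n (S : 'M[R]_n) v : qf S (- v) = qf S v.
Proof. by rewrite /qf mulmxN [(- v)^T]linearN/= !mulNmx opprK. Qed.

Lemma trmx11 (A : 'M[R]_1) : A^T = A.
Proof. by apply/matrixP => i j; rewrite !ord1 mxE. Qed.

Lemma qfD n (S : 'M[R]_n) u v : S^T = S ->
  qf S (u + v) = qf S u + 2 * (u^T *m S *m v) 0 0 + qf S v.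
Proof.
move=> symS; rewrite /qf [(u + v)^T]linearD/= !(mulmxDl, mulmxDr).
have -> : v^T *m S *m u = u^T *m S *m v.
  by rewrite -[LHS]trmx11 !trmx_mul trmxK symS mulmxA.
by rewrite !mxE; ring.
Qed.

End tuple_vectors.

Section measurable_matrices.
Context {R : realType} {d : measure_display} {S : measurableType d}.
Notation mR := (measurableTypeR R).

Definition measurable_mx (p q : nat) (f : S -> 'M[R]_(p, q)) :=
  forall i j, measurable_fun setT (fun s => f s i j).

Lemma measurable_mx_cst p q (A : 'M[R]_(p, q)) : measurable_mx (fun=> A).
Proof. by move=> i j; exact: measurable_cst. Qed.

Lemma measurable_mxM p q r (f : S -> 'M[R]_(p, q)) (g : S -> 'M[R]_(q, r)) :
  measurable_mx f -> measurable_mx g -> measurable_mx (fun s => f s *m g s).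
Proof.
move=> mf mg i j.
rewrite (_ : (fun s => _) = (fun s => \sum_k f s i k * g s k j)); last first.
  by apply/funext => s; rewrite mxE.
by apply: measurable_sum => k; apply: measurable_funM.
Qed.

Lemma measurable_mxT p q (f : S -> 'M[R]_(p, q)) :
  measurable_mx f -> measurable_mx (fun s => (f s)^T).
Proof.
move=> mf i j; rewrite (_ : (fun s => _) = (fun s => f s j i))//.
by apply/funext => s; rewrite mxE.
Qed.

Lemma measurable_mxD p q (f g : S -> 'M[R]_(p, q)) :
  measurable_mx f -> measurable_mx g -> measurable_mx (fun s => f s + g s).
Proof.
move=> mf mg i j; rewrite (_ : (fun s => _) = (fun s => f s i j + g s i j)).
  exact: measurable_funD.
by apply/funext => s; rewrite mxE.
Qed.

Lemma measurable_mx_vec n (f : S -> n.-tuple mR) :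
  measurable_fun setT f -> measurable_mx (fun s => vec (f s)).
Proof.
move=> mf i j; rewrite (_ : (fun s => _) = (fun s => tnth (f s) i)).
  have /= mt := @measurable_tnth _ mR n i.
  exact: (measurableT_comp mt mf).
by apply/funext => s; rewrite mxE.
Qed.

Lemma measurable_tup n (f : S -> 'cV[R]_n) :
  measurable_mx f -> measurable_fun setT (fun s => tup (f s)).
Proof.
move=> mf; apply/measurable_fun_tnthP => i.
rewrite (_ : _ \o _ = fun s => f s i 0); first exact: mf.
by apply/funext => s /=; rewrite tnth_mktuple.
Qed.

Lemma measurable_qf n (A : 'M[R]_n) (f : S -> 'cV[R]_n) :
  measurable_mx f -> measurable_fun setT (fun s => qf A (f s)).
Proof.
move=> mf; have mfT := measurable_mxT mf; have mA := measurable_mx_cst A.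
exact: (measurable_mxM (measurable_mxM mfT mA) mf).
Qed.

End measurable_matrices.

Section lebesgue_tuples.
Context {R : realType}.
Notation mR := (measurableTypeR R).

Lemma tnth_cons_pair0 n (x : mR) (t : n.-tuple mR) : tnth (cons_pair (x, t)) ord0 = x.
Proof. by []. Qed.

Lemma tnth_cons_pairS n (x : mR) (t : n.-tuple mR) i :
  tnth (cons_pair (x, t)) (lift ord0 i) = tnth t i.
Proof. by rewrite tnthS. Qed.

Lemma eq_cons_pair n (u : n.+1.-tuple mR) (x : mR) (t : n.-tuple mR) :
  tnth u ord0 = x -> (forall i, tnth u (lift ord0 i) = tnth t i) ->
  u = cons_pair (x, t).
Proof.
move=> u0 uS; apply: eq_from_tnth => i.
by case: (unliftP ord0 i) => [j ->|->]; rewrite ?tnth_cons_pairS.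
Qed.

Lemma measurable_cons_pair2 {d} {S : measurableType d} n (f : S -> mR)
    (g : S -> n.-tuple mR) :
  measurable_fun setT f -> measurable_fun setT g ->
  measurable_fun setT (fun s => cons_pair (f s, g s)).
Proof. by move=> mf mg; exact: measurable_cons. Qed.

Definition addt n (c : 'I_n -> R) (t : n.-tuple mR) : n.-tuple mR :=
  [tuple (tnth t i + c i : mR) | i < n].

Lemma measurable_addt n c : measurable_fun setT (@addt n c).
Proof.
apply/measurable_fun_tnthP => i.
rewrite (_ : _ \o _ = (fun x : mR => x + c i : mR) \o (fun t => tnth t i)).
  apply: measurableT_comp; first exact: measurable_addr.
  exact: measurable_tnth.
by apply/funext => s /=; rewrite tnth_mktuple.
Qed.

Lemma ge0_integral_addt n (c : 'I_n -> R) (f : n.-tuple mR -> \bar R) :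
  measurable_fun setT f -> (forall t, 0 <= f t)%E ->
  (\int[lebesgue n]_t f (addt c t) = \int[lebesgue n]_t f t)%E.
Proof.
elim: n c f => [|n IH] c f mf f0.
  rewrite !integral_prod_measure0//; first by rewrite [addt _ _]tuple0.
  by apply: measurableT_comp => //; exact: measurable_addt.
rewrite /lebesgue !ge0_integral_prod_measureS//; last first.
  by apply: measurableT_comp => //; exact: measurable_addt.
have addtS x t : addt c (cons_pair (x, t)) =
    cons_pair (x + c ord0 : mR, addt (fun i => c (lift ord0 i)) t).
  apply: eq_cons_pair; first by rewrite tnth_mktuple.
  by move=> i; rewrite !tnth_mktuple tnth_cons_pairS.
transitivity (\int[lebesgue_measure]_x \int[lebesgue n]_t
    f (cons_pair ((x + c ord0)%R : mR, t)))%E.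
  apply: eq_integral => x _; under eq_integral do rewrite addtS.
  rewrite -/(lebesgue n) (IH _ (fun t => f (cons_pair (x + c ord0 : mR, t))))//.
  by apply: measurableT_comp => //; exact: measurable_cons_pair2.
rewrite (ge0_integral_addr (c ord0)
  (f := fun x => \int[lebesgue n]_t f (cons_pair (x, t)))%E)//.
- apply: (measurable_integral_snd _ (f := fun x t => f (cons_pair (x, t)))) => //.
  by apply: measurableT_comp => //; exact: measurable_cons_pair.
- by move=> x; apply: integral_ge0 => t _; exact: f0.
Qed.

Lemma ge0_integral_shift n (c : 'cV[R]_n) (f : n.-tuple mR -> \bar R) :
  measurable_fun setT f -> (forall t, 0 <= f t)%E ->
  (\int[lebesgue n]_t f (tup (vec t + c)) = \int[lebesgue n]_t f t)%E.
Proof.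
move=> mf f0; rewrite -(ge0_integral_addt (fun i => c i 0) mf f0).
apply: eq_integral => t _; congr f; apply: eq_from_tnth => i.
by rewrite !tnth_mktuple !mxE.
Qed.

Definition gauss (n : nat) : {sigma_finite_measure set (n.-tuple mR) -> \bar R} :=
  prod_measure (fun _ : 'I_n => normal_prob (0 : R) 1).

Lemma gauss_setT n : gauss n setT = 1%E.
Proof. by apply: prod_measure_setT => i; exact: probability_setT. Qed.

Lemma ge0_integral_gauss_pdf n (f : n.-tuple mR -> \bar R) :
  measurable_fun setT f -> (forall t, 0 <= f t)%E ->
  (\int[gauss n]_t f t =
   \int[lebesgue n]_t (f t * (\prod_(i < n) normal_pdf 0 1 (tnth t i))%:E))%E.
Proof.
elim: n f => [|n IH] f mf f0.
  rewrite !integral_prod_measure0 ?big_ord0 ?mule1//.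
    apply: emeasurable_funM => //; apply/measurable_EFinP.
    by apply: measurable_prod => -[].
  by move=> t; rewrite big_ord0 mule1.
have mpdf m : measurable_fun setT (fun t : m.-tuple mR =>
    (\prod_(i < m) normal_pdf (0 : R) 1 (tnth t i))%:E).
  apply/measurable_EFinP; apply: measurable_prod => i _.
  apply: measurableT_comp; first exact: measurable_normal_pdf.
  exact: measurable_tnth.
have pdf0 m (t : m.-tuple mR) :
    (0 <= (\prod_(i < m) normal_pdf (0 : R) 1 (tnth t i))%:E)%E.
  by rewrite lee_fin prodr_ge0// => i _; exact: normal_pdf_ge0.
have mF : measurable_fun setT (fun x : mR => \int[gauss n]_t f (cons_pair (x, t)))%E.
  apply: (measurable_integral_snd _ (f := fun x t => f (cons_pair (x, t)))) => //.
  by apply: measurableT_comp => //; exact: measurable_cons_pair.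
have mfx x : measurable_fun setT (fun t : n.-tuple mR => f (cons_pair (x, t))).
  by apply: measurableT_comp => //; exact: measurable_cons_pair2.
rewrite /gauss ge0_integral_prod_measureS// -/(gauss n).
rewrite ge0_integral_normal_prob//; last by move=> x; apply: integral_ge0 => t _; exact: f0.
rewrite /lebesgue ge0_integral_prod_measureS//; last 2 first.
- by apply: emeasurable_funM => //; exact: mpdf.
- by move=> t; rewrite mule_ge0.
apply: eq_integral => x _; rewrite IH// -/(lebesgue n) -ge0_integralZr//.
- apply: eq_integral => t _.
  rewrite [X in _ = (_ * X%:E)%E]big_ord_recl.
  under [in RHS]eq_bigr do rewrite tnth_cons_pairS.
  by rewrite EFinM -[LHS]muleA; congr (_ * _)%E; rewrite muleC.
- by apply: emeasurable_funM => //; exact: mpdf.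
- by move=> t _; rewrite mule_ge0.
- by rewrite lee_fin normal_pdf_ge0.
Qed.

Definition gnorm (n : nat) : R := (Num.sqrt (2 * pi)) ^+ n.

Lemma gnorm_gt0 n : 0 < gnorm n.
Proof. by rewrite exprn_gt0// sqrtr_gt0 mulr_gt0// pi_gt0. Qed.

Lemma prod_normal_pdf n (t : n.-tuple mR) :
  \prod_(i < n) normal_pdf 0 1 (tnth t i) =
  (gnorm n)^-1 * expR (- qf 1%:M (vec t) / 2).
Proof.
rewrite qf1 mulNr mulr_suml -sumrN expR_sum /gnorm -exprVn.
have -> : (Num.sqrt (2 * pi))^-1 ^+ n = \prod_(i < n) (Num.sqrt (2 * (pi : R)))^-1.
  by rewrite prodr_const card_ord.
rewrite -big_split/=; apply: eq_bigr => i _.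
rewrite normal_pdfE ?oner_eq0// /normal_peak /normal_fun !mxE subr0 expr1n mul1r.
by rewrite -[pi *+ 2]mulr_natl mulNr.
Qed.

Lemma ge0_integral_gauss n (f : n.-tuple mR -> \bar R) :
  measurable_fun setT f -> (forall t, 0 <= f t)%E ->
  (\int[gauss n]_t f t = ((gnorm n)^-1)%:E *
   \int[lebesgue n]_t (f t * (expR (- qf 1%:M (vec t) / 2))%:E))%E.
Proof.
move=> mf f0; rewrite ge0_integral_gauss_pdf// -ge0_integralZl//.
- by apply: eq_integral => t _; rewrite prod_normal_pdf EFinM muleCA.
- apply: emeasurable_funM => //; apply/measurable_EFinP.
  apply: measurableT_comp => //; apply: measurable_funM => //.
  by apply: measurableT_comp => //; apply: measurable_qf; exact: measurable_mx_vec.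
- by move=> t _; rewrite mule_ge0// lee_fin expR_ge0.
- by rewrite lee_fin invr_ge0 ltW// gnorm_gt0.
Qed.

End lebesgue_tuples.

Section gaussian_moments.
Context {R : realType}.
Notation mR := (measurableTypeR R).
Notation leb := (@lebesgue_measure R).
Notation N01 := (normal_prob (0 : R) 1).

Lemma normal_pdf01E (x : R) :
  normal_pdf 0 1 x = (Num.sqrt (2 * pi))^-1 * expR (- x ^+ 2 / 2).
Proof.
rewrite normal_pdfE ?oner_eq0// /normal_peak /normal_fun subr0 expr1n mul1r.
by rewrite -[pi *+ 2]mulr_natl.
Qed.

Lemma ge0_integral_normal01 (f : mR -> \bar R) :
  measurable_fun setT f -> (forall x, 0 <= f x)%E ->
  (\int[N01]_x f x = ((Num.sqrt (2 * pi))^-1)%:E *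
    \int[leb]_x (f x * (expR (- x ^+ 2 / 2))%:E))%E.
Proof.
move=> mf f0; rewrite ge0_integral_normal_prob// -ge0_integralZl//.
- by apply: eq_integral => x _; rewrite normal_pdf01E EFinM muleCA.
- apply: emeasurable_funM => //; apply/measurable_EFinP.
  apply: measurableT_comp => //; apply: measurable_funM => //.
  exact: measurableT_comp.
- by move=> x _; rewrite mule_ge0// lee_fin expR_ge0.
Qed.

(* The inequality [1 + y <= expR y] with [y = (1 - c) x^2 / 2] and
   [c = t^-2] compares the second moment with [\int expR y = t], for [t] on
   either side of 1. *)
Lemma integral_normal01_expR_sqr (c : R) : 0 < c ->
  (\int[N01]_x (expR ((1 - c) * x ^+ 2 / 2))%:E = (Num.sqrt c)^-1%:E)%E.
Proof.
move=> c0; rewrite ge0_integral_normal01//; last first.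
  apply/measurable_EFinP; apply: measurableT_comp => //.
  by apply: measurable_funM => //; exact: measurable_funM.
transitivity (((Num.sqrt (2 * pi))^-1)%:E *
    \int[leb]_x (expR (- (c * x ^+ 2 + 2 * 0 * x + 0) / 2))%:E)%E.
  congr (_ * _)%E; apply: eq_integral => x _; rewrite -EFinM -expRD.
  by congr (expR _)%:E; ring.
rewrite integral_gauss_quad// -EFinM; congr EFin.
rewrite expr0n /= mul0r subrr mul0r expR0 mulr1.
have p0 : 0 < 2 * (pi : R) by rewrite mulr_gt0// pi_gt0.
rewrite (sqrtrM c^-1) ?ltW// sqrtrV ?ltW// mulrA mulVf ?mul1r//.
by rewrite gt_eqF// sqrtr_gt0.
Qed.

Lemma integral_normal01_sqr : (\int[N01]_x (x ^+ 2)%:E = 1)%E.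
Proof.
set V := (X in X = _).
have msq : measurable_fun setT (fun x : mR => (x ^+ 2)%:E).
  by apply/measurable_EFinP; exact: measurable_funX.
have V0 : (0 <= V)%E by apply: integral_ge0 => x _; rewrite lee_fin sqr_ge0.
have mexp c : measurable_fun setT (fun x : mR => (expR ((1 - c) * x ^+ 2 / 2))%:E).
  apply/measurable_EFinP; apply: measurableT_comp => //.
  by apply: measurable_funM => //; exact: measurable_funM.
have one : (\int[N01]_(x in setT) (1%:E : \bar R) = 1)%E.
  by rewrite integral_cst// mul1e; exact: probability_setT.
have VE (a : R) : 0 <= a -> (\int[N01]_x (a * x ^+ 2)%:E = a%:E * V)%E.
  move=> a0; rewrite -ge0_integralZl//; first by move=> x _; rewrite lee_fin sqr_ge0.
have ub (t : R) : 1 < t -> (1 + ((1 - t ^- 2) / 2)%:E * V <= t%:E)%E.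
  move=> t1; have t0 : 0 < t by rewrite (lt_trans _ t1).
  have a0 : 0 <= (1 - t ^- 2) / 2.
    by rewrite divr_ge0// subr_ge0 invf_le1 ?exprn_gt0// exprn_ege1// ltW.
  rewrite -VE// -one -ge0_integralD//; last 2 first.
  - by move=> x _; rewrite lee_fin mulr_ge0// sqr_ge0.
  - by apply/measurable_EFinP; exact: measurable_funM.
  have -> : t%:E = (\int[N01]_x (expR ((1 - t ^- 2) * x ^+ 2 / 2))%:E)%E.
    rewrite integral_normal01_expR_sqr ?invr_gt0 ?exprn_gt0//.
    by rewrite sqrtrV ?sqr_ge0// sqrtr_sqr gtr0_norm// invrK.
  apply: ge0_le_integral => //.
  - by move=> x _; rewrite adde_ge0// lee_fin mulr_ge0// sqr_ge0.
  - by apply: emeasurable_funD => //; apply/measurable_EFinP; exact: measurable_funM.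
  - move=> x _; rewrite -EFinD lee_fin; apply: le_trans (expR_ge1Dx _).
    by rewrite lerD2l mulrAC.
have lb (t : R) : 0 < t -> t < 1 -> (1 <= t%:E + ((t ^- 2 - 1) / 2)%:E * V)%E.
  move=> t0 t1.
  have a0 : 0 <= (t ^- 2 - 1) / 2.
    by rewrite divr_ge0// subr_ge0 invf_ge1 ?exprn_gt0// exprn_ile1// ltW.
  have -> : t%:E = (\int[N01]_x (expR ((1 - t ^- 2) * x ^+ 2 / 2))%:E)%E.
    rewrite integral_normal01_expR_sqr ?invr_gt0 ?exprn_gt0//.
    by rewrite sqrtrV ?sqr_ge0// sqrtr_sqr gtr0_norm// invrK.
  rewrite -VE// -[leLHS]one -ge0_integralD//; last 2 first.
  - by move=> x _; rewrite lee_fin mulr_ge0// sqr_ge0.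
  - by apply/measurable_EFinP; exact: measurable_funM.
  apply: ge0_le_integral => //.
  - by apply: emeasurable_funD => //; apply/measurable_EFinP; exact: measurable_funM.
  - move=> x _; rewrite -EFinD lee_fin.
    have := expR_ge1Dx ((1 - t ^- 2) * x ^+ 2 / 2); lra.
(* At t = 2 an infinite [V] would contradict [ub]. *)
have Vfin : V \is a fin_num.
  rewrite ge0_fin_numE// ltNge; apply/negP; rewrite leye_eq => /eqP Voo.
  have := ub 2 (ltr1n _ 2); rewrite Voo gt0_muley ?addey//.
  rewrite lte_fin divr_gt0// subr_gt0 invf_lt1// -natrX ltr1n //.
move: (fineK Vfin) V0 ub lb; set v := fine V => <- v0 ub lb.
congr EFin; apply/eqP; rewrite eq_le; apply/andP; split.
(* At t = 1 + h, [ub] reads (2 + h) v <= 2 (1 + h)^2, hence v <= 1 + 3 h <= 1 + e. *)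
- apply/ler_addgt0Pr => e e0; pose h := Num.min 1 (e / 3).
  have h0 : 0 < h by rewrite lt_min ltr01 divr_gt0.
  have h1 : h <= 1 by rewrite ge_min lexx.
  have he : 3 * h <= e by rewrite mulrC -ler_pdivlMr// ge_min lexx orbT.
  have := ub (1 + h); rewrite ltrDl => /(_ h0); rewrite -EFinM -EFinD lee_fin.
  rewrite -subr_ge0 => H.
  have : 0 <= (1 + h) ^+ 2 * 2 / h * (1 + h - (1 + (1 - (1 + h) ^- 2) / 2 * v)).
    apply: mulr_ge0; last exact: H.
    by apply: divr_ge0; [apply: mulr_ge0 => //; exact: sqr_ge0|exact: ltW].
  have -> : (1 + h) ^+ 2 * 2 / h * (1 + h - (1 + (1 - (1 + h) ^- 2) / 2 * v)) =
     2 * (1 + h) ^+ 2 - (2 + h) * v.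
    by field; rewrite !gt_eqF// addr_gt0.
  rewrite lee_fin in v0; nra.
(* At t = 1 - h, [lb] reads (2 - h) v >= 2 (1 - h)^2, hence v >= 1 - 2 h >= 1 - e. *)
- rewrite -subr_ge0; apply/ler_addgt0Pr => e e0; pose h := Num.min (1 / 2) (e / 2).
  have h0 : 0 < h by rewrite lt_min !divr_gt0.
  have h1 : h <= 1 / 2 by rewrite ge_min lexx.
  have he : 2 * h <= e by rewrite mulrC -ler_pdivlMr// ge_min lexx orbT.
  have t0 : 0 < 1 - h by lra.
  have := lb (1 - h); rewrite ltrBlDr ltrDl => /(_ t0 h0); rewrite -EFinM -EFinD lee_fin.
  rewrite -subr_ge0 => H.
  have : 0 <= (1 - h) ^+ 2 * 2 / h * (1 - h + ((1 - h) ^- 2 - 1) / 2 * v - 1).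
    apply: mulr_ge0; last exact: H.
    by apply: divr_ge0; [apply: mulr_ge0 => //; exact: sqr_ge0|exact: ltW].
  have -> : (1 - h) ^+ 2 * 2 / h * (1 - h + ((1 - h) ^- 2 - 1) / 2 * v - 1) =
     (2 - h) * v - 2 * (1 - h) ^+ 2.
    by field; rewrite !gt_eqF.
  rewrite lee_fin in v0; nra.
Qed.

Lemma measurable_oppr : measurable_fun setT (fun x : mR => (- x : mR)).
Proof. exact: (@measurable_funN _ mR R setT (fun x => x)). Qed.

Lemma lebesgue_measure_opp (A : set mR) : measurable A ->
  leb ((fun x => - x) @^-1` A) = leb A.
Proof.
move=> mA; apply/esym.
pose hM := isMeasurableFun.Build _ _ _ _ (fun x : mR => (- x : mR)) measurable_oppr.
pose H : {mfun mR >-> mR} := HB.pack (fun x : mR => (- x : mR)) hM.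
have := @lebesgue_measure_unique R (pushforward leb H); apply => //.
move=> _ [[a b]/= _ <-]; rewrite /pushforward.
rewrite (_ : _ @^-1` _ = [set` `[- b, - a[]); last first.
  by apply/seteqP; split => x /=; rewrite !in_itv/=; lra.
rewrite !lebesgue_measure_itv /= !lte_fin ltrN2.
by case: ifP => // _; rewrite -!EFinD; congr EFin; lra.
Qed.

Lemma ge0_integral_opp (f : mR -> \bar R) :
  measurable_fun setT f -> (forall x, 0 <= f x)%E ->
  (\int[leb]_x f (- x)%R = \int[leb]_x f x)%E.
Proof.
move=> mf f0.
pose hM := isMeasurableFun.Build _ _ _ _ (fun x : mR => (- x : mR)) measurable_oppr.
pose H : {mfun mR >-> mR} := HB.pack (fun x : mR => (- x : mR)) hM.
transitivity (\int[pushforward leb H]_x f x)%E.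
  by rewrite (ge0_integral_pushforward measurable_oppr)// => t _; exact: f0.
by apply: eq_measure_integral => A mA _; exact: lebesgue_measure_opp.
Qed.

Lemma ge0_integral_normal01_opp (f : mR -> \bar R) :
  measurable_fun setT f -> (forall x, 0 <= f x)%E ->
  (\int[N01]_x f (- x)%R = \int[N01]_x f x)%E.
Proof.
move=> mf f0; rewrite !ge0_integral_normal01//; last exact: measurableT_comp measurable_oppr.
congr (_ * _)%E.
rewrite -(ge0_integral_opp (f := fun x => (f x * (expR (- x ^+ 2 / 2))%:E)%E)).
- by apply: eq_integral => x _; rewrite sqrrN.
- apply: emeasurable_funM => //; apply/measurable_EFinP.
  apply: measurableT_comp => //; apply: measurable_funM => //.
  exact: measurableT_comp.
- by move=> x; rewrite mule_ge0// lee_fin expR_ge0.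
Qed.

Lemma normal01_opp (A : set mR) : measurable A ->
  N01 ((fun x => - x) @^-1` A) = N01 A.
Proof.
move=> mA.
have mA' : measurable ((fun x : mR => (- x : mR)) @^-1` A).
  by rewrite -[X in measurable X]setTI; exact: measurable_oppr.
rewrite -[LHS]mul1e -[RHS]mul1e.
rewrite -(integral_cst N01 mA') -(integral_cst N01 mA).
rewrite [LHS]integral_mkcond [RHS]integral_mkcond.
rewrite -(ge0_integral_normal01_opp (f := (cst 1%:E) \_ A)%E)//.
- by apply: (measurable_restrictT _ mA).1; exact: measurable_cst.
- by move=> x; rewrite patchE; case: ifP.
Qed.

Section flips.
Variable n : nat.

Definition flip_coord (k i : 'I_n) (t : n.-tuple mR) : mR :=
  if i == k then (- tnth t i) else tnth t i.

Definition flip (k : 'I_n) : n.-tuple mR -> n.-tuple mR := select (flip_coord k) id.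

Lemma tnth_flip k t i : tnth (flip k t) i = flip_coord k i t.
Proof. by rewrite tnth_mktuple. Qed.

Lemma measurable_flip_coord k i : measurable_fun setT (flip_coord k i).
Proof.
have mt := @measurable_tnth _ mR n i.
rewrite /flip_coord; case: (i == k) => //.
have mo := measurableT_comp measurable_oppr mt.
exact: mo.
Qed.

Lemma indep_family_flip k :
  indep_family (gauss n) (flip_coord k) (fun=> N01).
Proof.
split => [i|i|A mA]; first exact: measurable_flip_coord.
- exact: probability_setT.
- pose B i := if i == k then (fun x : mR => (- x : mR)) @^-1` A i else A i.
  have mB i : measurable (B i).
    rewrite /B; case: ifP => // _.
    by rewrite -[X in measurable X]setTI; exact: measurable_oppr.
  rewrite (_ : [set _ | _] = box B); last first.
    apply/seteqP; split => t H i; have := H i; rewrite /B /flip_coord;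
      by case: ifP.
  rewrite [LHS]prod_measure_box//; apply: eq_bigr => i _.
  by rewrite /B; case: ifP => // _; exact: normal01_opp.
Qed.

Lemma ge0_integral_gauss_flip k (f : n.-tuple mR -> \bar R) :
  measurable_fun setT f -> (forall t, 0 <= f t)%E ->
  (\int[gauss n]_t f (flip k t) = \int[gauss n]_t f t)%E.
Proof.
move=> mf f0.
exact: (ge0_integral_indep_family (indep_family_flip k) (fun _ _ => id) mf f0).
Qed.

(** [flip k] preserves the Gaussian measure and exchanges the positive and negative parts of [f];
    integrability makes their difference meaningful. The mixed second moments follow without Fubini
    for signed functions. *)
Lemma integral_gauss_odd k (f : n.-tuple mR -> R) :
  (gauss n).-integrable setT (EFin \o f) ->
  (forall t, f (flip k t) = - f t) ->
  (\int[gauss n]_t (f t)%:E = 0)%E.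
Proof.
move=> intf oddf; rewrite integralE.
have mf : measurable_fun setT (EFin \o f) by case/integrableP: intf.
have -> : (\int[gauss n]_t (fun t => (f t)%:E)^\- t =
           \int[gauss n]_t (fun t => (f t)%:E)^\+ t)%E.
  rewrite -(ge0_integral_gauss_flip k (f := (fun t => (f t)%:E)^\+%E))//.
    by apply: eq_integral => t _; rewrite funenegE funeposE oddf.
  exact: measurable_funepos.
have /= := integrable_funepos measurableT intf.
move=> /(integral_fune_fin_num measurableT) fin; rewrite subee//.
Qed.

Lemma integral_gauss_sqr k :
  (\int[gauss n]_t ((tnth t k : R) ^+ 2)%:E = 1)%E.
Proof.
pose g (i : 'I_n) (x : mR) : R := if i == k then x ^+ 2 else 1.
have mg i : measurable_fun setT (g i).
  by rewrite /g; case: (i == k) => //; exact: measurable_funX.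
have g0 i x : 0 <= g i x by rewrite /g; case: ifP => _ //; exact: sqr_ge0.
transitivity (\int[gauss n]_t (\prod_(i < n) g i (tnth t i))%:E)%E.
  apply: eq_integral => t _; congr EFin.
  rewrite (bigD1 k)//= /g eqxx big1 ?mulr1// => i ik.
  by rewrite (negbTE ik).
rewrite ge0_integral_prod_tnth// (bigD1 k)//= big1 ?mule1 => [|i ik].
  by rewrite /g eqxx integral_normal01_sqr.
rewrite /g (negbTE ik) integral_cst// mul1e; exact: probability_setT.
Qed.

Lemma measurable_tnth_fun (k : 'I_n) : measurable_fun setT (fun t : n.-tuple mR => tnth t k : R).
Proof. exact: (@measurable_tnth _ mR n k). Qed.

Lemma integrable_gauss_mul k l :
  (gauss n).-integrable setT (fun t => ((tnth t k : R) * tnth t l)%:E).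
Proof.
have mt := measurable_tnth_fun.
have isq i : (gauss n).-integrable setT (fun t => ((tnth t i : R) ^+ 2)%:E).
  apply/integrableP; split; first by apply/measurable_EFinP; exact: measurable_funX.
  under eq_integral do rewrite gee0_abs ?lee_fin ?sqr_ge0//.
  by rewrite integral_gauss_sqr ltry.
apply: (le_integrable measurableT _ _ (integrableD measurableT (isq k) (isq l))).
  by apply/measurable_EFinP; exact: measurable_funM.
move=> t _ /=; rewrite lee_fin; apply: le_trans (ler_norm _).
rewrite ler_norml; set x : R := tnth t k; set y : R := tnth t l.
have := sqr_ge0 (x + y); have := sqr_ge0 (x - y).
have := sqr_ge0 x; have := sqr_ge0 y.
by move=> *; apply/andP; split; nra.
Qed.

Lemma integral_gauss_mul k l :
  (\int[gauss n]_t ((tnth t k : R) * tnth t l)%:E = (k == l)%:R%:E)%E.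
Proof.
have [->|kl] := eqVneq k l.
  by rewrite -(integral_gauss_sqr l); apply: eq_integral => t _; rewrite expr2.
apply: (integral_gauss_odd (k := k)); first exact: integrable_gauss_mul.
by move=> t; rewrite !tnth_flip /flip_coord eqxx eq_sym (negbTE kl) mulNr.
Qed.

Lemma qf_vecE (M : 'M[R]_n) (t : n.-tuple mR) :
  qf M (vec t) = \sum_j \sum_i M i j * ((tnth t i : R) * tnth t j).
Proof.
rewrite /qf mxE; apply: eq_bigr => j _; rewrite !mxE mulr_suml.
by apply: eq_bigr => i _; rewrite !mxE; ring.
Qed.

Lemma integrable_gauss_qf (M : 'M[R]_n) :
  (gauss n).-integrable setT (fun t => (qf M (vec t))%:E).
Proof.
apply: (eq_integrable measurableT (fun t : n.-tuple mR => \sum_j \sum_i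
    ((M i j)%:E * ((tnth t i : R) * tnth t j)%:E))%E).
  by move=> t _; rewrite qf_vecE -sumEFin; apply: eq_bigr => j _; rewrite -sumEFin.
apply: integrable_sum => // j _; apply: integrable_sum => // i _.
by apply: integrableZl => //; exact: integrable_gauss_mul.
Qed.

Lemma integral_gauss_qf (M : 'M[R]_n) :
  (\int[gauss n]_t (qf M (vec t))%:E = (\tr M)%:E)%E.
Proof.
transitivity (\int[gauss n]_t (\sum_j \sum_i
    ((M i j)%:E * ((tnth t i : R) * tnth t j)%:E)))%E.
  by apply: eq_integral => t _; rewrite qf_vecE -sumEFin; apply: eq_bigr => j _; rewrite -sumEFin.
have iZ i j : (gauss n).-integrable setT
    (fun t => ((M i j)%:E * ((tnth t i : R) * tnth t j)%:E)%E).
  by apply: integrableZl => //; exact: integrable_gauss_mul.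
rewrite integral_sum//; last first.
  by move=> j; apply: integrable_sum => // i _; exact: iZ.
rewrite /mxtrace -sumEFin; apply: eq_bigr => j _.
rewrite integral_sum// (bigD1 j)//= integralZl//; last exact: integrable_gauss_mul.
rewrite integral_gauss_mul eqxx mule1 big1 ?adde0// => i ij.
rewrite integralZl//; last exact: integrable_gauss_mul.
by rewrite integral_gauss_mul (negbTE ij) mule0.
Qed.

End flips.
End gaussian_moments.

(** * Gaussian integrals of quadratic forms *)

Section gaussian_form_integrals.
Context {R : realType}.
Notation mR := (measurableTypeR R).

(* Equal to [gnorm n / Num.sqrt (\det S)] if [S] is positive definite, and to
   [+oo] otherwise for symmetric [S]. Working with it avoids both the
   determinant and the square root of a matrix. *)
Definition Jint (n : nat) (S : 'M[R]_n) : \bar R :=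
  (\int[lebesgue n]_t (expR (- qf S (vec t) / 2))%:E)%E.

Lemma measurable_expR_qf {d} {T : measurableType d} n (S : 'M[R]_n) (f : T -> 'cV[R]_n) (c : R) :
  measurable_mx f -> measurable_fun setT (fun s => (expR (c * qf S (f s) / 2))%:E).
Proof.
move=> mf; apply/measurable_EFinP; apply: measurableT_comp => //.
by do 2!apply: measurable_funM => //; exact: measurable_qf.
Qed.

Lemma measurable_vec n : measurable_mx (@vec R n).
Proof. by apply: (measurable_mx_vec (f := fun t => t)). Qed.

Lemma measurable_Jint n (S : 'M[R]_n) :
  measurable_fun setT (fun t : n.-tuple mR => (expR (- qf S (vec t) / 2))%:E).
Proof.
rewrite (_ : (fun t => _) = fun t => (expR (-1 * qf S (vec t) / 2))%:E).
  by apply: measurable_expR_qf; exact: measurable_vec.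
by apply/funext => t; rewrite mulN1r.
Qed.

Lemma Jint_ge0 n (S : 'M[R]_n) : (0 <= Jint S)%E.
Proof. by apply: integral_ge0 => t _; rewrite lee_fin expR_ge0. Qed.

Lemma lebesgue_setT_gt0 n : (0 < @lebesgue R n setT)%E.
Proof.
rewrite (_ : setT = box (fun=> setT)); last by apply/seteqP; split.
rewrite [ltRHS]prod_measure_box//.
elim: n => [|n IH]; first by rewrite big_ord0.
rewrite big_ord_recl mule_gt0//.
have := lebesgue_measure_itv (`]-oo, +oo[%R : interval R); rewrite set_itvE => lE.
by rewrite [ltRHS]lE/= addey// lt0y.
Qed.

Lemma vec_cons_pair n (x : mR) (t : n.-tuple mR) :
  vec (cons_pair (x, t)) = col_mx (x%:M : 'M[R]_1) (vec t) :> 'cV[R]_(1 + n).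
Proof.
apply/colP => i; rewrite -(fintype.splitK i); case: (fintype.split i) => j /=.
  rewrite col_mxEu !mxE !ord1 eqxx mulr1n -[RHS](tnth_cons_pair0 x t).
  by congr tnth; apply/val_inj.
rewrite col_mxEd !mxE -[RHS](tnth_cons_pairS x); congr tnth.
by apply/val_inj.
Qed.

Lemma mx11M (A B : 'M[R]_1) : (A *m B) 0 0 = A 0 0 * B 0 0.
Proof. by rewrite mxE big_ord1. Qed.

Lemma qf_block n (a : R) (b : 'cV[R]_n) (C : 'M[R]_n) (x : R) (w : 'cV[R]_n) :
  qf (block_mx (a%:M : 'M[R]_1) b^T b C) (col_mx (x%:M : 'M[R]_1) w) =
  a * x ^+ 2 + 2 * (b^T *m w) 0 0 * x + qf C w.
Proof.
rewrite /qf tr_col_mx mul_row_block mul_row_col !mulmxDl.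
rewrite !(mul_mx_scalar, tr_scalar_mx, mul_scalar_mx) -!scalemxAl.
have -> : w^T *m b = b^T *m w by rewrite -[LHS]trmx11 trmx_mul trmxK.
by move: (b^T *m w) (w^T *m C *m w) => u v; rewrite !mxE eqxx !mulr1n; ring.
Qed.

(* Integrating out the first coordinate turns [S] into the Schur complement of
   its upper left entry. *)
Lemma Jint_schur n (S : 'M[R]_n) : S^T = S -> (Jint S < +oo)%E ->
  S \in unitmx /\ (Jint S * Jint (invmx S) = ((@gnorm R n) ^+ 2)%:E)%E.
Proof.
elim: n S => [|n IH] S symS finS.
  have Joe (M : 'M[R]_0) : Jint M = 1%E.
    rewrite /Jint integral_prod_measure0//.
    - by rewrite /qf mxE big_ord0 oppr0 mul0r expR0.
    - exact: measurable_Jint.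
  by rewrite !Joe mule1 /gnorm expr0 expr1n; split => //; rewrite unitmxE det_mx00 unitr1.
pose S1 : 'M[R]_(1 + n) := S.
pose a := S 0 0; pose b := dlsubmx S1; pose C := drsubmx S1.
have SE : S = block_mx (a%:M : 'M[R]_1) b^T b C :> 'M[R]_(1 + n).
  rewrite -[LHS](@submxK R 1 n 1 n) -/S1; congr block_mx.
    apply/matrixP => i j; rewrite !ord1 !mxE eqxx mulr1n.
    by congr (S _ _); apply/val_inj.
  by rewrite /b trmx_dlsub symS.
have symC : C^T = C by rewrite /C trmx_drsub symS.
pose beta (t : n.-tuple mR) := (b^T *m vec t) 0 0.
have qSE x t : qf S (vec (cons_pair (x, t))) =
    a * x ^+ 2 + 2 * beta t * x + qf C (vec t).
  by rewrite vec_cons_pair [X in qf X _]SE qf_block.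
have JE : (Jint S = \int[lebesgue n]_t \int[lebesgue_measure]_x
    (expR (- (a * x ^+ 2 + 2 * beta t * x + qf C (vec t)) / 2))%:E)%E.
  have J0 t : (0 <= (expR (- qf S (vec t) / 2))%:E)%E by rewrite lee_fin expR_ge0.
  apply: etrans (ge0_integral_prod_measureSr _ (measurable_Jint S) J0) _.
  by apply: eq_integral => t _; apply: eq_integral => x _; rewrite qSE.
(* If a <= 0, every inner integral is [+oo], and so is the outer one because Lebesgue measure is not
   zero. *)
have a0 : 0 < a.
  rewrite ltNge; apply/negP => a0; move: finS; rewrite JE.
  under eq_integral do rewrite integral_gauss_quad_le0//.
  rewrite integral_cst// gt0_mulye ?ltxx//.
  exact: lebesgue_setT_gt0.
pose S' : 'M[R]_n := C - a^-1 *: (b *m b^T).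
have symS' : S'^T = S'.
  by rewrite /S' linearB/= linearZ/= trmx_mul trmxK symC.
have qS' t : qf S' (vec t) = qf C (vec t) - beta t ^+ 2 / a.
  rewrite /qf /S' mulmxBr mulmxBl -scalemxAr -scalemxAl !mulmxA -[_ *m b^T *m _]mulmxA.
  rewrite [LHS]mxE [X in _ + X]mxE [X in _ - X]mxE mx11M.
  have -> : ((vec t)^T *m b) 0 0 = beta t.
    by rewrite -[_ *m b]trmx11 trmx_mul trmxK.
  by rewrite /beta; ring.
have JS : (Jint S = (Num.sqrt (2 * pi / a))%:E * Jint S')%E.
  rewrite JE /Jint -ge0_integralZl//; last first.
    exact: measurable_Jint.
  apply: eq_integral => t _; rewrite integral_gauss_quad// -EFinM qS'.
  by congr (_ * expR _)%:E; field; rewrite gt_eqF.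
have pa0 : 0 < 2 * pi / a by rewrite divr_gt0// mulr_gt0// pi_gt0.
have finS' : (Jint S' < +oo)%E.
  rewrite ltey; apply/eqP => S'oo; move: finS.
  by rewrite JS S'oo gt0_muley ?ltxx// lte_fin sqrtr_gt0.
have [uS' JS'] := IH S' symS' finS'.
pose K := invmx S'.
have symK : K^T = K by rewrite /K trmx_inv symS'.
have SK : S' *m K = 1%:M by rewrite mulmxV.
pose kappa := b^T *m K *m b.
(* The block formula for the inverse of [S] in terms of the inverse [K] of its Schur complement. *)
pose N : 'M[R]_(1 + n) := block_mx (a^-1%:M + a^-1 ^+ 2 *: kappa)
  (- a^-1 *: (b^T *m K)) (- a^-1 *: (K *m b)) K.
have CK : C *m K = 1%:M + a^-1 *: (b *m (b^T *m K)).
  by rewrite -SK /S' mulmxBl -scalemxAl mulmxA subrK.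
have SN : S1 *m N = 1%:M.
  rewrite /S1 SE /N mulmx_block scalar_mx_block; congr block_mx.
  - rewrite mul_scalar_mx scalerDr scale_scalar_mx scalerA -scalemxAr mulmxA -/kappa.
    rewrite divff ?gt_eqF// scaleNr expr2 mulrA divff ?gt_eqF// mul1r addrK//.
  - rewrite mul_scalar_mx scalerA mulrN divff ?gt_eqF// scaleN1r addNr//.
  - rewrite mulmxDr -!scalemxAr (mulmxA C) CK mulmxDl mul1mx -scalemxAl.
    rewrite -[b *m _ *m b]mulmxA -/kappa mul_mx_scalar scaleNr scalerDr scalerA -expr2.
    by rewrite opprD addrACA addrN add0r addrN.
  - rewrite -scalemxAr CK scaleNr addrC addrK//.
have uS : S \in unitmx by case/mulmx1_unit: SN.
have NE : invmx S = N.
  by rewrite -[RHS]mul1mx -(mulVmx uS) -mulmxA SN mulmx1.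
split => //.
(* Translating the last n coordinates by (x / a) b splits the form of the inverse. Hence
   [Jint (invmx S)] acquires the factor sqrt (2 pi a) where [Jint S] has sqrt (2 pi / a), and each
   dimension contributes 2 pi to the product. *)
have qN x t : qf (invmx S) (vec (cons_pair (x, t))) =
    a^-1 * x ^+ 2 + qf K (vec t - (x / a) *: b).
  rewrite vec_cons_pair NE.
  have -> : N = block_mx ((a^-1 + a^-1 ^+ 2 * kappa 0 0)%:M : 'M[R]_1)
      (- a^-1 *: (K *m b))^T (- a^-1 *: (K *m b)) K.
    rewrite /N; congr block_mx; last by rewrite linearZ/= trmx_mul symK.
    by apply/matrixP => i j; rewrite !ord1 !mxE eqxx !mulr1n.
  rewrite qf_block qfD// qfN linearZ/= trmx_mul symK -scalemxAl mulmxN -scalemxAr.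
  have -> : (vec t)^T *m K *m b = b^T *m K *m vec t.
    by rewrite -[LHS]trmx11 !trmx_mul trmxK symK mulmxA.
  have -> : qf K ((x / a) *: b) = (x / a) ^+ 2 * kappa 0 0.
    rewrite /qf /kappa -scalemxAr [((x / a) *: b)^T]linearZ/= -!scalemxAl scalerA -expr2.
    by rewrite mxE.
  by move: (b^T *m K *m vec t) => u; rewrite !mxE; ring.
have mgau : measurable_fun setT (fun x : mR => (expR (- (a^-1 * x ^+ 2 + 2 * 0 * x + 0) / 2))%:E).
  exact: measurable_gauss_quad.
have JN : (Jint (invmx S) = (Num.sqrt (2 * pi * a))%:E * Jint K)%E.
  have J0 t : (0 <= (expR (- qf (invmx S) (vec t) / 2))%:E)%E by rewrite lee_fin expR_ge0.
  apply: etrans (ge0_integral_prod_measureS _ (measurable_Jint (invmx S)) J0) _.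
  transitivity (\int[lebesgue_measure]_x
     ((expR (- (a^-1 * x ^+ 2 + 2 * 0 * x + 0) / 2))%:E * Jint K))%E; last first.
    move: (Jint K) (Jint_ge0 K) => j j0.
    rewrite ge0_integralZr; [|by []|exact: mgau|by move=> x _; rewrite lee_fin expR_ge0|exact: j0].
    rewrite integral_gauss_quad ?invr_gt0// invrK.
    by rewrite expr0n /= mul0r subrr mul0r expR0 mulr1.
  apply: eq_integral => x _.
  have K0 t : (0 <= (expR (- qf K (vec t) / 2))%:E)%E by rewrite lee_fin expR_ge0.
  have := ge0_integral_shift (- ((x / a) *: b)) (measurable_Jint K) K0.
  rewrite -/(Jint K) => <-.
  rewrite -ge0_integralZl//; last first.
    rewrite (_ : (fun t => _) = (fun t => (expR (- 1 * qf K (vec (tup (vec t - (x / a) *: b))) / 2))%:E)).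
      apply: measurable_expR_qf; apply: measurable_mx_vec; apply: measurable_tup.
      by apply: measurable_mxD; [exact: measurable_vec|exact: measurable_mx_cst].
    by apply/funext => t; rewrite mulN1r.
  apply: eq_integral => t _; rewrite qN tupK -EFinM -expRD.
  by congr (expR _)%:E; field; rewrite gt_eqF.
rewrite JS JN muleACA JS' -!EFinM -sqrtrM ?ltW//; congr EFin.
have -> : 2 * pi / a * (2 * pi * a) = (2 * pi) ^+ 2 :> R.
  by field; rewrite gt_eqF.
rewrite sqrtr_sqr ger0_norm ?mulr_ge0 ?pi_ge0// /gnorm (exprS _ n) exprMn sqr_sqrtr//.
by rewrite mulr_ge0 ?pi_ge0.
Qed.

Lemma Jint1 n : Jint (1%:M : 'M[R]_n) = (gnorm n)%:E.
Proof.
have := @ge0_integral_gauss R n (cst 1%E) (measurable_cst _) (fun=> lee01).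
rewrite integral_cst// mul1e [X in X = _](gauss_setT n).
under eq_integral do rewrite mul1e.
rewrite -/(Jint 1%:M) => J1.
rewrite -[LHS]mul1e -[1%E](_ : (gnorm n)%:E * ((gnorm n)^-1)%:E = 1%E)%E.
  by rewrite -muleA -J1 mule1.
by rewrite -EFinM divff// gt_eqF// gnorm_gt0.
Qed.

(** * Images of Gaussian vectors under linear maps *)

Section linear_images.
Variables (n d : nat) (U : 'M[R]_(n, d)).
Let Sig := U *m U^T.
Hypothesis uSig : Sig \in unitmx.

Let symSig : Sig^T = Sig.
Proof. by rewrite /Sig trmx_mul trmxK. Qed.

Let symI : (invmx Sig)^T = invmx Sig.
Proof. by rewrite trmx_inv symSig. Qed.

Definition lin (z : d.-tuple mR) : n.-tuple mR := tup (U *m vec z).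

Lemma measurable_lin : measurable_fun setT lin.
Proof.
apply: measurable_tup; apply: measurable_mxM; first exact: measurable_mx_cst.
exact: measurable_vec.
Qed.

(** The preimage of [v] under [U] of least norm: it is orthogonal to the kernel of [U], and its
    squared norm is [qf (invmx Sig) (vec v)]. *)
Let w (v : n.-tuple mR) : 'cV[R]_d := U^T *m invmx Sig *m vec v.

Let Uw v : U *m w v = vec v.
Proof. by rewrite /w mulmxA mulmxA mulmxV// mul1mx. Qed.

Let mz (z : d.-tuple mR) : R :=
  expR ((qf (invmx Sig) (U *m vec z) - qf 1%:M (vec z)) / 2).

(* [mz] is the density of a measure whose image under [U] is translation
   invariant. *)
Let mz_shift z v : mz (tup (vec z + w v)) = mz z.
Proof.
rewrite /mz tupK mulmxDr Uw !qfD ?trmx1//; congr (expR (_ / 2)).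
have -> : qf 1%:M (w v) = qf (invmx Sig) (vec v).
  rewrite /qf mulmx1 /w !trmx_mul trmxK symI !mulmxA.
  by rewrite -[_ *m U *m U^T]mulmxA -[_ *m invmx Sig *m (U *m U^T)]mulmxA mulVmx// mulmx1.
have -> : (vec z)^T *m 1%:M *m w v = (U *m vec z)^T *m invmx Sig *m vec v.
  by rewrite mulmx1 /w trmx_mul !mulmxA.
by ring.
Qed.

(* The density of [U z] for a standard Gaussian [z], read backwards: it follows
   from the uniqueness of translation-invariant measures, by Tonelli. *)
Lemma ge0_integral_lin (F : n.-tuple mR -> \bar R) :
  measurable_fun setT F -> (forall t, 0 <= F t)%E ->
  (\int[lebesgue n]_v F v = Jint (invmx Sig) *
   \int[gauss d]_z (F (lin z) * (expR (qf (invmx Sig) (U *m vec z) / 2))%:E))%E.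
Proof.
move=> mF F0.
pose k (v : n.-tuple mR) := expR (- qf (invmx Sig) (vec v) / 2).
have k0 v : 0 <= k v by exact: expR_ge0.
have mk : measurable_fun setT (fun v => (k v)%:E) by exact: measurable_Jint.
have m0 z : 0 <= mz z by exact: expR_ge0.
have mvec p e (V : measurableType e) (f : V -> p.-tuple mR) :
  measurable_fun setT f -> measurable_mx (fun s => vec (f s)) by exact: measurable_mx_vec.
have mmz : measurable_fun setT (fun z => (mz z)%:E).
  apply/measurable_EFinP; apply: measurableT_comp => //.
  apply: measurable_funM => //; apply: measurable_funB; apply: measurable_qf.
    by apply: measurable_mxM; [exact: measurable_mx_cst|exact: measurable_vec].
  exact: measurable_vec.
pose L := (\int[lebesgue d]_z (F (lin z) * (mz z)%:E))%E.
have L0 : (0 <= L)%E by apply: integral_ge0 => z _; rewrite mule_ge0 ?lee_fin.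
have mFlin : measurable_fun setT (F \o lin) by exact: measurableT_comp measurable_lin.
have mLz : measurable_fun setT (fun z => F (lin z) * (mz z)%:E)%E.
  exact: emeasurable_funM.
have -> : (\int[gauss d]_z (F (lin z) * (expR (qf (invmx Sig) (U *m vec z) / 2))%:E) =
    ((gnorm d)^-1)%:E * L)%E.
  rewrite ge0_integral_gauss; last 2 first.
  - apply: emeasurable_funM => //.
    rewrite (_ : (fun z => _) = (fun z => (expR (1 * qf (invmx Sig) (U *m vec z) / 2))%:E)).
      apply: measurable_expR_qf.
      by apply: measurable_mxM; [exact: measurable_mx_cst|exact: measurable_vec].
    by apply/funext => z; rewrite mul1r.
  - by move=> z; rewrite mule_ge0// lee_fin expR_ge0.
  congr (_ * _)%E; apply: eq_integral => z _; rewrite -muleA -EFinM -expRD.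
  by congr (_ * (expR _)%:E)%E; ring.
have Gd : (0 < @gnorm R d) by exact: gnorm_gt0.
(* The double integral of k(v) F(v + U z) mz(z) is computed in both orders. Integrating over z first
   and shifting z by [w v] gives the left side. Replacing v + U z by v and then shifting z by [w v]
   gives the right side, where k and mz combine to exp (- |z|^2 / 2), of integral [gnorm d]. *)
suff LG : (Jint (invmx Sig) * L = (gnorm d)%:E * \int[lebesgue n]_v F v)%E.
  rewrite muleCA LG muleA -EFinM mulVf ?gt_eqF// mul1e//.
have linD z (v : n.-tuple mR) : lin (tup (vec z + w v)) = tup (vec (lin z) + vec v).
  by rewrite /lin !tupK mulmxDr Uw.
have mlin2 (c : R) : measurable_fun setT (fun z : n.-tuple mR * d.-tuple mR =>
    tup (c *: vec z.1 + vec (lin z.2))).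
  apply: measurable_tup; apply: measurable_mxD; last first.
    by apply: measurable_mx_vec; exact: (measurableT_comp measurable_lin).
  move=> i j; rewrite (_ : (fun z => _) = (fun z => c * vec z.1 i j)).
    by apply: measurable_funM => //; apply: measurable_mx_vec.
  by apply/funext => z; rewrite mxE.
transitivity (\int[lebesgue n]_v \int[lebesgue d]_z
    ((k v)%:E * (F (tup (1 *: vec v + vec (lin z))) * (mz z)%:E)))%E.
  rewrite /Jint -ge0_integralZr//.
  apply: eq_integral => v _; rewrite -/(k v).
  have shL : (L = \int[lebesgue d]_z (F (tup (1 *: vec v + vec (lin z))) * (mz z)%:E))%E.
    have Lz0 z : (0 <= F (lin z) * (mz z)%:E)%E by rewrite mule_ge0 ?lee_fin.
    rewrite /L -(ge0_integral_shift (w v) mLz Lz0); apply: eq_integral => z _.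
    by rewrite mz_shift linD scale1r addrC.
  rewrite shL -ge0_integralZl//.
  - apply: emeasurable_funM => //; apply: measurableT_comp => //.
    apply: measurable_tup; apply: measurable_mxD; first exact: measurable_mx_cst.
    by apply: measurable_mx_vec; exact: measurable_lin.
  - by move=> z _; rewrite mule_ge0 ?lee_fin.
  - by rewrite lee_fin.
have m2 (c : R) : measurable_fun setT (fun z : n.-tuple mR * d.-tuple mR =>
    F (tup (c *: vec z.1 + vec (lin z.2)))).
  exact: measurableT_comp.
have mk2 : measurable_fun setT (fun z : n.-tuple mR * d.-tuple mR => (k z.1)%:E).
  exact: (measurableT_comp mk).
have mz2 : measurable_fun setT (fun z : n.-tuple mR * d.-tuple mR => (mz z.2)%:E).
  exact: (measurableT_comp mmz).
pose h1 v z := ((k v)%:E * (F (tup (1 *: vec v + vec (lin z))) * (mz z)%:E))%E.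
have mh1 : measurable_fun setT (fun z => h1 z.1 z.2).
  by apply: emeasurable_funM => //; apply: emeasurable_funM.
have h10 : forall x y, (0 <= h1 x y)%E by move=> x y; rewrite /h1 !mule_ge0 ?lee_fin.
rewrite [LHS](tonelli (lebesgue n) (lebesgue d) mh1 h10).
transitivity (\int[lebesgue d]_z \int[lebesgue n]_v
    ((k (tup (-1 *: vec (lin z) + vec v)))%:E * (F v * (mz z)%:E)))%E.
  apply: eq_integral => z _.
  pose G v := ((k (tup (-1 *: vec (lin z) + vec v)))%:E * (F v * (mz z)%:E))%E.
  have mG : measurable_fun setT G.
    apply: emeasurable_funM; last by apply: emeasurable_funM.
    apply: (measurableT_comp mk); apply: measurable_tup; apply: measurable_mxD.
      exact: measurable_mx_cst.
    exact: measurable_vec.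
  have G0 v : (0 <= G v)%E by rewrite /G !mule_ge0 ?lee_fin.
  rewrite -(ge0_integral_shift (vec (lin z)) mG G0); apply: eq_integral => v _.
  by rewrite /h1 /G tupK scale1r scaleN1r addrCA addNr addr0 vecK.
pose h2 v z := ((k (tup (-1 *: vec (lin z) + vec v)))%:E * (F v * (mz z)%:E))%E.
have mh2 : measurable_fun setT (fun z => h2 z.1 z.2).
  apply: emeasurable_funM.
    apply: (measurableT_comp mk); apply: measurable_tup; apply: measurable_mxD.
      move=> i j; rewrite (_ : (fun z => _) = (fun z => - vec (lin z.2) i j)).
        apply: measurable_funN; apply: measurable_mx_vec.
        exact: (measurableT_comp measurable_lin).
      by apply/funext => z; rewrite scaleN1r mxE.
    exact: measurable_mx_vec.
  by apply: emeasurable_funM => //; exact: (measurableT_comp mF).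
have h20 : forall x y, (0 <= h2 x y)%E by move=> x y; rewrite /h2 !mule_ge0 ?lee_fin.
rewrite -[LHS](tonelli (lebesgue n) (lebesgue d) mh2 h20).
rewrite -ge0_integralZl//; last by rewrite lee_fin ltW.
apply: eq_integral => v _.
have mkv : measurable_fun setT (fun z => (k (tup (-1 *: vec (lin z) + vec v)))%:E).
  apply: (measurableT_comp mk); apply: measurable_tup; apply: measurable_mxD.
    move=> i j; rewrite (_ : (fun z => _) = (fun z => - vec (lin z) i j)).
      by apply: measurable_funN; apply: measurable_mx_vec; exact: measurable_lin.
    by apply/funext => z; rewrite scaleN1r mxE.
  exact: measurable_mx_cst.
have mkmv : measurable_fun setT
    (fun z => (k (tup (-1 *: vec (lin z) + vec v)))%:E * (mz z)%:E)%E.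
  exact: emeasurable_funM.
have kmv0 z : (0 <= (k (tup (-1 *: vec (lin z) + vec v)))%:E * (mz z)%:E)%E.
  by rewrite mule_ge0 ?lee_fin.
transitivity (F v * \int[lebesgue d]_z
    ((k (tup (-1 *: vec (lin z) + vec v)))%:E * (mz z)%:E))%E.
  by rewrite -ge0_integralZl//; apply: eq_integral => z _; rewrite muleCA.
rewrite muleC; congr (_ * _)%E.
rewrite -Jint1 -(ge0_integral_shift (w v) mkmv kmv0).
apply: eq_integral => z _; rewrite mz_shift linD !tupK scaleN1r opprD subrK.
rewrite /k /lin !tupK qfN /mz -EFinM -expRD.
by congr (expR _)%:E; ring.
Qed.

End linear_images.

End gaussian_form_integrals.

Section unit_mass.
Context {d : measure_display} {S : measurableType d} {R : realType}.
Variable m : {measure set S -> \bar R}.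
Hypothesis m1 : m setT = 1%E.

Lemma integrable_cst_mass1 (c : R) : m.-integrable setT (fun=> c%:E).
Proof.
apply/integrableP; split; first exact: measurable_cst.
by rewrite integral_cst// [X in (_ * X)%E]m1 mule1 ltry.
Qed.

Lemma integral_cst_mass1 (c : R) : (\int[m]_x c%:E = c%:E)%E.
Proof. by rewrite integral_cst// [X in (_ * X)%E]m1 mule1. Qed.

Lemma integrable_bounded_mass1 (f : S -> R) (c : R) :
  measurable_fun setT f -> (forall x, `|f x| <= c) ->
  m.-integrable setT (fun x => (f x)%:E).
Proof.
move=> mf fc; apply: (le_integrable measurableT _ _ (integrable_cst_mass1 c)).
  exact/measurable_EFinP.
by move=> x _ /=; rewrite lee_fin (le_trans (fc x))// ler_norm.
Qed.

(** The tangent line of the exponential at the mean a, e^a (1 + X - a) <= e^X, is integrated. *)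
Lemma jensen_expR (X : S -> R) : m.-integrable setT (fun x => (X x)%:E) ->
  ((expR (fine (\int[m]_x (X x)%:E)))%:E <= \int[m]_x (expR (X x))%:E)%E.
Proof.
move=> iX; set a := fine _.
have aE : (\int[m]_x (X x)%:E = a%:E)%E.
  by rewrite fineK//; exact: integral_fune_fin_num.
have mX : measurable_fun setT X by apply/measurable_EFinP; case/integrableP: iX.
have mE : measurable_fun setT (fun x => (expR (X x))%:E).
  by apply/measurable_EFinP; exact: measurableT_comp.
have [->|] := eqVneq (\int[m]_x (expR (X x))%:E)%E +oo%E; first by rewrite leey.
rewrite -ltey => finE.
have iE : m.-integrable setT (fun x => (expR (X x))%:E).
  apply/integrableP; split => //.
  by under eq_integral do rewrite gee0_abs ?lee_fin ?expR_ge0//.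
have iZ : m.-integrable setT (fun x => (expR a)%:E * (X x)%:E)%E.
  exact: integrableZl.
have iC := integrable_cst_mass1 (expR a * (1 - a)).
have -> : ((expR a)%:E =
    \int[m]_x ((expR a * (1 - a))%:E + (expR a)%:E * (X x)%:E))%E.
  rewrite integralD// integralZl// aE integral_cst_mass1 -EFinM -EFinD.
  by congr EFin; ring.
apply: le_integral => //; first exact: integrableD.
move=> x _; rewrite -EFinM -EFinD lee_fin.
have -> : X x = a + (X x - a) by ring.
rewrite expRD -mulrDr ler_pM2l ?expR_gt0//.
apply: le_trans (expR_ge1Dx _).
by rewrite le_eqVlt; apply/orP; left; apply/eqP; ring.
Qed.

End unit_mass.

(** * Comparison of a Gaussian linear image with a standard Gaussian vector *)

Section gaussian_variational.
Context {R : realType}.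
Notation mR := (measurableTypeR R).

Lemma qf_mul n d (U : 'M[R]_(n, d)) (S : 'M[R]_n) (z : 'cV[R]_d) :
  qf S (U *m z) = qf (U^T *m S *m U) z.
Proof. by rewrite /qf trmx_mul !mulmxA. Qed.

(* [ln x <= x - 1] is used to replace [- ln (\det (U *m U^T)) / 2] by [Jint]. *)
Lemma gauss_variational n d (U : 'M[R]_(n, d)) (Psi : n.-tuple mR -> R) (c : R) :
  measurable_fun setT Psi -> (forall v, 0 <= Psi v <= c) ->
  (\int[gauss d]_z (Psi (lin U z))%:E + (n%:R / 2 + 1)%:E <=
   (ln (fine (\int[gauss n]_v (expR (Psi v))%:E)))%:E + (\tr (U *m U^T) / 2)%:E +
   ((gnorm n)^-1)%:E * Jint (U *m U^T))%E.
Proof.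
move=> mPsi Psib.
have G0 : 0 < @gnorm R n by exact: gnorm_gt0.
(* A singular Gram matrix, in particular n > d, falls under this trivial case by [Jint_schur]. *)
have [->|] := eqVneq (Jint (U *m U^T)) +oo%E.
  by rewrite gt0_muley ?lte_fin ?invr_gt0// addey// leey.
rewrite -ltey => finJ.
set Sig := U *m U^T in finJ *.
have symSig : Sig^T = Sig by rewrite /Sig trmx_mul trmxK.
have [uSig JJ] := Jint_schur symSig finJ.
have [J JE] : exists J, Jint Sig = J%:E.
  exists (fine (Jint Sig)); apply/esym/fineK.
  by rewrite (ge0_fin_numE (Jint_ge0 _)).
have G2 : 0 < gnorm n ^+ 2 :> R by rewrite exprn_gt0.
have J0 : 0 < J.
  rewrite lt_neqAle -lee_fin -JE Jint_ge0 andbT; apply/eqP => J0.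
  by move: JJ; rewrite JE -J0 mul0e => -[] /esym/eqP; rewrite gt_eqF.
have [K KE] : exists K, Jint (invmx Sig) = K%:E.
  exists (fine (Jint (invmx Sig))); apply/esym/fineK.
  rewrite (ge0_fin_numE (Jint_ge0 _)) ltey.
  by apply/eqP => Koo; move: JJ; rewrite JE Koo gt0_muley ?lte_fin.
have JK : J * K = gnorm n ^+ 2 by move: JJ; rewrite JE KE -EFinM => -[].
have K0 : 0 < K by rewrite -(pmulr_rgt0 _ J0) JK.
have mPe : measurable_fun setT (fun v => (expR (Psi v))%:E).
  by apply/measurable_EFinP; exact: measurableT_comp.
set E := (\int[gauss n]_v (expR (Psi v))%:E)%E.
(* Up to a constant, the quadratic terms are the logarithm of the ratio between the standard
   Gaussian density and the density of U z, taken at the point U z. The two forms have means tr Sig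
   and tr 1 = n. *)
pose X z := Psi (lin U z) - qf (U^T *m U) (vec z) / 2 +
  qf (U^T *m invmx Sig *m U) (vec z) / 2.
have EX : (E = ((gnorm n)^-1 * K)%:E * \int[gauss d]_z (expR (X z))%:E)%E.
  rewrite /E ge0_integral_gauss; [|by []|by move=> v; rewrite lee_fin expR_ge0].
  rewrite EFinM -muleA; congr (_ * _)%E.
  rewrite (ge0_integral_lin uSig); last 2 first.
  - apply: emeasurable_funM => //; exact: measurable_Jint.
  - by move=> v; rewrite mule_ge0// lee_fin expR_ge0.
  rewrite KE; congr (_ * _)%E; apply: eq_integral => z _.
  rewrite -!EFinM -!expRD; congr (expR _)%:E.
  have q1 : qf (U^T *m U) (vec z) = qf 1%:M (U *m vec z) by rewrite qf_mul mulmx1.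
  by rewrite /X q1 -qf_mul /lin tupK; ring.
have iPsi : (gauss d).-integrable setT (fun z => (Psi (lin U z))%:E).
  apply: (integrable_bounded_mass1 (gauss_setT d) (c := c)).
    exact: (measurableT_comp mPsi (measurable_lin U)).
  by move=> z; rewrite ger0_norm; case/andP: (Psib (lin U z)).
pose P := fine (\int[gauss d]_z (Psi (lin U z))%:E).
have PE : (\int[gauss d]_z (Psi (lin U z))%:E = P%:E)%E.
  by rewrite fineK//; exact: integral_fune_fin_num.
have iq (A : 'M[R]_d) (b : R) : (gauss d).-integrable setT (fun z => b%:E * (qf A (vec z))%:E)%E.
  by apply: integrableZl => //; exact: integrable_gauss_qf.
have XE : (fun z => (X z)%:E) = (fun z => (Psi (lin U z))%:E +
   ((- 2^-1)%:E * (qf (U^T *m U) (vec z))%:E +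
    2^-1%:E * (qf (U^T *m invmx Sig *m U) (vec z))%:E))%E.
  by apply/funext => z; rewrite -!EFinM -!EFinD /X; congr EFin; ring.
have iqq : (gauss d).-integrable setT (fun z => (- 2^-1)%:E * (qf (U^T *m U) (vec z))%:E +
    2^-1%:E * (qf (U^T *m invmx Sig *m U) (vec z))%:E)%E.
  by apply: integrableD.
have iX : (gauss d).-integrable setT (fun z => (X z)%:E).
  by rewrite XE; apply: integrableD.
have IX : (\int[gauss d]_z (X z)%:E = (P - \tr Sig / 2 + n%:R / 2)%:E)%E.
  rewrite XE integralD// integralD// !integralZl//; try exact: integrable_gauss_qf.
  rewrite !integral_gauss_qf PE -!EFinM -!EFinD; congr EFin.
  rewrite mxtrace_mulC -/Sig (mxtrace_mulC (U^T *m _)) mulmxA mulmxV// mxtrace1.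
  by ring.
have := jensen_expR (gauss_setT d) iX; rewrite IX /=.
set a := P - _ + _.
have Efin : E \is a fin_num.
  rewrite ge0_fin_numE; last by apply: integral_ge0 => v _; rewrite lee_fin expR_ge0.
  apply: (@le_lt_trans _ _ (expR c)%:E); last exact: ltry.
  rewrite -(integral_cst_mass1 (gauss_setT n) (expR c)).
  apply: ge0_le_integral => //.
  by move=> v _; rewrite lee_fin ler_expR; case/andP: (Psib v).
have GK0 : 0 < (gnorm n)^-1 * K by rewrite mulr_gt0// invr_gt0.
rewrite -(@lee_pmul2l _ ((gnorm n)^-1 * K)%:E)// ?lte_fin//.
rewrite -EX -(fineK Efin) -EFinM lee_fin => aE.
rewrite PE JE -EFinM -!EFinD lee_fin.
have lnE : ln ((gnorm n)^-1 * K) + a <= ln (fine E).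
  have Ka0 : 0 < (gnorm n)^-1 * K * expR a by rewrite mulr_gt0// expR_gt0.
  rewrite -{1}(expRK a) -lnM ?posrE ?expR_gt0//.
  by rewrite ler_ln ?posrE//; exact: lt_le_trans aE.
(* By [JK], gnorm^-1 K is the inverse of gnorm^-1 J, so that only the explicit integral over Sig
   itself survives. *)
have lnJ : - ln ((gnorm n)^-1 * K) <= (gnorm n)^-1 * J - 1.
  have -> : (gnorm n)^-1 * K = ((gnorm n)^-1 * J)^-1.
    apply: (mulfI (x := gnorm n * J)); first by rewrite gt_eqF// mulr_gt0.
    rewrite mulrACA mulfV ?gt_eqF// mul1r JK; field.
    by rewrite !gt_eqF.
  have GJ0 : 0 < (gnorm n)^-1 * J by rewrite mulr_gt0// invr_gt0.
  rewrite lnV ?posrE// opprK.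
  have := expR_ge1Dx (ln ((gnorm n)^-1 * J)); rewrite lnK ?posrE//; lra.
rewrite /a in lnE; lra.
Qed.

End gaussian_variational.

(** * Resampling the rows *)

Section independent_pairs.
Context {d1 d2 d' : measure_display} {S1 : measurableType d1}
  {S2 : measurableType d2} {T : measurableType d'} {R : realType}.
Variables (m1 : {sigma_finite_measure set S1 -> \bar R})
  (m2 : {sigma_finite_measure set S2 -> \bar R}).

Lemma indep_family_tnth (n : nat) (mu : 'I_n -> {sigma_finite_measure set T -> \bar R}) :
  (forall i, mu i setT = 1%E) ->
  indep_family (prod_measure mu) (fun i t => tnth t i) mu.
Proof.
split => // [i|A mA]; first exact: measurable_tnth.
exact: prod_measure_box.
Qed.

Lemma indep_family_id (m : {sigma_finite_measure set T -> \bar R}) :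
  m setT = 1%E -> indep_family m (fun (_ : unit) => id) (fun=> m).
Proof.
move=> mT; split => // A mA; rewrite (big_pred1 tt) => [|[]//].
by congr (m _); apply/seteqP; split => [x|x Ax []]//; apply.
Qed.

Definition sum_family (I J : Type) (X : I -> S1 -> T) (Y : J -> S2 -> T) (k : I + J) :
    S1 * S2 -> T :=
  match k with inl i => X i \o fst | inr j => Y j \o snd end.

Lemma indep_family_pair (I J : finType) (X : I -> S1 -> T) (Y : J -> S2 -> T)
    (mu : {sigma_finite_measure set T -> \bar R}) :
  indep_family m1 X (fun=> mu) -> indep_family m2 Y (fun=> mu) ->
  indep_family (m1 \x m2)%E (sum_family X Y) (fun=> mu).
Proof.
move=> [mX mu1 XE] [mY mu1' YE]; split => [[i|j]|[i|j]|A mA].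
- exact: (measurableT_comp (mX i)).
- exact: (measurableT_comp (mY j)).
- exact: mu1 i.
- exact: mu1' j.
- have msub d (S : measurableType d) (K : finType) (Z : K -> S -> T) (B : K -> set T) :
      (forall i, measurable_fun setT (Z i)) -> (forall i, measurable (B i)) ->
      measurable [set w | forall i, B i (Z i w)].
    move=> mZ mB; rewrite (_ : [set _ | _] =
        \bigcap_(i in [set: K]) (Z i @^-1` B i)); last first.
      by apply/seteqP; split => [w H i _|w H i]; [exact: H|exact: (H i)].
    apply: fin_bigcap_measurable => // i _.
    by rewrite -[X in measurable X]setTI; exact: mZ.
  rewrite (_ : [set w | _] = [set w | forall i, A (inl i) (X i w)] `*`
      [set w | forall j, A (inr j) (Y j w)]); last first.
    apply/seteqP; split => [[x y] /= H|[x y] /= [Hx Hy] [i|j]].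
    - by split => i; [exact: (H (inl i))|exact: (H (inr i))].
    - exact: (Hx i).
    - exact: (Hy j).
  rewrite big_sumType /= -XE// -YE//.
  apply: product_measure1E.
  - by apply: (msub _ _ _ X (fun i => A (inl i))).
  - by apply: (msub _ _ _ Y (fun j => A (inr j))).
Qed.

(** Drawing members from two independent i.i.d. families with a common law gives an i.i.d. family
    again, as long as none is drawn twice. Row and column replacements are both of this form. *)
Lemma ge0_integral_resample (I J : finType) (X : I -> S1 -> T) (Y : J -> S2 -> T)
    (mu : {sigma_finite_measure set T -> \bar R}) (k : nat) (s : 'I_k -> I + J)
    (f : k.-tuple T -> \bar R) :
  indep_family m1 X (fun=> mu) -> indep_family m2 Y (fun=> mu) -> injective s ->
  measurable_fun setT f -> (forall t, 0 <= f t)%E ->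
  (\int[m1]_x \int[m2]_y f (select (sum_family X Y) s (x, y)) =
   \int[prod_measure (fun _ : 'I_k => mu)]_t f t)%E.
Proof.
move=> iX iY injs mf f0.
have iXY := indep_family_pair iX iY.
rewrite -(ge0_integral_indep_family iXY injs mf f0).
rewrite [RHS]fubini_tonelli1//.
apply: measurableT_comp => //; apply: measurable_select.
by case: iXY.
Qed.

End independent_pairs.

(** * Replacement of the columns one at a time *)

Section chain.
Context {R : realType}.
Notation mR := (measurableTypeR R).
Variables (n d N : nat) (a : 'I_d -> R) (e : 'I_N -> 'I_n * 'I_n).
Hypothesis e_inj : injective e.
Hypothesis e_lt : forall k, ((e k).1 < (e k).2)%N.
Hypothesis a_sqr : \sum_k a k ^+ 2 = 1.

Definition gauss_rows : {sigma_finite_measure set (n.-tuple (d.-tuple mR)) -> \bar R} :=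
  prod_measure (fun _ : 'I_n => gauss d).

Lemma gauss_rows_setT : gauss_rows setT = 1%E.
Proof. by apply: prod_measure_setT => i; exact: gauss_setT. Qed.

Implicit Types (w : n.-tuple (d.-tuple mR)) (xi : N.-tuple mR).

Definition rows_mx w : 'M[R]_(n, d) := \matrix_(i, k) (a k * tnth (tnth w i) k).

Definition gram_entry w (k : 'I_N) : mR :=
  \sum_l a l * (tnth (tnth w (e k).1) l : R) * tnth (tnth w (e k).2) l.

Definition mix (t : nat) w xi : N.-tuple mR :=
  [tuple if ((e k).2 < t)%N then gram_entry w k else tnth xi k | k < N].

Definition gram_tuple w : N.-tuple mR := [tuple gram_entry w k | k < N].

(** Both updates are encoded as selections from a disjoint union, so that [ge0_integral_resample]
    shows that they preserve the Gaussian laws. *)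
Definition row_upd (t : 'I_n) : n.-tuple (d.-tuple mR) * d.-tuple mR -> n.-tuple (d.-tuple mR) :=
  select (sum_family (fun (i : 'I_n) w => tnth w i) (fun (_ : unit) => id))
    (fun i => if i == t then inr tt else inl i).

Definition col_upd (t : 'I_n) : N.-tuple mR * n.-tuple mR -> N.-tuple mR :=
  select (sum_family (fun (k : 'I_N) xi => tnth xi k) (fun (i : 'I_n) v => tnth v i))
    (fun k => if (e k).2 == t then inr (e k).1 else inl k).

Lemma tnth_row_upd t w z i :
  tnth (row_upd t (w, z)) i = if i == t then z else tnth w i.
Proof. by rewrite tnth_mktuple; case: eqP. Qed.

Lemma tnth_col_upd t xi v k :
  tnth (col_upd t (xi, v)) k = if (e k).2 == t then tnth v (e k).1 else tnth xi k.
Proof. by rewrite tnth_mktuple; case: eqP. Qed.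

Lemma measurable_row_upd t : measurable_fun setT (row_upd t).
Proof.
apply: measurable_select => -[i|[]] /=.
- have mt := @measurable_tnth _ (d.-tuple mR) n i.
  exact: (measurableT_comp mt).
- exact: measurable_snd.
Qed.

Lemma measurable_col_upd t : measurable_fun setT (col_upd t).
Proof.
apply: measurable_select => -[i|i] /=.
- have mt := @measurable_tnth _ mR N i; exact: (measurableT_comp mt).
- have mt := @measurable_tnth _ mR n i; exact: (measurableT_comp mt).
Qed.

Lemma ge0_integral_row_upd t (f : n.-tuple (d.-tuple mR) -> \bar R) :
  measurable_fun setT f -> (forall w, 0 <= f w)%E ->
  (\int[gauss_rows]_w \int[gauss d]_z f (row_upd t (w, z)) = \int[gauss_rows]_w f w)%E.
Proof.
move=> mf f0; apply: ge0_integral_resample => //.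
- by apply: indep_family_tnth => i; exact: gauss_setT.
- by apply: indep_family_id; exact: gauss_setT.
- by move=> i j; case: eqP => [->|_]; case: eqP => [->|_]// [].
Qed.

Lemma ge0_integral_col_upd t (f : N.-tuple mR -> \bar R) :
  measurable_fun setT f -> (forall xi, 0 <= f xi)%E ->
  (\int[gauss N]_xi \int[gauss n]_v f (col_upd t (xi, v)) = \int[gauss N]_xi f xi)%E.
Proof.
move=> mf f0; apply: ge0_integral_resample => //.
- by apply: indep_family_tnth => i; exact: probability_setT.
- by apply: indep_family_tnth => i; exact: probability_setT.
(* Two distinct entries of column t differ in their row index, so no coordinate of [v] is used
   twice. *)
- move=> i j; case: eqP => [ei|_]; case: eqP => [ej|_]// [] // eij; apply: e_inj.
  by rewrite [LHS]surjective_pairing [RHS]surjective_pairing ei ej eij.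
Qed.

(** An entry (i, j) has i < j. Columns before t therefore do not see row t, while column t pairs the
    new row z with the old rows i < t, which gives the coordinates (U z)_i. Later columns come from
    [xi] on both sides. *)
Lemma mix_upd (t : 'I_n) w z xi :
  mix t.+1 (row_upd t (w, z)) xi = mix t w (col_upd t (xi, lin (rows_mx w) z)).
Proof.
apply: eq_from_tnth => k; rewrite [LHS]tnth_mktuple [RHS]tnth_mktuple tnth_col_upd ltnS leq_eqVlt.
have [ekt|ekt] := eqVneq (e k).2 t.
  have e1t : (e k).1 != t.
    by apply/eqP => e1t; have := e_lt k; rewrite ekt e1t ltnn.
  rewrite ekt eqxx /= ltnn /lin tnth_mktuple mxE; apply: eq_bigr => l _.
  by rewrite !tnth_row_upd (negbTE e1t) ekt eqxx !mxE.
rewrite (_ : (nat_of_ord (e k).2 == t) = false); last exact/negbTE.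
rewrite /=; case: ifP => // ltk; apply: eq_bigr => l _.
rewrite !tnth_row_upd (negbTE ekt).
have /negbTE-> // : (e k).1 != t.
by apply/eqP => e1t; have := ltn_trans (e_lt k) ltk; rewrite e1t ltnn.
Qed.

Lemma measurable_gram_entry k : measurable_fun setT (gram_entry ^~ k : _ -> mR).
Proof.
have mt i l : measurable_fun setT (fun w : n.-tuple (d.-tuple mR) => (tnth (tnth w i) l : R)).
  have m1 := @measurable_tnth _ mR d l; have m2 := @measurable_tnth _ (d.-tuple mR) n i.
  exact: (measurableT_comp m1 m2).
apply: (@measurable_sum _ _ R _ _ _ (fun l w => a l * (tnth (tnth w (e k).1) l : R) * tnth (tnth w (e k).2) l)) => l.
by apply: measurable_funM => //; apply: measurable_funM.
Qed.

Lemma measurable_mix t : measurable_fun setT (fun z => mix t z.1 z.2).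
Proof.
apply/measurable_fun_tnthP => k.
rewrite (_ : _ \o _ = fun z => if ((e k).2 < t)%N then gram_entry z.1 k else tnth z.2 k).
  case: (_ < t)%N; first exact: (measurableT_comp (measurable_gram_entry k)).
  have mt := @measurable_tnth _ mR N k; exact: (measurableT_comp mt).
by apply/funext => z /=; rewrite tnth_mktuple.
Qed.

Lemma measurable_gram_tuple : measurable_fun setT gram_tuple.
Proof.
apply/measurable_fun_tnthP => k.
rewrite (_ : _ \o _ = fun w => gram_entry w k); first exact: measurable_gram_entry.
by apply/funext => z /=; rewrite tnth_mktuple.
Qed.

Lemma measurable_rows_mx : measurable_mx rows_mx.
Proof.
move=> i l; rewrite (_ : (fun w => _) = fun w => a l * (tnth (tnth w i) l : R)).
  apply: measurable_funM => //.
  have m1 := @measurable_tnth _ mR d l; have m2 := @measurable_tnth _ (d.-tuple mR) n i.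
  exact: (measurableT_comp m1 m2).
by apply/funext => w; rewrite mxE.
Qed.

Lemma measurable_expR_qf_rows : measurable_fun setT
  (fun z : n.-tuple (d.-tuple mR) * n.-tuple mR =>
    (expR (- qf (rows_mx z.1 *m (rows_mx z.1)^T) (vec z.2) / 2))%:E).
Proof.
(* Moving the varying rows into the vector leaves a form with a constant matrix, to which
   [measurable_expR_qf] applies. *)
rewrite (_ : (fun z => _) = fun z : n.-tuple (d.-tuple mR) * n.-tuple mR =>
   (expR (-1 * qf 1%:M ((rows_mx z.1)^T *m vec z.2) / 2))%:E).
  apply: measurable_expR_qf; apply: measurable_mxM.
    apply: measurable_mxT => i j.
    have mr := measurable_rows_mx i j; exact: (measurableT_comp mr).
  by apply: measurable_mx_vec.
by apply/funext => z; rewrite qf_mul trmxK mulmx1 mulN1r.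
Qed.

Lemma measurable_Jint_rows : measurable_fun setT (fun w => Jint (rows_mx w *m (rows_mx w)^T)).
Proof.
apply: (measurable_integral_snd _ (f := fun w (y : n.-tuple mR) =>
  (expR (- qf (rows_mx w *m (rows_mx w)^T) (vec y) / 2))%:E)).
  exact: measurable_expR_qf_rows.
by move=> w y; rewrite lee_fin expR_ge0.
Qed.

(** Each of the n rows contributes the sum of the a_k^2, which is 1. *)
Lemma integral_trace_rows :
  (\int[gauss_rows]_w (\tr (rows_mx w *m (rows_mx w)^T))%:E = n%:R%:E)%E.
Proof.
have trE w : (\tr (rows_mx w *m (rows_mx w)^T))%:E =
    (\sum_i \sum_k ((a k ^+ 2)%:E * ((tnth (tnth w i) k : R) ^+ 2)%:E))%E.
  rewrite -sumEFin; apply: eq_bigr => i _; rewrite mxE -sumEFin.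
  by apply: eq_bigr => k _; rewrite !mxE -EFinM; congr EFin; ring.
under eq_integral do rewrite trE.
have msq k : measurable_fun setT (fun z : d.-tuple mR => (tnth z k : R) ^+ 2).
  by apply: measurable_funX; exact: measurable_tnth_fun.
have msq2 i k : measurable_fun setT (fun w => ((tnth (tnth w i) k : R) ^+ 2)%:E).
  apply/measurable_EFinP.
  have m2 := @measurable_tnth _ (d.-tuple mR) n i.
  exact: (measurableT_comp (msq k) m2).
have Isq i k : (\int[gauss_rows]_w ((tnth (tnth w i) k : R) ^+ 2)%:E = 1)%E.
  pose g (j : 'I_n) (z : d.-tuple mR) : R := if j == i then (tnth z k : R) ^+ 2 else 1.
  transitivity (\int[gauss_rows]_w (\prod_(j < n) g j (tnth w j))%:E)%E.
    apply: eq_integral => w _; congr EFin.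
    by rewrite (bigD1 i)//= /g eqxx big1 ?mulr1// => j /negbTE ->.
  rewrite ge0_integral_prod_tnth; last 2 first.
  - by move=> j; rewrite /g; case: (j == i).
  - by move=> j z; rewrite /g; case: (j == i) => //; exact: sqr_ge0.
  rewrite (bigD1 i)//= big1 ?mule1 => [|j ji].
    by rewrite /g eqxx integral_gauss_sqr.
  by rewrite /g (negbTE ji) integral_cst_mass1//; exact: gauss_setT.
have mc i k : measurable_fun setT (fun w => ((a k ^+ 2)%:E * ((tnth (tnth w i) k : R) ^+ 2)%:E)%E).
  exact: measurable_funeM.
have c0 i k w : (0 <= (a k ^+ 2)%:E * ((tnth (tnth w i) k : R) ^+ 2)%:E)%E.
  by rewrite mule_ge0 ?lee_fin ?sqr_ge0.
rewrite ge0_integral_sum//; last 2 first.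
- by move=> i; apply: emeasurable_sum => k; exact: mc.
- by move=> i w _; apply: sume_ge0 => k _; exact: c0.
transitivity (\sum_(i < n) (1%:E : \bar R))%E; last first.
  by rewrite sumEFin sumr_const card_ord.
apply: eq_bigr => i _; rewrite ge0_integral_sum//.
rewrite -a_sqr -sumEFin; apply: eq_bigr => k _.
rewrite ge0_integralZl ?lee_fin ?sqr_ge0// ?Isq ?mule1// => w _.
by rewrite lee_fin sqr_ge0.
Qed.

Variables (g : N.-tuple mR -> R) (c : R).
Hypothesis mg : measurable_fun setT g.
Hypothesis gb : forall x, 0 <= g x <= c.

Let mge {d'} {S : measurableType d'} (h : S -> N.-tuple mR) : measurable_fun setT h ->
  measurable_fun setT (fun s => (expR (g (h s)))%:E).
Proof.
move=> mh; apply/measurable_EFinP; apply: measurableT_comp => //.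
exact: (measurableT_comp mg).
Qed.

Let exp_integral_bounds (h : N.-tuple mR -> N.-tuple mR) : measurable_fun setT h ->
  let Z := (\int[gauss N]_xi (expR (g (h xi)))%:E)%E in
  Z \is a fin_num /\ 1 <= fine Z <= expR c.
Proof.
move=> mh Z.
have Z1 : (1 <= Z)%E.
  rewrite -(integral_cst_mass1 (gauss_setT N) 1); apply: ge0_le_integral => //.
  - exact: mge.
  - move=> xi _; rewrite lee_fin -expR0 ler_expR.
    by case/andP: (gb (h xi)).
have Zc : (Z <= (expR c)%:E)%E.
  rewrite -(integral_cst_mass1 (gauss_setT N) (expR c)); apply: ge0_le_integral => //.
  - exact: mge.
  - by move=> xi _; rewrite lee_fin ler_expR; case/andP: (gb (h xi)).
have Zfin : Z \is a fin_num.
  rewrite ge0_fin_numE ?(le_trans _ Z1)// ?lee_fin//.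
  exact: le_lt_trans Zc (ltry _).
by split => //; rewrite -!lee_fin fineK// Z1.
Qed.

Let ln_bounds (x : R) : 1 <= x <= expR c -> 0 <= ln x <= c.
Proof.
case/andP => x1 xc; have x0 : 0 < x by rewrite (lt_le_trans _ x1).
by rewrite ln_ge0//= -[leRHS](expRK c) ler_ln ?posrE ?expR_gt0.
Qed.

Let measurable_ln_integral {d'} {S : measurableType d'} (h : S -> N.-tuple mR -> N.-tuple mR) :
  measurable_fun setT (fun z => h z.1 z.2) ->
  measurable_fun setT (fun s => ln (fine (\int[gauss N]_xi (expR (g (h s xi)))%:E))).
Proof.
move=> mh; apply: (measurableT_comp (@measurable_ln R)).
apply: (@measurableT_comp _ _ _ _ _ _ fine) => //.
apply: (measurable_integral_snd _ (f := fun s xi => (expR (g (h s xi)))%:E)).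
  exact: mge.
by move=> s xi; rewrite lee_fin expR_ge0.
Qed.

(** Interpolates between ln E exp g of the Gaussian vector at t = 0 and g of the Gram entries at t =
    n. With [ln] outside the Gaussian average but inside the average over the rows, each step has
    the shape of [gauss_variational]. *)
Definition hybrid (t : nat) w : R :=
  ln (fine (\int[gauss N]_xi (expR (g (mix t w xi)))%:E)).

Let mixw t w : measurable_fun setT (mix t w).
Proof.
exact: (measurableT_comp (measurable_mix t) (pair1_measurable w)).
Qed.

Lemma hybrid_bounds t w : 0 <= hybrid t w <= c.
Proof. by apply: ln_bounds; case: (exp_integral_bounds (mixw t w)). Qed.

Lemma measurable_hybrid t : measurable_fun setT (hybrid t).
Proof. by apply: measurable_ln_integral; exact: measurable_mix. Qed.

Let hybrid_upd (t : 'I_n) w v : R :=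
  ln (fine (\int[gauss N]_xi (expR (g (mix t w (col_upd t (xi, v)))))%:E)).

Let mcol (t : 'I_n) w : measurable_fun setT
  (fun z : n.-tuple mR * N.-tuple mR => mix t w (col_upd t (z.2, z.1))).
Proof.
apply: (measurableT_comp (mixw t w)); apply: (measurableT_comp (measurable_col_upd t)).
exact: measurable_swap.
Qed.

Let mcol2 (t : 'I_n) w v : measurable_fun setT (fun xi => mix t w (col_upd t (xi, v))).
Proof.
apply: (measurableT_comp (mixw t w)); apply: (measurableT_comp (measurable_col_upd t)).
exact: pair2_measurable.
Qed.

(* Row [t] is resampled while all [n] current rows, the old row [t] included,
   serve as the linear map [U]; only the coordinates [i < t] of [U z] enter. *)
Let hybrid_pointwise (t : 'I_n) w :
  (\int[gauss d]_z (hybrid t.+1 (row_upd t (w, z)))%:E + (n%:R / 2 + 1)%:E <=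
   (hybrid t w)%:E + (\tr (rows_mx w *m (rows_mx w)^T) / 2)%:E +
   ((gnorm n)^-1)%:E * Jint (rows_mx w *m (rows_mx w)^T))%E.
Proof.
have mH : measurable_fun setT (hybrid_upd t w).
  exact: (measurable_ln_integral (h := fun v xi => mix t w (col_upd t (xi, v)))).
have Hb v : 0 <= hybrid_upd t w v <= c.
  by apply: ln_bounds; case: (exp_integral_bounds (mcol2 t w v)).
have GV := gauss_variational (rows_mx w) mH Hb.
(* Here [expR] cancels the [ln] of [hybrid_upd], and a fresh Gaussian column put into a Gaussian
   vector leaves its law unchanged. *)
have ZE : (\int[gauss n]_v (expR (hybrid_upd t w v))%:E =
    \int[gauss N]_xi (expR (g (mix t w xi)))%:E)%E.
  transitivity (\int[gauss n]_v \int[gauss N]_xi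
      (expR (g (mix t w (col_upd t (xi, v)))))%:E)%E.
    apply: eq_integral => v _.
    have [Zf /andP[Z1 _]] := exp_integral_bounds (mcol2 t w v).
    by rewrite lnK ?posrE ?(lt_le_trans ltr01)// fineK.
  pose h v xi := (expR (g (mix t w (col_upd t (xi, v)))))%:E.
  have mh : measurable_fun setT (fun z => h z.1 z.2) by apply: mge; exact: mcol.
  have h0 : forall x y, (0 <= h x y)%E by move=> x y; rewrite lee_fin expR_ge0.
  rewrite [LHS](tonelli (gauss n) (gauss N) mh h0).
  apply: (ge0_integral_col_upd t (f := fun xi => (expR (g (mix t w xi)))%:E)).
  - exact: mge.
  - by move=> xi; rewrite lee_fin expR_ge0.
rewrite ZE -/(hybrid t w) in GV.
have HE : (\int[gauss d]_z (hybrid t.+1 (row_upd t (w, z)))%:E =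
  \int[gauss d]_z (hybrid_upd t w (lin (rows_mx w) z))%:E)%E.
  apply: eq_integral => z _; rewrite /hybrid /hybrid_upd.
  by under eq_integral do rewrite mix_upd.
by rewrite HE; exact: GV.
Qed.

Let Jw w := (((gnorm n)^-1)%:E * Jint (rows_mx w *m (rows_mx w)^T))%E.

Let mhE t : measurable_fun setT (fun w => (hybrid t w)%:E).
Proof. by apply/measurable_EFinP; exact: measurable_hybrid. Qed.

Let hE0 t w : (0 <= (hybrid t w)%:E)%E.
Proof. by rewrite lee_fin; case/andP: (hybrid_bounds t w). Qed.

(** Integrates [hybrid_pointwise] over the rows: resampling a row preserves their law, and half the
    mean trace is n / 2. That constant stays on both sides so that no subtraction of extended reals
    occurs. *)
Lemma hybrid_step (t : 'I_n) :
  (\int[gauss_rows]_w (hybrid t.+1 w)%:E + (n%:R / 2 + 1)%:E <=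
   \int[gauss_rows]_w (hybrid t w)%:E + (n%:R / 2)%:E + \int[gauss_rows]_w Jw w)%E.
Proof.
have trw0 w : 0 <= \tr (rows_mx w *m (rows_mx w)^T).
  rewrite /mxtrace; apply: sumr_ge0 => i _; rewrite mxE; apply: sumr_ge0 => k _.
  by rewrite [X in _ * X]mxE -expr2 sqr_ge0.
have mtr : measurable_fun setT (fun w => (\tr (rows_mx w *m (rows_mx w)^T) / 2)%:E).
  apply/measurable_EFinP; apply: measurable_funM => //.
  apply: measurable_sum => i.
  by apply: measurable_mxM; [|apply: measurable_mxT]; exact: measurable_rows_mx.
have mJw : measurable_fun setT Jw by apply: measurable_funeM; exact: measurable_Jint_rows.
have Jw0 w : (0 <= Jw w)%E.
  by rewrite mule_ge0 ?Jint_ge0// lee_fin invr_ge0 ltW// gnorm_gt0.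
have trE : ((n%:R / 2)%:E = \int[gauss_rows]_w (\tr (rows_mx w *m (rows_mx w)^T) / 2)%:E)%E.
  under eq_integral do rewrite EFinM.
  rewrite ge0_integralZr//.
  - by rewrite integral_trace_rows.
  - apply/measurable_EFinP; apply: measurable_sum => i.
    by apply: measurable_mxM; [|apply: measurable_mxT]; exact: measurable_rows_mx.
  - by move=> w _; rewrite lee_fin.
have rs : (\int[gauss_rows]_w \int[gauss d]_z (hybrid t.+1 (row_upd t (w, z)))%:E =
    \int[gauss_rows]_w (hybrid t.+1 w)%:E)%E.
  exact: (ge0_integral_row_upd t (mhE t.+1) (hE0 t.+1)).
have c1 := integral_cst_mass1 gauss_rows_setT (n%:R / 2 + 1).
rewrite -rs -c1. rewrite trE.
have mrow : measurable_fun setT (fun w => \int[gauss d]_z (hybrid t.+1 (row_upd t (w, z)))%:E)%E.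
  apply: (measurable_integral_snd _ (f := fun w z => (hybrid t.+1 (row_upd t (w, z)))%:E)) => //.
  apply: (measurableT_comp (mhE t.+1)).
  rewrite (_ : (fun z => _) = row_upd t); first exact: measurable_row_upd.
  by apply/funext => -[].
have row0 w : (0 <= \int[gauss d]_z (hybrid t.+1 (row_upd t (w, z)))%:E)%E.
  by apply: integral_ge0.
have n0 : 0 <= n%:R / 2 + 1 :> R by rewrite addr_ge0// divr_ge0.
have tr0 w : (0 <= (\tr (rows_mx w *m (rows_mx w)^T) / 2)%:E)%E by rewrite lee_fin divr_ge0.
have mhr := mhE t.
have hr0 := hE0 t.
rewrite -ge0_integralD//.
rewrite -ge0_integralD// -ge0_integralD//; last 2 first.
- by move=> w _; rewrite adde_ge0.
- exact: emeasurable_funD.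
apply: ge0_le_integral => //.
- by move=> w _; rewrite adde_ge0.
- exact: emeasurable_funD.
- by apply: emeasurable_funD => //; exact: emeasurable_funD.
Qed.

Lemma chain_bound (delta : R) :
  (\int[gauss_rows]_w Jw w <= (1 + delta)%:E)%E ->
  (\int[gauss_rows]_w (g (gram_tuple w))%:E <=
   (ln (fine (\int[gauss N]_xi (expR (g xi))%:E)) + n%:R * delta)%:E)%E.
Proof.
move=> Jd.
have mixn w xi : mix n w xi = gram_tuple w.
  by apply: eq_from_tnth => k; rewrite !tnth_mktuple ltn_ord.
have mix0 w xi : mix 0 w xi = xi.
  by apply: eq_from_tnth => k; rewrite tnth_mktuple.
(* No Gaussian entry is left, so the inner integral is that of a constant and [ln] undoes [expR]. *)
have hn w : hybrid n w = g (gram_tuple w).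
  rewrite /hybrid; under eq_integral do rewrite mixn.
  by rewrite (integral_cst_mass1 (gauss_setT N)) /= expRK.
set L := ln _.
have h0 w : hybrid 0 w = L.
  by rewrite /hybrid /L; under eq_integral do rewrite mix0.
suff H t : (t <= n)%N ->
    (\int[gauss_rows]_w (hybrid t w)%:E <= (L + t%:R * delta)%:E)%E.
  by have := H n (leqnn n); under eq_integral do rewrite hn.
elim: t => [|t IH] tn.
  under eq_integral do rewrite h0.
  by rewrite (integral_cst_mass1 gauss_rows_setT) mul0r addr0.
have := hybrid_step (Ordinal tn) => /= step.
have {}IH := IH (ltnW tn).
rewrite -(@leeD2rE _ (n%:R / 2 + 1)%:E)//.
apply: (le_trans step).
apply: (@le_trans _ _ ((L + t%:R * delta)%:E + (n%:R / 2)%:E + (1 + delta)%:E)%E).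
  by apply: leeD => //; apply: leeD.
by rewrite -!EFinD lee_fin -natr1; lra.
Qed.

End chain.

(** * The expected Gaussian integral *)

Section gaussian_convolution.
Context {R : realType}.
Notation mR := (measurableTypeR R).
Notation N01 := (normal_prob (0 : R) 1).

(* [Hfac b r u] is the expectation of [expR (- b * (u + Z) ^+ 2 / 2)] for a
   centered Gaussian [Z] with variance [r]. *)
Definition Hfac (b r u : R) : R :=
  (Num.sqrt (1 + b * r))^-1 * expR (- (b / (1 + b * r) * u ^+ 2) / 2).

Lemma Hfac_ge0 b r u : 0 <= Hfac b r u.
Proof. by rewrite mulr_ge0 ?expR_ge0// invr_ge0 sqrtr_ge0. Qed.

Lemma measurable_Hfac {d'} {S : measurableType d'} b r (f : S -> R) :
  measurable_fun setT f -> measurable_fun setT (fun s => Hfac b r (f s)).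
Proof.
move=> mf; apply: measurable_funM => //; apply: measurableT_comp => //.
apply: measurable_funM => //; apply: measurable_funN; apply: measurable_funM => //.
exact: measurable_funX.
Qed.

(** Variances of independent Gaussians add. In the computation this is 1 + b (r + s^2) = (1 + b r)
    (1 + beta s^2) with beta = b / (1 + b r), after completing the square in z. *)
Lemma integral_Hfac (b r s u : R) : 0 <= b -> 0 <= r ->
  (\int[N01]_z (Hfac b r (u + s * z))%:E = (Hfac b (r + s ^+ 2) u)%:E)%E.
Proof.
move=> b0 r0.
have br : 0 < 1 + b * r by rewrite ltr_pwDl// mulr_ge0.
pose beta := b / (1 + b * r).
have beta0 : 0 <= beta by rewrite divr_ge0// ltW.
have maff : measurable_fun setT (fun z : mR => u + s * z : R).
  by apply: measurable_funD => //; apply: measurable_funM.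
rewrite ge0_integral_normal01//; last 2 first.
- by apply/measurable_EFinP; exact: measurable_Hfac.
- by move=> z; rewrite lee_fin Hfac_ge0.
have bs : 0 < 1 + beta * s ^+ 2 by rewrite ltr_pwDl// mulr_ge0// sqr_ge0.
transitivity (((Num.sqrt (2 * pi))^-1)%:E * ((Num.sqrt (1 + b * r))^-1%:E *
  \int[lebesgue_measure]_z (expR (- ((1 + beta * s ^+ 2) * z ^+ 2 +
    2 * (beta * u * s) * z + beta * u ^+ 2) / 2))%:E))%E.
  congr (_ * _)%E; rewrite -ge0_integralZl//; last exact: measurable_gauss_quad.
  apply: eq_integral => z _; rewrite /Hfac -!EFinM; congr EFin.
  rewrite -[LHS]mulrA -expRD; congr (_ * expR _).
  by rewrite -/beta; ring.
rewrite integral_gauss_quad// -!EFinM; congr EFin.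
rewrite /Hfac.
have E1 : 1 + b * (r + s ^+ 2) = (1 + b * r) * (1 + beta * s ^+ 2).
  by rewrite /beta; field; rewrite gt_eqF.
have p0 : 0 < 2 * (pi : R) by rewrite mulr_gt0// pi_gt0.
rewrite E1 (sqrtrM (1 + beta * s ^+ 2)) ?ltW// (sqrtrM (1 + beta * s ^+ 2)^-1) ?ltW//.
rewrite sqrtrV ?ltW// invfM.
have alg (x y z t : R) : x != 0 -> x^-1 * (y * (x * z * t)) = y * z * t by move=> x0; field.
have sp : Num.sqrt (2 * pi) != 0 :> R by rewrite gt_eqF// sqrtr_gt0.
rewrite alg//; congr (_ * expR _).
by rewrite invfM (mulrA b) -/beta; field; rewrite gt_eqF.
Qed.

Lemma integral_prod_Hfac (d : nat) (b : 'I_d -> R) (r s : R) (u : 'I_d -> R) :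
  (forall k, 0 <= b k) -> 0 <= r ->
  (\int[gauss d]_z (\prod_k Hfac (b k) r (u k + s * tnth z k))%:E =
   (\prod_k Hfac (b k) (r + s ^+ 2) (u k))%:E)%E.
Proof.
move=> b0 r0.
rewrite (ge0_integral_prod_tnth (fun=> N01) (g := fun k z => Hfac (b k) r (u k + s * z))).
- by rewrite -prodEFin; apply: eq_bigr => k _; rewrite integral_Hfac.
- move=> k; have maff : measurable_fun setT (fun z : mR => u k + s * z : R).
    by apply: measurable_funD => //; apply: measurable_funM.
  exact: measurable_Hfac.
- by move=> k z; exact: Hfac_ge0.
Qed.

(** The shift [u] absorbs one row at a time, whose variance y_i^2 is then collected in the second
    argument of [Hfac]. It starts from [Hfac b 0 u], which is exp (- b u^2 / 2). *)
Lemma integral_rows_Hfac (n d : nat) (b : 'I_d -> R) (y : 'I_n -> R) (u : 'I_d -> R) :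
  (forall k, 0 <= b k) ->
  (\int[gauss_rows n d]_w (\prod_k Hfac (b k) 0
     (u k + \sum_i y i * tnth (tnth w i) k))%:E =
   (\prod_k Hfac (b k) (\sum_i y i ^+ 2) (u k))%:E)%E.
Proof.
move=> b0; elim: n y u => [|n IH] y u.
  have m0 : measurable_fun setT (fun w : 0.-tuple (d.-tuple mR) =>
    (\prod_k Hfac (b k) 0 (u k + \sum_i y i * tnth (tnth w i) k))%:E).
    rewrite (_ : (fun w => _) = cst (\prod_k Hfac (b k) 0 (u k))%:E).
      exact: measurable_cst.
    apply/funext => w; congr EFin; apply: eq_bigr => k _.
    by rewrite big_ord0 addr0.
  rewrite integral_prod_measure0//.
    by congr EFin; apply: eq_bigr => k _; rewrite !big_ord0 addr0.
  by move=> w; rewrite lee_fin prodr_ge0// => k _; exact: Hfac_ge0.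
have mF : measurable_fun setT (fun w : n.+1.-tuple (d.-tuple mR) =>
    (\prod_k Hfac (b k) 0 (u k + \sum_i y i * tnth (tnth w i) k))%:E).
  apply/measurable_EFinP; apply: measurable_prod => k _.
  apply: measurable_Hfac.
  apply: measurable_funD => //; apply: measurable_sum => i.
  apply: measurable_funM => //.
  have m1 := @measurable_tnth _ mR d k; have m2 := @measurable_tnth _ (d.-tuple mR) n.+1 i.
  exact: (measurableT_comp m1 m2).
rewrite /gauss_rows ge0_integral_prod_measureS//; last first.
  by move=> w; rewrite lee_fin prodr_ge0// => k _; exact: Hfac_ge0.
transitivity (\int[gauss d]_x (\prod_k Hfac (b k) (\sum_(i < n) y (lift ord0 i) ^+ 2)
   (u k + y ord0 * tnth x k))%:E)%E.
  apply: eq_integral => x _.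
  rewrite -(IH (fun i => y (lift ord0 i)) (fun k => u k + y ord0 * tnth x k)).
  apply: eq_integral => w _; congr EFin; apply: eq_bigr => k _; congr Hfac.
  rewrite big_ord_recl addrA; congr (_ + _).
  by apply: eq_bigr => i _; rewrite tnthS.
rewrite integral_prod_Hfac//; last by apply: sumr_ge0 => i _; exact: sqr_ge0.
by congr EFin; apply: eq_bigr => k _; rewrite big_ord_recl [in RHS]addrC.
Qed.

Definition phi_tail (d : nat) (a : 'I_d -> R) (r : R) : R :=
  \prod_k (Num.sqrt (1 + a k ^+ 2 * r))^-1.

(** For fixed y the coordinates of U^T y are independent centered Gaussians with variances a_k^2
    |y|^2. The expectation of exp (- |U^T y|^2 / 2) is thus a product that depends on |y|^2 only. *)
Lemma integral_Jint_rows (n d : nat) (a : 'I_d -> R) :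
  (\int[gauss_rows n d]_w Jint (rows_mx a w *m (rows_mx a w)^T) =
   \int[lebesgue n]_y (phi_tail a (\sum_i tnth y i ^+ 2))%:E)%E.
Proof.
pose h (w : n.-tuple (d.-tuple mR)) (y : n.-tuple mR) :=
  (expR (- qf (rows_mx a w *m (rows_mx a w)^T) (vec y) / 2))%:E.
have mh : measurable_fun setT (fun z => h z.1 z.2).
  exact: (measurable_expR_qf_rows a).
have h0 : forall w y, (0 <= h w y)%E by move=> w y; rewrite lee_fin expR_ge0.
rewrite [LHS](tonelli (gauss_rows n d) (lebesgue n) mh h0).
apply: eq_integral => y _.
transitivity (\int[gauss_rows n d]_w (\prod_k Hfac (a k ^+ 2) 0
     (0 + \sum_i (tnth y i : R) * tnth (tnth w i) k))%:E)%E.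
  apply: eq_integral => w _; congr EFin.
  rewrite (_ : qf _ _ = qf 1%:M ((rows_mx a w)^T *m vec y)); last first.
    by rewrite qf_mul trmxK mulmx1.
  rewrite qf1 mulNr mulr_suml -sumrN expR_sum; apply: eq_bigr => k _.
  have -> : ((rows_mx a w)^T *m vec y) k 0 =
      a k * (\sum_i (tnth y i : R) * tnth (tnth w i) k).
    by rewrite mxE mulr_sumr; apply: eq_bigr => i _; rewrite !mxE; ring.
  by rewrite /Hfac mulr0 addr0 sqrtr1 invr1 mul1r mulr1 add0r exprMn mulNr.
rewrite integral_rows_Hfac => [|k]; last exact: sqr_ge0.
congr EFin; apply: eq_bigr => k _.
by rewrite /Hfac expr0n /= mulr0 oppr0 mul0r expR0 mulr1.
Qed.

End gaussian_convolution.

(** * Pointwise bounds on the product of inverse square roots, and its integral *)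

Section tail_bounds.
Context {R : realType}.
Notation mR := (measurableTypeR R).

Lemma expR_half (y : R) : expR (y / 2) = Num.sqrt (expR y).
Proof.
have -> : expR y = expR (y / 2) ^+ 2 by rewrite expr2 -expRD; congr expR; field.
by rewrite sqrtr_sqr ger0_norm// expR_ge0.
Qed.

(** Squared, this is 1 / (1 + x) = 1 - x / (1 + x) <= exp (- x / (1 + x)), followed by (x - x^2) (1
    + x) = x - x^3 <= x. *)
Lemma inv_sqrt1D_le (x : R) : 0 <= x ->
  (Num.sqrt (1 + x))^-1 <= expR (- (x - x ^+ 2) / 2).
Proof.
move=> x0; have x1 : 0 < 1 + x by rewrite ltr_pwDl.
rewrite -(sqrtrV (ltW x1)).
rewrite expR_half; apply: ler_wsqrtr.
apply: (@le_trans _ _ (expR (- (x / (1 + x))))).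
  apply: le_trans (expR_ge1Dx _).
  by rewrite le_eqVlt; apply/orP; left; apply/eqP; field; rewrite gt_eqF.
rewrite ler_expR lerN2 ler_pdivlMr//.
have : 0 <= x ^+ 3 by rewrite exprn_ge0.
by rewrite exprS expr2 => ?; nra.
Qed.

Lemma expR_ge_sqr (t : R) : 0 <= t -> t ^+ 2 / 4 <= expR t.
Proof.
move=> t0.
have -> : expR t = expR (t / 2) ^+ 2.
  by rewrite expr2 -expRD; congr expR; field.
have h := expR_ge1Dx (t / 2).
apply: (@le_trans _ _ ((1 + t / 2) ^+ 2)); first nra.
by rewrite lerXn2r ?nnegrE ?expR_ge0// addr_ge0// divr_ge0.
Qed.

(** Convexity of the exponential: its tangent at theta L, evaluated at L and at 0, is combined with
    weights theta and 1 - theta. For 1 + x = e^L this is (1 + x)^theta <= 1 + theta x. *)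
Lemma expR_bernoulli (theta L : R) : 0 <= theta <= 1 ->
  expR (theta * L) <= 1 + theta * (expR L - 1).
Proof.
move=> /andP[t0 t1].
have e0 := expR_gt0 (theta * L).
have h1 : expR (theta * L) * (1 + (1 - theta) * L) <= expR L.
  have -> : expR L = expR (theta * L) * expR ((1 - theta) * L).
    by rewrite -expRD; congr expR; ring.
  by rewrite ler_pM2l// expR_ge1Dx.
have h2 : expR (theta * L) * (1 - theta * L) <= 1.
  rewrite -[leRHS](divff (lt0r_neq0 e0)) ler_pM2l// -expRN.
  by have := expR_ge1Dx (- (theta * L)).
have : theta * (expR (theta * L) * (1 + (1 - theta) * L)) <= theta * expR L.
  exact: ler_wpM2l.
have : (1 - theta) * (expR (theta * L) * (1 - theta * L)) <= (1 - theta) * 1.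
  by apply: ler_wpM2l => //; rewrite subr_ge0.
by move: (expR (theta * L)) (expR L) => x y; nra.
Qed.

Section weights.
Variables (d : nat) (a : 'I_d -> R) (n : nat).
Hypothesis a_sqr : \sum_k a k ^+ 2 = 1.
Let eps := \sum_k a k ^+ 4.
Let N : R := n%:R.
Hypothesis n400 : (400 <= n)%N.
Hypothesis eps_le : N ^+ 3 * eps <= 1.

Let N0 : 0 < N. Proof. by rewrite ltr0n (leq_trans _ n400). Qed.

Let N400 : 400 <= N. Proof. by rewrite (ler_nat R 400 n). Qed.

Let eps0 : 0 <= eps.
Proof. by apply: sumr_ge0 => k _; rewrite exprn_even_ge0. Qed.

(** The product is at most exp (- r / 2 + u) with u = eps r^2 / 2, and e^u <= 1 + u e^u. The
    hypotheses give u <= r / (2 N), while r^2 <= 4 N^2 exp (r / N). Together u e^u <= 2 eps N^2 exp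
    (3 r / (2 N)), which is the origin of 3 / N. *)
Lemma phi_tail_small (r : R) : 0 <= r -> r <= N ^+ 2 ->
  phi_tail a r <= expR (- r / 2) + 2 * eps * N ^+ 2 * expR (- (1 - 3 / N) * r / 2).
Proof.
move=> r0 rN.
pose u := eps * r ^+ 2 / 2.
have phiu : phi_tail a r <= expR (- r / 2 + u).
  apply: (@le_trans _ _ (\prod_k expR (- (a k ^+ 2 * r - (a k ^+ 2 * r) ^+ 2) / 2))).
    apply: ler_prod => k _; rewrite invr_ge0 sqrtr_ge0/=.
    by apply: inv_sqrt1D_le; rewrite mulr_ge0// sqr_ge0.
  rewrite -expR_sum ler_expR le_eqVlt; apply/orP; left; apply/eqP.
  rewrite /u /eps -[X in - X / 2](mul1r r) -a_sqr !mulr_suml -sumrN mulr_suml -big_split/=.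
  by apply: eq_bigr => k _; ring.
have u0 : 0 <= u by rewrite divr_ge0// mulr_ge0// sqr_ge0.
have uN : u <= r / (2 * N).
  rewrite /u ler_pdivlMr ?mulr_gt0//.
  have : eps * r * N <= 1.
    apply: le_trans eps_le; rewrite [leRHS]mulrC exprSr mulrA ler_pM2r//.
    by rewrite ler_wpM2l.
  move=> /(ler_wpM2r r0); rewrite mul1r => h.
  by rewrite (_ : eps * r ^+ 2 / 2 * (2 * N) = eps * r * N * r) //; field.
have eu : expR u <= 1 + u * expR u.
  have := expR_ge1Dx (- u); rewrite expRN => h.
  have := expR_gt0 u => p0.
  have : expR u * (1 + - u) <= expR u * (expR u)^-1 by rewrite ler_pM2l.
  by rewrite divff ?gt_eqF//; lra.
have r2 : r ^+ 2 <= 4 * N ^+ 2 * expR (r / N).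
  have := expR_ge_sqr (divr_ge0 r0 (ltW N0)).
  rewrite expr_div_n mulrAC ler_pdivrMr ?exprn_gt0//.
  move=> h; have : 4 * (r ^+ 2 / 4) <= 4 * (expR (r / N) * N ^+ 2) by rewrite ler_pM2l.
  by rewrite (_ : 4 * (r ^+ 2 / 4) = r ^+ 2); [lra|field].
apply: (le_trans phiu); rewrite expRD.
have -> : expR (- (1 - 3 / N) * r / 2) = expR (- r / 2) * (expR (r / N) * expR (r / (2 * N))).
  by rewrite -!expRD; congr expR; field; rewrite gt_eqF.
rewrite mulrCA -[X in X + _]mulr1 -mulrDr ler_pM2l ?expR_gt0//.
apply: (le_trans eu); rewrite lerD2l mulrA.
apply: ler_pM => //; last by rewrite ler_expR.
rewrite /u ler_pdivrMr//; apply: le_trans (ler_wpM2l eps0 r2) _.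
by rewrite le_eqVlt; apply/orP; left; apply/eqP; ring.
Qed.

(* With [b = N^(-3/2)] the hypothesis on [eps] gives [a k ^+ 2 <= b], and
   Bernoulli's inequality then replaces each factor by a power of [1 + b * r]. *)
Lemma phi_tail_large (r : R) : N ^+ 2 <= r ->
  phi_tail a r <= (N ^+ 2)^-1 * (4^-1 ^+ n * (1 + r) ^- n).
Proof.
move=> rN.
pose s := Num.sqrt N.
have sN : s ^+ 2 = N by rewrite sqr_sqrtr// ltW.
have s20 : 20 <= s.
  rewrite -(ler_pXn2r (n := 2))// ?nnegrE ?sqrtr_ge0// sN.
  by apply: le_trans N400; rewrite -natrX ler_nat.
have s0 : 0 < s by rewrite (lt_le_trans _ s20).
(* With t = b r the condition r >= N^2 = s^4 becomes t >= s, and the bound [phiL] below is (1 +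
   t)^(- s^3 / 2). *)
pose t := r / s ^+ 3.
have r0 : 0 <= r by rewrite (le_trans _ rN)// sqr_ge0.
have rt : r = s ^+ 3 * t by rewrite /t mulrCA divff ?mulr1// expf_neq0// gt_eqF.
have ts : s <= t.
  rewrite /t ler_pdivlMr ?exprn_gt0// -exprS (_ : 4 = 2 * 2)%N// exprM sN//.
have t0 : 0 < t by rewrite (lt_le_trans s0).
have t1 : 0 < 1 + t by rewrite addr_gt0.
pose L := ln (1 + t).
have eL : expR L = 1 + t by rewrite lnK.
have L0 : 0 <= L by rewrite ln_ge0// lerDl ltW.
have bk k : 0 <= a k ^+ 2 * s ^+ 3 <= 1.
  have h0 : 0 <= a k ^+ 2 * s ^+ 3 by rewrite mulr_ge0 ?sqr_ge0// exprn_ge0// ltW.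
  rewrite h0 /= -(ler_pXn2r (n := 2))// ?nnegrE//.
  rewrite expr1n; apply: le_trans eps_le.
  rewrite exprMn -!exprM mulrC (_ : 3 * 2 = 2 * 3)%N// exprM sN ler_pM2l ?exprn_gt0//.
  rewrite /eps (bigD1 k)//= lerDl; apply: sumr_ge0 => j _.
  by rewrite exprn_even_ge0.
have phiL : phi_tail a r <= expR (- (s ^+ 3 * L) / 2).
  have -> : - (s ^+ 3 * L) / 2 = \sum_k (- (a k ^+ 2 * s ^+ 3 * L) / 2).
    by rewrite -mulr_suml sumrN -!mulr_suml a_sqr mul1r.
  rewrite expR_sum.
  apply: ler_prod => k _; rewrite invr_ge0 sqrtr_ge0/=.
  set q := a k ^+ 2 * s ^+ 3 * L.
  have h : expR q <= 1 + a k ^+ 2 * r.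
    have := expR_bernoulli L (bk k); rewrite eL -/q rt.
    by rewrite (_ : 1 + t - 1 = t) ?mulrA//; ring.
  have -> : expR (- q / 2) = (Num.sqrt (expR q))^-1.
    by rewrite mulNr expRN expR_half.
  rewrite lef_pV2 ?posrE ?sqrtr_gt0 ?expR_gt0//.
    by rewrite ler_wsqrtr.
  by rewrite (lt_le_trans _ h)// expR_gt0.
apply: (le_trans phiL).
(* Every factor is bounded by a power of 1 + t: N^2 = s^4 <= (1 + t)^4, 4 <= 1 + t, and 1 + r = 1 +
   s^3 t <= (1 + t)^4. The total exponent 4 + 5 n is at most s^3 / 2 since s >= 20, that is n >=
   400. *)
have inv : N ^+ 2 * (4 ^+ n * (1 + r) ^+ n) <= expR (s ^+ 3 * L / 2).
  apply: (@le_trans _ _ (expR (4%:R * L) * (expR (n%:R * L) * expR ((4 * n)%:R * L)))).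
    have t1' := ltW t1; have s0' := ltW s0; have t0' := ltW t0.
    have r1 : 0 <= 1 + r by rewrite addr_ge0.
    have A1 : N ^+ 2 <= (1 + t) ^+ 4.
      by rewrite -sN -exprM; apply: lerXn2r; rewrite ?nnegrE//; lra.
    have A2 : 4 ^+ n <= (1 + t) ^+ n.
      by apply: lerXn2r; rewrite ?nnegrE//; lra.
    have A3 : (1 + r) ^+ n <= ((1 + t) ^+ 4) ^+ n.
      apply: lerXn2r; rewrite ?nnegrE ?exprn_ge0//.
      have h1 : s ^+ 3 * t <= t ^+ 3 * t.
        by rewrite ler_pM2r//; apply: lerXn2r; rewrite ?nnegrE.
      have h2 : 0 <= t ^+ 3 by rewrite exprn_ge0.
      have h3 : 0 <= t ^+ 2 by rewrite exprn_ge0.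
      rewrite rt (_ : (1 + t) ^+ 4 = 1 + 4 * t + 6 * t ^+ 2 + 4 * t ^+ 3 + t ^+ 3 * t); last ring.
      move: h1 h2 h3; set x := t ^+ 3 * t; set y := t ^+ 3; set z := t ^+ 2; set v := s ^+ 3 * t.
      lra.
    rewrite !expRM_natl eL exprM.
    apply: ler_pM => //; rewrite ?mulr_ge0 ?exprn_ge0//.
    by apply: ler_pM => //; rewrite exprn_ge0.
  rewrite -!expRD ler_expR -!mulrDl mulrAC ler_wpM2r//.
  rewrite natrM -/N -sN ler_pdivlMr// (exprS s 2).
  have h1 : 20 * s ^+ 2 <= s * s ^+ 2 by rewrite ler_wpM2r// sqr_ge0.
  have h2 : 400 <= s ^+ 2 by rewrite sN.
  move: h1 h2; move: (s * s ^+ 2) (s ^+ 2) => x y; lra.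
rewrite mulNr expRN exprVn -!invfM lef_pV2 ?posrE ?expR_gt0//.
by rewrite !mulr_gt0 ?exprn_gt0// ltr_pwDl.
Qed.

Let c : R := 1 - 3 / N.

Let c0 : 0 < c.
Proof. by rewrite subr_gt0 ltr_pdivrMr// mul1r (lt_le_trans _ N400)// ltr_nat. Qed.

(** As (1 + 6 / N) (1 - 3 / N) >= 1 for these N, c^-1 <= 1 + 6 / N <= exp (6 / N); the power n / 2
    leaves e^3. *)
Let inv_sqrt_c : (Num.sqrt c)^-1 ^+ n <= expR 3.
Proof.
have cN : c^-1 <= expR (6 / N).
  apply: le_trans (expR_ge1Dx _); rewrite -[leLHS]div1r ler_pdivrMr// /c.
  have -> : (1 + 6 / N) * (1 - 3 / N) = 1 + (3 * N - 18) / N ^+ 2.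
    by field; rewrite gt_eqF.
  rewrite lerDl divr_ge0 ?sqr_ge0// subr_ge0.
  by apply: (@le_trans _ _ (3 * 400)); [lra|rewrite ler_pM2l].
have -> : expR 3 = (expR (3 / N)) ^+ n.
  by rewrite -expRM_natl mulrCA divff ?mulr1// gt_eqF.
rewrite lerXn2r ?nnegrE ?expR_ge0 ?invr_ge0 ?sqrtr_ge0//.
rewrite -(sqrtrV (ltW c0)) (_ : 3 / N = 6 / N / 2); last by field; rewrite gt_eqF.
by rewrite expR_half; exact: ler_wsqrtr.
Qed.

Lemma integral_oneDsqr :
  (\int[@lebesgue_measure R]_x ((1 + x ^+ 2)^-1)%:E = pi%:E)%E.
Proof.
rewrite (ge0_symfun_integralT (f := fun x : R => (1 + x ^+ 2)^-1)).
- rewrite -set_itvcy; have := @integral0y_oneDsqr R; rewrite /oneDsqr => ->.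
  by rewrite -EFinM; congr EFin; field.
- by move=> x; rewrite invr_ge0 addr_ge0// sqr_ge0.
- exact: continuous_oneDsqrV.
- by move=> x /=; rewrite sqrrN.
Qed.

Lemma expectation_Jint_le :
  (\int[gauss_rows n d]_w (((gnorm n)^-1)%:E *
     Jint (rows_mx a w *m (rows_mx a w)^T)) <=
   (1 + (2 * expR 3 * eps * N ^+ 2 + (N ^+ 2)^-1))%:E)%E.
Proof.
have G0 : 0 < @gnorm R n by exact: gnorm_gt0.
have G1 : 1 <= @gnorm R n.
  rewrite /gnorm exprn_ege1// -[leLHS]sqrtr1 ler_wsqrtr//.
  by have := @pi_ge2 R; lra.
rewrite ge0_integralZl; [|by []|exact: measurable_Jint_rows
  |by move=> w _; exact: Jint_ge0|by rewrite lee_fin invr_ge0 ltW].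
rewrite integral_Jint_rows.
(* [f1] is the main term, of integral [gnorm n]. [f2] carries the error for |y|^2 <= N^2 and costs
   the factor e^3 of [inv_sqrt_c]. [f3] serves beyond: (1 + |y|^2)^-n is at most the product of the
   (1 + y_i^2)^-1, and the weights 4^-1 bring each one-dimensional integral down to pi / 4 < 1. *)
pose f1 (y : n.-tuple mR) := expR (- (\sum_i (tnth y i : R) ^+ 2) / 2).
pose f2 (y : n.-tuple mR) := \prod_i expR (- (c * (tnth y i : R) ^+ 2 + 2 * 0 * (tnth y i : R) + 0) / 2).
pose f3 (y : n.-tuple mR) := \prod_i (4^-1 * (1 + (tnth y i : R) ^+ 2)^-1).
have mt i : measurable_fun setT (fun y : n.-tuple mR => (tnth y i : R)).
  exact: measurable_tnth_fun.
have f1E y : (f1 y)%:E = (expR (- qf 1%:M (vec y) / 2))%:E.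
  rewrite /f1 qf1; congr (expR (- _ / 2))%:E.
  by apply: eq_bigr => i _; rewrite mxE.
have mf1 : measurable_fun setT (fun y => (f1 y)%:E).
  by under eq_fun do rewrite f1E; exact: measurable_Jint.
have mf2 : measurable_fun setT (fun y => (f2 y)%:E).
  apply/measurable_EFinP; apply: measurable_prod => i _.
  apply: measurableT_comp => //; apply: measurable_funM => //; apply: measurable_funN.
  by do 2!apply: measurable_funD => //; apply: measurable_funM => //; exact: measurable_funX.
have m1D : measurable_fun setT (fun x : mR => 4^-1 * (1 + x ^+ 2)^-1).
  apply: measurable_funM => //; apply: continuous_measurable_fun.
  exact: continuous_oneDsqrV.
have mf3 : measurable_fun setT (fun y => (f3 y)%:E).
  apply/measurable_EFinP; apply: measurable_prod => i _.
  have m2 := @measurable_tnth _ mR n i.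
  exact: (measurableT_comp m1D m2).
have f10 y : (0 <= (f1 y)%:E)%E by rewrite lee_fin expR_ge0.
have f20 y : (0 <= (f2 y)%:E)%E by rewrite lee_fin prodr_ge0// => i _; exact: expR_ge0.
have f30 y : (0 <= (f3 y)%:E)%E.
  by rewrite lee_fin prodr_ge0// => i _; rewrite mulr_ge0// invr_ge0 addr_ge0// sqr_ge0.
have I1 : (\int[lebesgue n]_y (f1 y)%:E = (gnorm n)%:E)%E.
  by under eq_integral do rewrite f1E; exact: Jint1.
have I2 : (\int[lebesgue n]_y (f2 y)%:E = (gnorm n * (Num.sqrt c)^-1 ^+ n)%:E)%E.
  rewrite (ge0_integral_prod_tnth (fun=> @lebesgue_measure R)
    (g := fun _ x => expR (- (c * x ^+ 2 + 2 * 0 * x + 0) / 2))).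
  - under eq_bigr do rewrite integral_gauss_quad//.
    rewrite prodEFin prodr_const card_ord -exprMn; congr (_ ^+ n)%:E.
    rewrite expr0n /= mul0r subrr mul0r expR0 mulr1 (sqrtrM c^-1).
      by rewrite (sqrtrV (ltW c0)).
    by rewrite mulr_ge0// pi_ge0.
  - by move=> _; have := measurable_gauss_quad c 0 0 => /measurable_EFinP.
  - by move=> _ x; exact: expR_ge0.
have I3 : (\int[lebesgue n]_y (f3 y)%:E <= 1)%E.
  rewrite (ge0_integral_prod_tnth (fun=> @lebesgue_measure R)
    (g := fun _ x => 4^-1 * (1 + x ^+ 2)^-1)).
  - have E x : x \in [set: mR] -> ((4^-1 * (1 + x ^+ 2)^-1)%:E = 4^-1%:E * ((1 + x ^+ 2)^-1)%:E :> \bar R)%E.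
      by rewrite EFinM.
    have -> : (\int[@lebesgue_measure R]_x (4^-1 * (1 + x ^+ 2)^-1)%:E = (4^-1 * pi)%:E)%E.
      under eq_integral do rewrite EFinM.
      rewrite ge0_integralZl ?integral_oneDsqr//.
      - apply/measurable_EFinP; apply: continuous_measurable_fun.
        exact: continuous_oneDsqrV.
      - by move=> x _; rewrite lee_fin invr_ge0 addr_ge0// sqr_ge0.
    rewrite prodEFin prodr_const card_ord lee_fin exprn_ile1//.
      by rewrite mulr_ge0// pi_ge0.
    by have := @pihalf_lt2 R; rewrite ltr_pdivrMr// => ?; rewrite ltW// mulrC ltr_pdivrMr//; lra.
  - by [].
  - by move=> _ x; rewrite mulr_ge0// invr_ge0 addr_ge0// sqr_ge0.
pose K2 := 2 * eps * N ^+ 2; pose K3 := (N ^+ 2)^-1.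
have K20 : 0 <= K2 by rewrite /K2 mulr_ge0 ?sqr_ge0// mulr_ge0.
have K30 : 0 <= K3 by rewrite /K3 invr_ge0 sqr_ge0.
have f2E y : f2 y = expR (- c * (\sum_i (tnth y i : R) ^+ 2) / 2).
  rewrite /f2 -expR_sum; congr expR.
  rewrite mulr_sumr mulr_suml; apply: eq_bigr => i _; ring.
have pw (y : n.-tuple mR) : phi_tail a (\sum_i (tnth y i : R) ^+ 2) <=
    f1 y + K2 * f2 y + K3 * f3 y.
  set r := \sum_i _.
  have r0 : 0 <= r by apply: sumr_ge0 => i _; exact: sqr_ge0.
  have := f10 y; have := f20 y; have := f30 y; rewrite !lee_fin => F3 F2 F1.
  have [rN|Nr] := leP r (N ^+ 2).
    apply: (le_trans (phi_tail_small r0 rN)).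
    by rewrite f2E -/r /f1 -/r lerDl mulr_ge0.
  apply: (le_trans (phi_tail_large (ltW Nr))).
  apply: (@le_trans _ _ (K3 * f3 y)); last first.
    by rewrite lerDr addr_ge0// mulr_ge0.
  rewrite ler_wpM2l// /f3 big_split/= prodr_const card_ord.
  rewrite ler_wpM2l// ?exprn_ge0//.
  rewrite -exprVn (_ : (1 + r)^-1 ^+ n = \prod_(i < n) (1 + r)^-1); last first.
    by rewrite prodr_const card_ord.
  apply: ler_prod => i _; rewrite invr_ge0 addr_ge0//=.
  rewrite lef_pV2 ?posrE ?ltr_pwDl ?sqr_ge0// lerD2l /r (bigD1 i)//= lerDl.
  by apply: sumr_ge0 => j _; exact: sqr_ge0.
have mphi : measurable_fun setT (fun y : n.-tuple mR =>
    (phi_tail a (\sum_i (tnth y i : R) ^+ 2))%:E).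
  apply/measurable_EFinP; apply: measurable_prod => k _.
  (* In this form measurability is a matter of composing [expR] and [ln]. *)
  have -> : (fun y : n.-tuple mR => (Num.sqrt (1 + a k ^+ 2 * \sum_i (tnth y i : R) ^+ 2))^-1) =
     (fun y => expR (- ln (1 + a k ^+ 2 * \sum_i (tnth y i : R) ^+ 2) / 2)).
    apply/funext => y; rewrite mulNr expRN expR_half lnK// posrE ltr_pwDl//.
    by rewrite mulr_ge0 ?sqr_ge0//; apply: sumr_ge0 => i _; exact: sqr_ge0.
  apply: measurableT_comp => //; apply: measurable_funM => //; apply: measurable_funN.
  apply: (measurableT_comp (@measurable_ln R)).
  apply: measurable_funD => //; apply: measurable_funM => //.
  by apply: measurable_sum => i; exact: measurable_funX.
have phi0 (r : R) : 0 <= phi_tail a r.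
  by apply: prodr_ge0 => k _; rewrite invr_ge0 sqrtr_ge0.
have step : (\int[lebesgue n]_y (phi_tail a (\sum_i (tnth y i : R) ^+ 2))%:E <=
   (gnorm n + K2 * (gnorm n * expR 3) + K3)%:E)%E.
  apply: (@le_trans _ _ (\int[lebesgue n]_y ((f1 y)%:E + K2%:E * (f2 y)%:E + K3%:E * (f3 y)%:E))%E).
    apply: ge0_le_integral => //.
    - by move=> y _; rewrite lee_fin.
    - apply: emeasurable_funD; last exact: measurable_funeM.
      by apply: emeasurable_funD => //; exact: measurable_funeM.
    - by move=> y _; rewrite -!EFinM -!EFinD lee_fin.
  have K2f y : (0 <= K2%:E * (f2 y)%:E)%E by rewrite mule_ge0.
  have K3f y : (0 <= K3%:E * (f3 y)%:E)%E by rewrite mule_ge0.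
  have mK2 : measurable_fun setT (fun y => K2%:E * (f2 y)%:E)%E by exact: measurable_funeM.
  have mK3 : measurable_fun setT (fun y => K3%:E * (f3 y)%:E)%E by exact: measurable_funeM.
  rewrite ge0_integralD//; last 2 first.
  - by move=> y _; rewrite adde_ge0.
  - exact: emeasurable_funD.
  rewrite ge0_integralD// !ge0_integralZl// I1 I2 -EFinM !EFinD.
  apply: leeD; last by rewrite -[leRHS]mule1; exact: lee_wpmul2l.
  by apply: leeD => //; rewrite lee_fin ler_wpM2l// ler_pM2l.
apply: le_trans (lee_wpmul2l _ step) _; first by rewrite lee_fin invr_ge0 ltW.
rewrite -EFinM lee_fin ler_pdivrMl// -/K3.
(* The third term does not scale with [gnorm n]; dividing it by [gnorm n >= 1] only helps. *)
have : K3 <= gnorm n * K3 by rewrite ler_peMl.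
rewrite /K2; move: (expR 3) (gnorm n) => x y; lra.
Qed.

End weights.
End tail_bounds.

(** * Entropy from the Donsker-Varadhan inequality *)

Section entropy_of_densities.
Context {R : realType} {d : measure_display} {S : measurableType d}.
Variables (m : {sigma_finite_measure set S -> \bar R}) (mu nu : probability S R).
Variables (f g : S -> R).
Hypothesis mf : measurable_fun setT f.
Hypothesis mg : measurable_fun setT g.
Hypothesis f0 : forall x, 0 <= f x.
Hypothesis g0 : forall x, 0 < g x.
Hypothesis muE : forall A, measurable A -> (mu A = \int[m]_(x in A) (f x)%:E)%E.
Hypothesis nuE : forall A, measurable A -> (nu A = \int[m]_(x in A) (g x)%:E)%E.

(** Taking G nonnegative loses nothing, because adding a constant to G shifts both sides equally,
    and it keeps the integrals within the nonnegative theory. *)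
Definition variational (B : R) := forall (G : S -> R) (c : R),
  measurable_fun setT G -> (forall x, 0 <= G x <= c) ->
  (\int[mu]_x (G x)%:E <= (ln (fine (\int[nu]_x (expR (G x))%:E)) + B)%:E)%E.

(** This is ln y <= y - 1 at y = b / a, multiplied by a. At a = 0 the value of [ln] at 0 is
    multiplied by 0. *)
Lemma xlnx_ge (a b : R) : 0 <= a -> 0 < b -> 0 <= a * ln (a / b) - a + b.
Proof.
move=> a0 b0; move: a0; rewrite le_eqVlt => /orP[/eqP <-|a0].
  by rewrite !mul0r subrr add0r ltW.
have ab : 0 < a / b by rewrite divr_gt0.
have ba : 0 < b / a by rewrite divr_gt0.
have h : ln (b / a) <= b / a - 1.
  by have := expR_ge1Dx (ln (b / a)); rewrite lnK ?posrE//; lra.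
have -> : ln (a / b) = - ln (b / a) by rewrite -lnV ?posrE// invf_div.
have := ler_wpM2l (ltW a0) h.
by rewrite mulrBr mulr1 mulrCA divff ?gt_eqF// mulr1 mulrN; lra.
Qed.

Let h x := f x / g x.

Let h0 x : 0 <= h x.
Proof. by rewrite divr_ge0// ltW. Qed.

Let fh x : f x = g x * h x.
Proof. by rewrite /h mulrCA divff ?mulr1// gt_eqF. Qed.

Lemma measurable_ratio : measurable_fun setT (fun x => f x / g x).
Proof.
apply: measurable_funM => //.
rewrite (_ : (fun x => _) = fun x => expR (- ln (g x))).
  by apply: measurableT_comp => //; apply: measurable_funN; apply: measurableT_comp.
by apply/funext => x; rewrite expRN lnK// posrE.
Qed.

(* Truncating the ratio [h] makes [ln h] an admissible test function; Fatou's
   lemma removes the truncation. *)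
Let clip (K x : R) : R := Num.min (Num.max x K^-1) K.

Let clip_ge (K x : R) : 1 < K -> K^-1 <= clip K x.
Proof.
move=> K1; rewrite le_min le_max lexx orbT /=.
by rewrite (@le_trans _ _ 1)// ?ltW// invf_lt1// (lt_trans _ K1).
Qed.

Let clip_le (K x : R) : clip K x <= K.
Proof. by rewrite ge_min lexx orbT. Qed.

Let clip_ub (K x : R) : 1 < K -> 0 <= x -> clip K x <= x + K^-1.
Proof.
move=> K1 x0; rewrite ge_min ge_max lerDl invr_ge0 (le_trans ler01 (ltW K1)) /=.
by rewrite lerDr x0.
Qed.

(** Up to K, clipping can only raise the argument of the logarithm, so the unclipped inequality
    carries over. Above K the logarithm is [ln K], which is at least 1 because e <= 4 <= K. *)
Let clip_xlnx (K x : R) : 4 <= K -> 0 <= x -> 0 <= x * ln (clip K x) - x + 1.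
Proof.
move=> K4 x0; have K1 : 1 < K by lra.
have K0 : 0 < K by lra.
have c0 : 0 < clip K x by rewrite (lt_le_trans _ (clip_ge x K1))// invr_gt0.
have [xK|Kx] := leP x K.
  have xc : x <= clip K x by rewrite le_min xK le_max lexx.
  move: x0; rewrite le_eqVlt => /orP[/eqP <-|x0].
    by rewrite mul0r subrr add0r.
  apply: le_trans (xlnx_ge (ltW x0) ltr01) _; rewrite divr1.
  rewrite lerD2r lerD2r; apply: ler_wpM2l; first exact: ltW.
  by rewrite ler_ln ?posrE.
have -> : clip K x = K by rewrite /clip min_r// le_max ltW.
have : 1 <= ln K.
  rewrite -[leLHS](@expRK R) ler_ln ?posrE ?expR_gt0//.
  apply: le_trans K4.
  (* From 1 - 1/2 <= exp (- 1/2) follows exp (1/2) <= 2, hence e <= 4. *)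
  have := expR_ge1Dx (- 2^-1 : R); rewrite expRN => h1.
  have e0 := expR_gt0 (2^-1 : R).
  have : expR 2^-1 * (1 + - 2^-1) <= expR 2^-1 * (expR 2^-1)^-1 :> R by rewrite ler_pM2l.
  rewrite divff ?gt_eqF// => h2.
  have -> : expR 1 = expR 2^-1 * expR 2^-1 :> R by rewrite -expRD; congr expR; field.
  move: e0 h2; move: (expR 2^-1) => x' *; nra.
move=> lK; have := ler_wpM2l x0 lK; rewrite mulr1; lra.
Qed.

Let mh : measurable_fun setT h. Proof. exact: measurable_ratio. Qed.

(** Since [f] and [g] both have mass 1, the added terms do not change the integral; they make the
    integrand nonnegative, as Fatou's lemma requires. *)
Let F (x : S) : R := f x * ln (f x / g x) - f x + g x.

Let F0 x : 0 <= F x. Proof. exact: xlnx_ge. Qed.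

Let mln_ratio : measurable_fun setT (fun x => f x * ln (f x / g x)).
Proof.
apply: measurable_funM => //.
exact: (measurableT_comp (@measurable_ln R) mh).
Qed.

Let mF : measurable_fun setT F.
Proof. by apply: measurable_funD => //; apply: measurable_funB. Qed.

Let If : (\int[m]_x (f x)%:E = 1)%E.
Proof. by rewrite -muE// probability_setT. Qed.

Let Ig : (\int[m]_x (g x)%:E = 1)%E.
Proof. by rewrite -nuE// probability_setT. Qed.

Let mclip K : measurable_fun setT (fun x => clip K (h x)).
Proof. by apply: measurable_minr => //; apply: measurable_maxr. Qed.

Let Fk (K : R) (x : S) : R := f x * ln (clip K (h x)) - f x + g x.

Let Fk0 K x : 4 <= K -> 0 <= Fk K x.
Proof.
move=> K4; rewrite /Fk fh.
have := mulr_ge0 (ltW (g0 x)) (clip_xlnx K4 (h0 x)).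
by congr (0 <= _); ring.
Qed.

Let mlnclip K : measurable_fun setT (fun x => ln (clip K (h x))).
Proof. exact: (measurableT_comp (@measurable_ln R) (mclip K)). Qed.

Let mFk K : measurable_fun setT (Fk K).
Proof.
apply: measurable_funD => //; apply: measurable_funB => //.
exact: measurable_funM.
Qed.

Let Fk_le (B K : R) : variational B -> 4 <= K ->
  (\int[m]_x (Fk K x)%:E <= (B + K^-1)%:E)%E.
Proof.
move=> var K4; have K1 : 1 < K by lra.
have K0 : 0 < K by lra.
(* The factor K makes the test function nonnegative and contributes [ln K] to both sides. Clipping
   from below raises the mean of K h by at most 1, so [Z] is at most K + 1 and the net error is ln
   (1 + 1 / K) <= 1 / K. *)
pose G x := ln (K * clip K (h x)).
have Kc x : 1 <= K * clip K (h x).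
  by rewrite -[leLHS](divff (lt0r_neq0 K0)) ler_pM2l//; exact: clip_ge.
have Kc0 x : 0 < K * clip K (h x) by rewrite (lt_le_trans ltr01).
have cl0 x : 0 < clip K (h x) by have := Kc0 x; rewrite pmulr_rgt0.
have mKc : measurable_fun setT (fun x => K * clip K (h x)).
  exact: measurable_funM.
have mG : measurable_fun setT G by exact: (measurableT_comp (@measurable_ln R) mKc).
have Gb x : 0 <= G x <= ln (K * K).
  by rewrite /G ln_ge0//= ler_ln ?posrE ?mulr_gt0// ler_pM2l.
have := var G _ mG Gb.
have -> : (\int[nu]_x (expR (G x))%:E = \int[nu]_x (K * clip K (h x))%:E)%E.
  by apply: eq_integral => x _; rewrite /G lnK// posrE.
set Z := (\int[nu]_x (K * clip K (h x))%:E)%E.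
have Ih : (\int[nu]_x (h x)%:E = 1)%E.
  rewrite (ge0_integral_density mg (fun x => ltW (g0 x)) nuE);
    [|exact/measurable_EFinP|by move=> x; rewrite lee_fin].
  by rewrite -If; apply: eq_integral => x _; rewrite -EFinM fh mulrC.
have ZK : (Z <= (K + 1)%:E)%E.
  apply: (@le_trans _ _ (\int[nu]_x (K%:E * (h x)%:E + 1%:E))%E).
    apply: ge0_le_integral => //.
    - by move=> x _; rewrite lee_fin ltW.
    - exact/measurable_EFinP.
    - apply: emeasurable_funD => //; apply: measurable_funeM; exact/measurable_EFinP.
    - move=> x _; rewrite -EFinM -EFinD lee_fin.
      have := ler_wpM2l (ltW K0) (clip_ub K1 (h0 x)).
      by rewrite mulrDr divff ?gt_eqF.
  rewrite ge0_integralD; [|by []|by move=> x _; apply: mule_ge0; rewrite lee_fin; [exact: ltW|exact: h0]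
    |by apply: measurable_funeM; exact/measurable_EFinP|by []|exact: measurable_cst].
  rewrite ge0_integralZl; [|by []|exact/measurable_EFinP
    |by move=> x _; rewrite lee_fin|by rewrite lee_fin ltW].
  by rewrite Ih mule1 (integral_cst_mass1 (probability_setT nu)).
have Z1 : (1 <= Z)%E.
  rewrite -(integral_cst_mass1 (probability_setT nu) 1); apply: ge0_le_integral => //.
  - exact/measurable_EFinP.
  - by move=> x _; rewrite lee_fin.
have Zfin : Z \is a fin_num.
  rewrite ge0_fin_numE ?(le_trans _ Z1)// ?lee_fin//.
  exact: le_lt_trans ZK (ltry _).
have fZ1 : 1 <= fine Z by rewrite -lee_fin fineK.
have fZK : fine Z <= K + 1 by rewrite -lee_fin fineK.
have lnZ : ln (fine Z) <= ln K + K^-1.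
  apply: (@le_trans _ _ (ln (K + 1))).
    have fZ0 : 0 < fine Z by exact: lt_le_trans ltr01 fZ1.
    have K10 : 0 < K + 1 by lra.
    by rewrite ler_ln ?posrE.
  have -> : K + 1 = K * (1 + K^-1) by rewrite mulrDr mulr1 divff ?gt_eqF.
  have K10 : 0 < 1 + K^-1 by rewrite addr_gt0 ?invr_gt0.
  rewrite lnM ?posrE// lerD2l.
  by have := expR_ge1Dx (ln (1 + K^-1)); rewrite lnK ?posrE//; lra.
have lK0 : 0 <= ln K by rewrite ln_ge0// ltW.
have mGE : measurable_fun setT (fun x => (G x)%:E) by exact/measurable_EFinP.
have GE0 x : (0 <= (G x)%:E)%E by rewrite lee_fin; case/andP: (Gb x).
have mfE : measurable_fun setT (fun x => (f x)%:E) by exact/measurable_EFinP.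
have mgE : measurable_fun setT (fun x => (g x)%:E) by exact/measurable_EFinP.
have mFkE : measurable_fun setT (fun x => (Fk K x)%:E) by exact/measurable_EFinP.
have eqI : (\int[m]_x (Fk K x)%:E + (1 + ln K)%:E = \int[mu]_x (G x)%:E + 1)%E.
  rewrite (ge0_integral_density mf f0 muE mGE GE0) -Ig.
  have -> : (1 + ln K)%:E = (\int[m]_x ((1 + ln K)%:E * (f x)%:E))%E.
    rewrite ge0_integralZl; [|by []|exact: mfE
      |by move=> x _; rewrite lee_fin|by rewrite lee_fin addr_ge0].
    by rewrite If mule1.
  rewrite -ge0_integralD; [|by []|by move=> x _; rewrite lee_fin; exact: Fk0|exact: mFkE
    |by move=> x _; rewrite mule_ge0 ?lee_fin ?addr_ge0|exact: measurable_funeM].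
  rewrite -ge0_integralD; [|by []|by move=> x _; rewrite mule_ge0 ?lee_fin//; case/andP: (Gb x)
    |exact: emeasurable_funM|by move=> x _; rewrite lee_fin ltW|exact: mgE].
  apply: eq_integral => x _; rewrite -!EFinM -!EFinD; congr EFin.
  by rewrite /Fk /G lnM ?posrE//; ring.
move=> DV; rewrite -(@leeD2rE _ (1 + ln K)%:E)// eqI.
apply: (le_trans (leeD2r _ DV)); rewrite -!EFinD lee_fin; lra.
Qed.

Let fatou_bound (B : R) : variational B -> (\int[m]_x (F x)%:E <= B%:E)%E.
Proof.
move=> var; pose K (n : nat) : R := (n + 4)%:R.
have K4 n : 4 <= K n by rewrite /K natrD lerDr.
have cvF x : limn_einf (fun n => (Fk (K n) x)%:E) = (F x)%:E.
  apply: (@cvg_limn_einf_sup _ _ _ _).1.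
  apply: cvg_near_cst.
  (* Beyond both h(x) and 1 / h(x) the clipping is inactive, so the sequence is eventually constant.
     Where h(x) = 0 the logarithm is multiplied by f(x) = 0. *)
  have [n0 n0P] : exists n0 : nat, h x <= n0%:R /\ (0 < h x -> (h x)^-1 <= n0%:R).
    exists (maxn (Num.bound (h x)) (Num.bound (h x)^-1)); split => [|hx0].
      by apply: (le_trans (ltW (archi_boundP (h0 x)))); rewrite ler_nat leq_maxl.
    have hi : 0 <= (h x)^-1 by rewrite invr_ge0.
    by apply: (le_trans (ltW (archi_boundP hi))); rewrite ler_nat leq_maxr.
  exists n0 => // n /= n0n; congr EFin; rewrite /Fk /F.
  have := h0 x; rewrite le_eqVlt => /orP[/eqP hx0|hx0].
    by rewrite fh -hx0 mulr0 !mul0r.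
  congr (_ * ln _ - _ + _); rewrite -/(h x) /clip.
  have nK : n0%:R <= K n by rewrite ler_nat (leq_trans n0n)// leq_addr.
  rewrite max_l; last first.
    rewrite -[leRHS]invrK lef_pV2 ?posrE ?invr_gt0//; last by have := K4 n; lra.
    by apply: le_trans nK; exact: n0P.2.
  by rewrite min_l// (le_trans _ nK)//; exact: n0P.1.
have -> : (\int[m]_x (F x)%:E = \int[m]_x limn_einf (fun n => (Fk (K n) x)%:E))%E.
  by apply: eq_integral => x _; rewrite cvF.
apply: (le_trans (fatou _ _ _ _)) => //.
- by move=> n; exact/measurable_EFinP.
- by move=> n x _; rewrite lee_fin; exact: Fk0.
rewrite limn_einf_lim; apply: lime_le; first exact: is_cvg_einfs.
(* An index k >= n with 1 / K k <= e bounds the infimum over the tail from n by B + e. *)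
apply: nearW => n; apply/lee_addgt0Pr => e e0.
pose k := maxn n (Num.bound e^-1).
apply: (@le_trans _ _ (\int[m]_x (Fk (K k) x)%:E)%E).
  by apply: ereal_inf_lbound; exists k => //=; rewrite leq_maxl.
apply: (le_trans (Fk_le var (K4 k))); rewrite -EFinD lee_fin lerD2l.
have ei : 0 <= e^-1 by rewrite invr_ge0 ltW.
rewrite -[leRHS]invrK lef_pV2 ?posrE ?invr_gt0//; last by have := K4 k; lra.
apply: (le_trans (ltW (archi_boundP ei))); rewrite ler_nat.
by rewrite (leq_trans (leq_maxr n _))// leq_addr.
Qed.

Lemma entropy_bounds (B : R) : variational B ->
  (0 <= \int[m]_x (f x * ln (f x / g x))%:E <= B%:E)%E.
Proof.
move=> var; have FB := fatou_bound var.
have int1 (p : S -> R) : measurable_fun setT p -> (forall x, 0 <= p x) ->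
    (\int[m]_x (p x)%:E < +oo)%E -> m.-integrable setT (fun x => (p x)%:E).
  move=> mp p0 poo; apply/integrableP; split; first exact/measurable_EFinP.
  by under eq_integral do rewrite gee0_abs ?lee_fin//.
have iF : m.-integrable setT (fun x => (F x)%:E).
  by apply: int1 => //; exact: le_lt_trans FB (ltry _).
have i_f : m.-integrable setT (fun x => (f x)%:E) by apply: int1 => //; rewrite If ltry.
have i_g : m.-integrable setT (fun x => (g x)%:E).
  by apply: int1 => // [x|]; [rewrite ltW|rewrite Ig ltry].
have -> : (\int[m]_x (f x * ln (f x / g x))%:E = \int[m]_x (F x)%:E)%E.
  transitivity (\int[m]_x ((F x)%:E + ((f x)%:E - (g x)%:E)))%E.
    by apply: eq_integral => x _; rewrite -EFinB -EFinD /F; congr EFin; ring.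
  rewrite integralD//; last exact: integrableB.
  by rewrite integralB// If Ig subee// adde0.
by rewrite FB andbT; apply: integral_ge0 => x _; rewrite lee_fin.
Qed.

End entropy_of_densities.

(** * Absolute continuity and the choice of densities *)

Section entropy_from_variational.
Context {R : realType}.

(** If nu A = 0 < mu A, the test function K 1_A gives K mu(A) <= B, since its exponential has
    integral 1 under [nu]. The choice K = (|B| + 1) / mu(A) contradicts this. *)
Lemma variational_null_dominates {d} {S : measurableType d}
    (mu nu : probability S R) (B : R) : variational mu nu B -> mu `<< nu.
Proof.
move=> var; apply/null_content_dominatesP => A mA nuA0.
have muAfin : mu A \is a fin_num by exact: fin_num_measure.
apply/eqP; rewrite eq_le measure_ge0 andbT leNgt; apply/negP => muA.
set r := fine (mu A).
have r0 : 0 < r by rewrite fine_gt0// muA ltey_eq muAfin.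
pose K := (`|B| + 1) / r.
have K0 : 0 <= K by rewrite divr_ge0 ?(ltW r0)// addr_ge0.
have e0 : 0 <= expR K - 1 by rewrite subr_ge0 -expR0 ler_expR.
have mI : measurable_fun setT (fun x => (\1_A x : R)%:E).
  by apply/measurable_EFinP; exact: measurable_indic.
have I0 x : (0 <= (\1_A x : R)%:E)%E by rewrite lee_fin.
have mG : measurable_fun setT (fun x => K * \1_A x : R).
  by apply: measurable_funM => //; exact: measurable_indic.
have Gb x : 0 <= K * \1_A x <= K.
  by rewrite indicE; case: (x \in A); rewrite ?mulr1 ?mulr0 lexx ?K0.
have := var _ _ mG Gb.
have -> : (\int[mu]_x (K * \1_A x)%:E = (K * r)%:E)%E.
  under eq_integral do rewrite EFinM.
  rewrite ge0_integralZl; [|by []|exact: mI|by move=> x _; exact: I0|by rewrite lee_fin].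
  by rewrite integral_indic// setIT [RHS]EFinM /r fineK.
have -> : (\int[nu]_x (expR (K * \1_A x))%:E = 1)%E.
  transitivity (\int[nu]_x (1 + (expR K - 1)%:E * (\1_A x : R)%:E))%E.
    apply: eq_integral => x _; rewrite -EFinM -EFinD indicE; congr EFin.
    by case: (x \in A) => /=; rewrite ?mulr1 ?mulr0 ?expR0 ?addr0// addrC subrK.
  rewrite ge0_integralD; [|by []|by []|exact: measurable_cst
    |by move=> x _; rewrite mule_ge0|exact: measurable_funeM].
  rewrite ge0_integralZl; [|by []|exact: mI|by move=> x _; exact: I0|by rewrite lee_fin].
  rewrite integral_indic// setIT nuA0 mule0 adde0.
  exact: (integral_cst_mass1 (probability_setT nu)).
rewrite /= ln1 add0r lee_fin /K divfK ?gt_eqF//.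
by have := ler_norm B; lra.
Qed.

(** The identity x^-1 = x exp (- ln (x^2)) also holds at 0, where the convention 0^-1 = 0 matches
    the factor x. *)
Lemma measurable_inv : measurable_fun setT (fun x : R => x^-1).
Proof.
rewrite (_ : (fun x => _) = fun x : R => x * expR (- ln (x ^+ 2))).
  apply: measurable_funM => //; apply: measurableT_comp => //.
  apply: measurable_funN; apply: measurableT_comp => //.
apply/funext => x; have [->|x0] := eqVneq x 0; first by rewrite invr0 mul0r.
rewrite expRN lnK; last by rewrite posrE exprn_even_gt0.
by rewrite expr2 invfM mulrA divff// mul1r.
Qed.

(** Radon-Nikodym derivatives are determined only almost everywhere, whereas [entropy_bounds] asks
    for densities that are nonnegative, respectively positive, at every point. The explicit Gaussian
    density and a nonnegative finite version for [mu] are used instead; they agree almost everywhere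
    with [density], so the integral is the same. *)
Lemma relative_entropy_bounds (N : nat)
    (mu nu : probability (N.-tuple (measurableTypeR R)) R) (B : R) :
  (forall A, measurable A -> nu A = gauss N A) -> variational mu nu B ->
  (0 <= relative_entropy mu nu <= B%:E)%E.
Proof.
move=> nuG var; have munu := variational_null_dominates var.
pose phi (t : N.-tuple (measurableTypeR R)) : R :=
  \prod_(i < N) normal_pdf 0 1 (tnth t i).
have phi_gt0 t : 0 < phi t.
  by apply: prodr_gt0 => i _; rewrite normal_pdf01E mulr_gt0 ?expR_gt0// invr_gt0 sqrtr_gt0 mulr_gt0// pi_gt0.
have mphi : measurable_fun setT phi.
  rewrite /phi; apply: measurable_prod => i _.
  apply: measurableT_comp; first exact: measurable_normal_pdf.
  exact: measurable_tnth.
have nuE A : measurable A -> (nu A = \int[lebesgue N]_(x in A) (phi x)%:E)%E.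
  move=> mA; rewrite nuG//.
  have -> : (gauss N A = \int[gauss N]_x (\1_A x)%:E)%E by rewrite integral_indic// setIT.
  rewrite ge0_integral_gauss_pdf; [|by apply/measurable_EFinP; exact: measurable_indic
    |by move=> x; rewrite lee_fin].
  rewrite [RHS]integral_mkcond; apply: eq_integral => x _.
  by rewrite epatch_indic/= muleC.
have nul : nu `<< lebesgue N.
  apply/null_content_dominatesP => A mA lA0; rewrite nuE//.
  by apply: null_set_integral => //; apply/measurable_EFinP; exact: measurable_funTS.
have mul := null_dominates_trans munu nul.
pose f x := fine (Radon_Nikodym_SigmaFinite.f mu (lebesgue N) x).
have fE x : (f x)%:E = Radon_Nikodym_SigmaFinite.f mu (lebesgue N) x.
  by rewrite /f fineK//; exact: Radon_Nikodym_SigmaFinite.f_fin_num.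
have f0 x : 0 <= f x by rewrite fine_ge0//; exact: Radon_Nikodym_SigmaFinite.f_ge0.
have mf : measurable_fun setT f.
  apply: measurableT_comp => //.
  exact: measurable_int (Radon_Nikodym_SigmaFinite.f_integrable mul).
have muE A : measurable A -> (mu A = \int[lebesgue N]_(x in A) (f x)%:E)%E.
  move=> mA; rewrite (Radon_Nikodym_SigmaFinite.f_integral mul)//.
  by apply: eq_integral => x _; rewrite fE.
have := entropy_bounds mf mphi f0 phi_gt0 muE nuE var.
suff -> : relative_entropy mu nu =
    (\int[lebesgue N]_x (f x * ln (f x / phi x))%:E)%E by [].
have m_int (p : probability (N.-tuple (measurableTypeR R)) R) : p `<< lebesgue N ->
    measurable_fun setT (density p).
  by move=> pl; apply: measurableT_comp.
rewrite /relative_entropy; case: pselect => [munu0 /=|] //.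
have dmu : ae_eq (lebesgue N) setT f (density mu).
  apply: filterS (ae_eq_Radon_Nikodym_SigmaFinite mul measurableT) => x /= h _.
  by rewrite /f h.
have dnu : ae_eq (lebesgue N) setT phi (density nu).
  have phiI : (lebesgue N).-integrable setT (fun x => (phi x)%:E).
    apply/integrableP; split; first exact/measurable_EFinP.
    under eq_integral do rewrite gee0_abs ?lee_fin ?ltW//.
    by rewrite -nuE// probability_setT ltry.
  have RNm := measurable_int _ (Radon_Nikodym_integrable (nu := charge_of_finite_measure nu) nul).
  apply: filterS (integral_ae_eq measurableT phiI RNm _) => [x /= h _|].
    by rewrite /density -h.
  move=> E _ mE; rewrite -nuE//.
  exact: (Radon_Nikodym_integral (nu := charge_of_finite_measure nu) nul mE).
apply: ae_eq_integral => //.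
- apply/measurable_EFinP; apply: measurable_funM; first exact: m_int.
  apply: measurableT_comp => //; apply: measurable_funM; first exact: m_int.
  by apply: measurableT_comp; [exact: measurable_inv|exact: m_int].
- apply/measurable_EFinP; apply: measurable_funM => //.
  apply: (measurableT_comp (@measurable_ln R)).
  exact: (measurable_ratio mf mphi phi_gt0).
- apply: filterS2 dmu dnu => x /= h1 h2 _.
  by rewrite h1// h2.
Qed.

End entropy_from_variational.

(** * Laws of the random matrices *)

Section laws.
Context {R : realType}.
Local Notation mR := (measurableTypeR R).
Local Notation N01 := (normal_prob (0 : R) 1).

Lemma prod_measure_map {d d' : measure_display} {T : measurableType d}
    {T' : measurableType d'} (k : nat)
    (m : 'I_k -> {sigma_finite_measure set T -> \bar R})
    (mu : 'I_k -> {sigma_finite_measure set T' -> \bar R}) (phi : 'I_k -> T -> T') :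
  (forall i, measurable_fun setT (phi i)) -> (forall i, mu i setT = 1%E) ->
  (forall i A, measurable A -> m i (phi i @^-1` A) = mu i A) ->
  forall A, measurable A ->
    prod_measure m ((fun t => [tuple phi i (tnth t i) | i < k]) @^-1` A) =
    prod_measure mu A.
Proof.
move=> mphi mu1 muE.
have ind : indep_family (prod_measure m) (fun i t => phi i (tnth t i)) mu.
  split=> [i||A mA]; first exact: (measurableT_comp (mphi i) (measurable_tnth i)).
    exact: mu1.
  transitivity (\prod_i m i (phi i @^-1` A i))%E.
    apply: (@prod_measure_box _ _ _ _ m (fun i => phi i @^-1` A i)) => i.
    by rewrite -[X in measurable X]setTI; exact: mphi.
  by apply: eq_bigr => i _; exact: muE.
move=> A mA; exact: (indep_family_prod_measure ind (s := id) (fun _ _ => id) mA).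
Qed.

(** For v = 0 the scaling map is constantly 0 and the image law is the Dirac measure, in agreement
    with [gaussian1]. For v > 0 it is a change of variables in the density. *)
Lemma gaussian1_scale (v : R) (A : set mR) : 0 <= v -> measurable A ->
  N01 ((fun x : mR => Num.sqrt v * x : mR) @^-1` A) = gaussian1 v A.
Proof.
move=> v0 mA; rewrite /gaussian1; case: (eqVneq v 0) => [->|vn0].
  rewrite sqrtr0 (_ : _ @^-1` A = if 0 \in A then setT else set0).
    rewrite /= diracE; case: ifP => _; last exact: measure0.
    exact: probability_setT.
  case: ifPn => [|] A0; apply/seteqP; split => x //=; rewrite mul0r.
    by move: A0; rewrite inE.
  by move: A0; rewrite notin_setE.
set s := Num.sqrt v; have s0 : 0 < s by rewrite sqrtr_gt0 lt0r vn0.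
have mB : measurable ((fun x : mR => s * x : mR) @^-1` A).
  by rewrite -[X in measurable X]setTI; exact: measurable_mulr.
have E (t : R) (B : set mR) : measurable B ->
    (normal_prob 0 t B = \int[lebesgue_measure]_x ((\1_B x)%:E * (normal_pdf 0 t x)%:E))%E.
  move=> mBB; rewrite -ge0_integral_normal_prob; [by rewrite integral_indic// setIT
    |by apply/measurable_EFinP; exact: measurable_indic|by move=> x; rewrite lee_fin].
apply: (etrans (E 1 _ mB)); apply: (etrans _ (esym (E s A mA))).
have mf : measurable_fun setT
    (fun x : mR => ((\1_A x : R)%:E * (normal_pdf 0 s x)%:E)%E).
  apply: emeasurable_funM; apply/measurable_EFinP; first exact: measurable_indic.
  exact: measurable_normal_pdf.
have f0 (x : mR) : (0 <= (\1_A x : R)%:E * (normal_pdf 0 s x)%:E)%E.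
  by rewrite -EFinM lee_fin mulr_ge0// normal_pdf_ge0.
apply: (etrans _ (ge0_integral_scale s0 mf f0)).
rewrite -ge0_integralZl; [|by []|exact: (measurableT_comp mf (measurable_mulr s))
  |by move=> x _; exact: f0|by rewrite lee_fin ltW].
apply: eq_integral => x _; rewrite -!EFinM; congr EFin.
rewrite mulrCA; congr (_ * _).
rewrite !normal_pdfE ?oner_eq0 ?gt_eqF// /normal_peak /normal_fun !subr0.
rewrite expr1n mul1r exprMn.
have -> : - (s ^+ 2 * x ^+ 2) / (s ^+ 2 *+ 2) = - x ^+ 2 / (1 *+ 2).
  by field; rewrite gt_eqF.
rewrite mulrA; congr (_ * _).
rewrite -mulrnAr sqrtrM ?sqr_ge0// sqrtr_sqr gtr0_norm// invfM mulrA divff ?mul1r//.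
by rewrite gt_eqF.
Qed.

Lemma gaussian_diag_scale (k : nat) (a : 'rV[R]_k) (A : set (k.-tuple mR)) :
  (forall j, 0 <= a 0 j) -> measurable A ->
  gauss k ((fun t => [tuple (Num.sqrt (a 0 j) * tnth t j : mR)%R | j < k]) @^-1` A) =
  gaussian_diag a A.
Proof.
move=> a0 mA.
pose phi (j : 'I_k) (x : mR) : mR := Num.sqrt (a 0 j) * x.
apply: (@prod_measure_map _ _ mR mR k (fun=> N01) (fun j => gaussian1 (a 0 j)) phi)
  mA => [j|j|j B mB].
- exact: measurable_mulr.
- rewrite -gaussian1_scale// preimage_setT; exact: probability_setT.
- exact: gaussian1_scale.
Qed.

Lemma mutually_independentT {d d' : measure_display}
    {T : measurableType d} {T' : measurableType d'} (P : probability T R)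
    (I : finType) (X : I -> {RV P >-> T'}) (A : I -> set T') :
  mutually_independent X -> (forall i, measurable (A i)) ->
  P [set w | forall i, A i (X i w)] = (\prod_i P (X i @^-1` A i))%E.
Proof.
move=> indX mA; have := indX [set: I]%SET A mA.
rewrite (_ : \bigcap_(i in _) _ = [set w | forall i, A i (X i w)]); last first.
  by apply/seteqP; split => [w H i|w H i _]; [apply: (H i); rewrite /= inE|exact: (H i)].
by move=> h; apply: (etrans h); apply: eq_bigl => i; rewrite inE.
Qed.

Lemma law_upper_gaussian {d} {T : measurableType d} (Q : probability T R) (n : nat)
    (M : random_matrix Q n n) : gaussian_symmetric_zero_diag M ->
  forall A, measurable A -> distribution Q (upper M) A = gauss #|above n| A.
Proof.
move=> [_ _ ind law] A mA.
have lawM (k : 'I_#|above n|) : has_law (M (enum_val k).1 (enum_val k).2) N01.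
  by apply: law; have := enum_valP k; rewrite inE.
have iF : indep_family Q
    (fun (k : 'I_#|above n|) w => M (enum_val k).1 (enum_val k).2 w : mR) (fun=> N01).
  split=> [k|k|B mB]; first exact: (measurable_funPT (M (enum_val k).1 (enum_val k).2)).
    exact: probability_setT.
  apply: (etrans (mutually_independentT ind mB)).
  by apply: eq_bigr => k _; exact: (lawM k (B k) (mB k)).
exact: (indep_family_prod_measure iF (s := id) (fun _ _ => id) mA).
Qed.

(** Row coordinates are sqrt (alpha_j) times standard Gaussians, and an off-diagonal entry
    multiplies two of them. The weights of the Gram entries are therefore alpha_j / |alpha|_2,
    without a square root. *)
Lemma law_upper_W {d} {T : measurableType d} (P : probability T R) (n k : nat)
    (a : 'rV[R]_k) (Y : random_matrix P n k) :
  (forall j, 0 <= a 0 j) -> iid_gaussian_rows a Y ->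
  forall A, measurable A ->
    distribution P (upper (W a Y)) A =
    gauss_rows n k (gram_tuple (fun j => a 0 j / lnorm 2 a)
      (enum_val : 'I_#|above n| -> 'I_n * 'I_n) @^-1` A).
Proof.
move=> a0 [ind law] A mA.
pose e : 'I_#|above n| -> 'I_n * 'I_n := enum_val.
pose F (r : n.-tuple (k.-tuple mR)) := gram_tuple (fun=> (lnorm 2 a)^-1) e r.
have mF : measurable_fun setT F by exact: measurable_gram_tuple.
pose Yt := select (fun i => random_tuple (Y i) : T -> _) (fun i : 'I_n => i).
have iF : indep_family P (fun i => random_tuple (Y i) : T -> _) (fun=> gaussian_diag a).
  split=> [i|i|B mB]; first exact: measurable_funPT.
    by rewrite -(law i)//; exact: probability_setT.
  apply: (etrans (mutually_independentT ind mB)).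
  by apply: eq_bigr => i _; exact: (law i (B i) (mB i)).
pose sc t := [tuple (Num.sqrt (a 0 j) * tnth t j : mR)%R | j < k].
have msc : measurable_fun setT sc.
  apply/measurable_fun_tnthP => j.
  rewrite (_ : _ \o _ = fun t => (Num.sqrt (a 0 j) * tnth t j : mR)%R).
    exact: (measurableT_comp (measurable_mulr _) (measurable_tnth j)).
  by apply/funext => t /=; rewrite tnth_mktuple.
have -> : distribution P (upper (W a Y)) A = P (Yt @^-1` (F @^-1` A)).
  congr (P _); apply/seteqP.
  suff UE w : upper (W a Y) w = F (Yt w) by split => w /=; rewrite -UE.
  apply: eq_from_tnth => m; rewrite !tnth_mktuple /gram_entry /W /= /Wentry /Wmx.
  have /negbTE mn : (enum_val m).1 != (enum_val m).2.
    by have := enum_valP m; rewrite inE; apply: contraTneq => ->; rewrite ltnn.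
  rewrite [LHS]mxE [X in _ + X]mxE [X in - X]mxE mn mulr0n oppr0 addr0 !mxE.
  rewrite mulr_sumr; apply: eq_bigr => l _.
  by rewrite !mxE -mulrA !tnth_mktuple.
have mFA : measurable (F @^-1` A) by rewrite -[X in measurable X]setTI; exact: mF.
rewrite (indep_family_prod_measure iF (s := id) (fun _ _ => id) mFA).
have gd1 : gaussian_diag a setT = 1%E.
  by rewrite -gaussian_diag_scale// preimage_setT; exact: gauss_setT.
have pm := @prod_measure_map _ _ _ _ n (fun=> gauss k) (fun=> gaussian_diag a)
  (fun=> sc) (fun=> msc) (fun=> gd1) (fun _ B mB => gaussian_diag_scale a0 mB) _ mFA.
apply: (etrans (esym pm)).
congr (gauss_rows n k _); apply/seteqP.
suff FE w : F [tuple sc (tnth w i)  | i < n] = gram_tuple (fun j => a 0 j / lnorm 2 a) e w.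
  by split => w /=; rewrite -FE.
apply: eq_from_tnth => m; rewrite !tnth_mktuple /gram_entry.
apply: eq_bigr => l _; rewrite !tnth_mktuple.
rewrite -[in RHS](sqr_sqrtr (a0 l)) expr2.
by rewrite -!mulrA mulrCA; congr (_ * _); rewrite !mulrA; congr (_ * _); ring.
Qed.

End laws.

(** * The explicit entropy bound and the limit *)

Section entropy_of_gram_matrix.
Context {R : realType}.
Local Notation mR := (measurableTypeR R).

Lemma lnorm_exprn (q k : nat) (a : 'rV[R]_k) : (0 < q)%N ->
  lnorm q%:R a ^+ q = \sum_j `|a 0 j| ^+ q.
Proof.
move=> q0; rewrite -powR_mulrn ?powR_ge0// /lnorm -powRrM mulVf ?pnatr_eq0 -?lt0n//.
rewrite powRr1; last by apply: sumr_ge0 => j _; exact: powR_ge0.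
by apply: eq_bigr => j _; rewrite powR_mulrn.
Qed.

Lemma variational_distribution {d d' : measure_display} {T : measurableType d}
    {T' : measurableType d'} (P : probability T R) (Q : probability T' R)
    (n k N : nat) (a : 'I_k -> R) (e : 'I_N -> 'I_n * 'I_n)
    (X : {RV P >-> N.-tuple mR}) (Z : {RV Q >-> N.-tuple mR}) (delta : R) :
  (forall A, measurable A ->
    distribution P X A = gauss_rows n k (gram_tuple a e @^-1` A)) ->
  (forall A, measurable A -> distribution Q Z A = gauss N A) ->
  injective e -> (forall m, (e m).1 < (e m).2)%N -> \sum_j a j ^+ 2 = 1 ->
  (\int[gauss_rows n k]_w (((gnorm n)^-1)%:E * Jint (rows_mx a w *m (rows_mx a w)^T)) <=
    (1 + delta)%:E)%E ->
  variational (distribution P X) (distribution Q Z) (n%:R * delta).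
Proof.
move=> XE ZE e_inj e_lt a_sqr Jle G c mG Gb.
have mGE : measurable_fun setT (fun x => (G x)%:E) by exact/measurable_EFinP.
have GE0 x : (0 <= (G x)%:E)%E by rewrite lee_fin; case/andP: (Gb x).
have -> : (\int[distribution P X]_x (G x)%:E =
    \int[gauss_rows n k]_w (G (gram_tuple a e w))%:E)%E.
  have mgr := @measurable_gram_tuple R n k N a e.
  pose hM := isMeasurableFun.Build _ _ _ _ (gram_tuple a e) mgr.
  pose H : {mfun _ >-> _} := HB.pack (gram_tuple a e) hM.
  transitivity (\int[pushforward (gauss_rows n k) H]_x (G x)%:E)%E.
    by apply: eq_measure_integral => A mA _; exact: XE.
  by rewrite (ge0_integral_pushforward mgr).
have -> : (\int[distribution Q Z]_x (expR (G x))%:E = \int[gauss N]_x (expR (G x))%:E)%E.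
  by apply: eq_measure_integral => A mA _; exact: ZE.
exact: (chain_bound e_inj e_lt a_sqr mG Gb Jle).
Qed.

(** The weights b = a / |a|_2 have unit norm, and the sum of the b_j^4 is [eps]. The upper bound is
    n times the cost of one column; the lower bound 0 serves the squeeze in the limit. *)
Lemma Ent_upper_bounds {d d' : measure_display} {T : measurableType d}
    {T' : measurableType d'} (P : probability T R) (Q : probability T' R)
    (n k : nat) (a : 'rV[R]_k) (Y : random_matrix P n k) (M : random_matrix Q n n)
    (eps := (lnorm 4 a / lnorm 2 a) ^+ 4) :
  (forall j, 0 <= a 0 j) -> a != 0 -> iid_gaussian_rows a Y ->
  gaussian_symmetric_zero_diag M -> (399 < n)%N -> n%:R ^+ 3 * eps <= 1 ->
  (0 <= Ent (upper (W a Y)) (upper M) <=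
    (n%:R * (2 * expR 3 * eps * n%:R ^+ 2 + n%:R ^- 2))%:E)%E.
Proof.
move=> a0 an0 hY hM n400 neps.
have l2 : lnorm 2 a ^+ 2 = \sum_j a 0 j ^+ 2.
  by rewrite lnorm_exprn//; apply: eq_bigr => j _; rewrite ger0_norm.
have l4 : lnorm 4 a ^+ 4 = \sum_j a 0 j ^+ 4.
  by rewrite lnorm_exprn//; apply: eq_bigr => j _; rewrite ger0_norm.
have l2n0 : lnorm 2 a != 0.
  apply: contra_neq an0 => l20; apply/rowP => j; rewrite mxE.
  move: l2; rewrite l20 expr0n /= => /esym/eqP.
  rewrite psumr_eq0 => [/allP/(_ j)|i _]; last exact: sqr_ge0.
  by rewrite mem_index_enum sqrf_eq0 => /(_ isT)/eqP.
pose b j := a 0 j / lnorm 2 a.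
have b2 : \sum_j b j ^+ 2 = 1.
  under eq_bigr do rewrite expr_div_n.
  by rewrite -mulr_suml -l2 divff// expf_neq0.
have b4 : \sum_j b j ^+ 4 = eps.
  under eq_bigr do rewrite expr_div_n.
  by rewrite -mulr_suml -l4 -expr_div_n.
pose e : 'I_#|above n| -> 'I_n * 'I_n := enum_val.
have e_lt m : ((e m).1 < (e m).2)%N by have := enum_valP m; rewrite inE.
have ZE := law_upper_gaussian hM.
apply: relative_entropy_bounds => //.
apply: (@variational_distribution _ _ _ _ P Q n k #|above n| b e) => //.
- exact: law_upper_W.
- exact: enum_val_inj.
- by rewrite -b4; apply: expectation_Jint_le => //; rewrite b4.
Qed.

End entropy_of_gram_matrix.

Theorem theorem4 (R : realType) (p : R) (hp : 0 < p < 1)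
    (d : nat -> nat) (alpha : forall n : nat, 'rV[R]_(d n))
    (alpha_ge0 : forall n (j : 'I_(d n)), 0 <= alpha n 0 j)
    (alpha_neq0 : forall n, alpha n != 0)
    (dT dS : nat -> measure_display)
    (T : forall n, measurableType (dT n)) (P : forall n, probability (T n) R)
    (Y : forall n, random_matrix (P n) n (d n))
    (hY : forall n, iid_gaussian_rows (alpha n) (Y n))
    (S : forall n, measurableType (dS n)) (Q : forall n, probability (S n) R)
    (M : forall n, random_matrix (Q n) n n)
    (hM : forall n, gaussian_symmetric_zero_diag (M n)) :
  (lnorm 2 (alpha n) / lnorm 4 (alpha n)) ^+ 4 / n%:R ^+ 3 @[n --> \oo]
    --> +oo ->
  Ent (upper (W (alpha n) (Y n))) (upper (M n)) @[n --> \oo] --> 0%E.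
Proof.
set r := fun n : nat => (lnorm 2 (alpha n) / lnorm 4 (alpha n)) ^+ 4 / n%:R ^+ 3.
move=> r_oo; have r1 : \forall n \near \oo, 1 <= r n by exact: (cvgryPge _).1.
have r_gt0 : \forall n \near \oo, 0 < r n.
  by apply: filterS r1 => n; exact: lt_le_trans.
have rV0 : (r n)^-1 @[n --> \oo] --> (0 : R).
  by apply: (gtr0_cvgV0 r_gt0).2 r_oo.
have nV0 : (n%:R : R)^-1 @[n --> \oo] --> (0 : R).
  by apply: (gtr0_cvgV0 _).2; [exists 1%N => // n; rewrite /= ltr0n|exact: cvgr_idn].
(* The majorant is the bound of [Ent_upper_bounds] with n^3 eps written as (r n)^-1. *)
apply: (squeeze_cvge (f := fun=> 0%E)
  (h := fun n => (2 * expR 3 * (r n)^-1 + n%:R^-1)%:E)).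
- near=> n.
  have n400 : (399 < n)%N by near: n; exists 400%N.
  have n0 : (n%:R : R) != 0 by rewrite pnatr_eq0 -lt0n (leq_trans _ n400).
  have rE : (r n)^-1 = n%:R ^+ 3 * (lnorm 4 (alpha n) / lnorm 2 (alpha n)) ^+ 4.
    by rewrite /r invfM invrK -exprVn invf_div mulrC.
  (* In terms of r this is r n >= 1, which holds eventually by [r1]. *)
  have neps : n%:R ^+ 3 * (lnorm 4 (alpha n) / lnorm 2 (alpha n)) ^+ 4 <= 1.
    by rewrite -rE invf_le1; near: n.
  have := Ent_upper_bounds (alpha_ge0 n) (alpha_neq0 n) (hY n) (hM n) n400 neps.
  suff -> (eps : R) : n%:R * (2 * expR 3 * eps * n%:R ^+ 2 + n%:R ^- 2) =
    2 * expR 3 * (n%:R ^+ 3 * eps) + n%:R^-1 by rewrite -rE.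
  by field.
- exact: cvg_cst.
- apply: cvg_EFin; first exact: nearW.
  rewrite -[X in _ --> X]addr0 -[X in X + _](mulr0 (2 * expR 3)).
  by apply: cvgD => //; apply: cvgMr.
Unshelve. all: by end_near. Qed.
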